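(* There is a constant $C$ such that for all $t>0$ and all functions $f=f(x,y)$ on $\mathbb R^3\times\mathbb R^3$ for which the right-hand sides are finite, $$\|e^{it(\Delta_x+\Delta_y)}f\|_{L^\infty(d(x-y))L^2(d(x+y))}\le\frac{C}{t^{3/2}}\|f\|_{L^1(dx)L^2(dy)}$$ and, similarly, $$\|e^{it(\Delta_x+\Delta_y)}f\|_{L^\infty(dx)L^2(dy)}\le\frac{C}{t^{3/2}}\|f\|_{L^1(d(x-y))L^2(d(x+y))}.$$
   Context: $\|f\|_{L^q(dx)L^2(dy)}$ takes first the $L^2$ norm in $y\in\mathbb R^3$, then the $L^q$ norm in $x\in\mathbb R^3$. $\|f\|_{L^q(d(x-y))L^2(d(x+y))}$ is the analogous norm of $f$ viewed as a function of $u=\frac{x-y}{\sqrt2}$ and $v=\frac{x+y}{\sqrt2}$ ($L^2$ in $v$, then $L^q$ in $u$). The propagator $e^{it(\Delta_x+\Delta_y)}$ is the free Schrödinger evolution on $\mathbb R^6$, extended by density from nice functions. *)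

(* Defs.v *)
From HB Require Import structures.
From mathcomp Require Import all_boot all_order all_algebra.
From mathcomp Require Import all_classical all_reals all_analysis.
From mathcomp Require Import complex.
Set Implicit Arguments.
Unset Strict Implicit.
Unset Printing Implicit Defensive.
Import Order.TTheory GRing.Theory Num.Theory.
Import numFieldNormedType.Exports.
Local Open Scope classical_set_scope.
Local Open Scope ring_scope.
Local Open Scope complex_scope.

(* R^3 carries the product (Borel) sigma-algebra; R^6 is R^3 * R^3. *)
Notation R1 R := (measurableTypeR R).
Notation R3 R := (R1 R * R1 R * R1 R)%type.
Notation R6 R := (R3 R * R3 R)%type.

(* The library proves that the product of two sigma-finite measures is
   sigma-finite, but that instance is shadowed by the one for subprobabilities,
   hence the explicit instances for the Lebesgue measures of R^2, R^3, R^6. *)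
Section product_sigma_finite.
Context d1 d2 (T1 : measurableType d1) (T2 : measurableType d2) (R : realType).
Variable m1 : {sigma_finite_measure set T1 -> \bar R}.
Variable m2 : {sigma_finite_measure set T2 -> \bar R}.
Local Open Scope ereal_scope.

Lemma sigma_finite_product : sigma_finite [set: T1 * T2] (m1 \x m2).
Proof.
have /sigma_finiteP[F [TF ndF Foo]] := sigma_finiteT m1.
have /sigma_finiteP[G [TG ndG Goo]] := sigma_finiteT m2.
exists (fun n => F n `*` G n).
  rewrite -setXTT TF TG predeqE => -[x y]; split.
    move=> [/= [n _ Fnx] [k _ Gky]]; exists (maxn n k) => //; split.
    - by move: x Fnx; exact/subsetPset/ndF/leq_maxl.
    - by move: y Gky; exact/subsetPset/ndG/leq_maxr.
  by move=> [n _ []/= ? ?]; split; exists n.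
move=> k; have [? ?] := Foo k; have [? ?] := Goo k.
split; first exact: measurableX.
by rewrite product_measure1E// lte_mul_pinfty// ge0_fin_numE.
Qed.

End product_sigma_finite.

Section lebesgue_spaces.
Context {R : realType}.

Definition leb2 : set (R1 R * R1 R) -> \bar R :=
  (@lebesgue_measure R \x @lebesgue_measure R)%E.
HB.instance Definition _ := Measure.copy leb2
  (@lebesgue_measure R \x @lebesgue_measure R)%E.
HB.instance Definition _ := Measure_isSigmaFinite.Build _ _ _ leb2
  (sigma_finite_product (@lebesgue_measure R) (@lebesgue_measure R)).

Definition leb3 : set (R3 R) -> \bar R := (leb2 \x @lebesgue_measure R)%E.
HB.instance Definition _ := Measure.copy leb3 (leb2 \x @lebesgue_measure R)%E.
HB.instance Definition _ := Measure_isSigmaFinite.Build _ _ _ leb3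
  (sigma_finite_product leb2 (@lebesgue_measure R)).

Definition leb6 : set (R6 R) -> \bar R := (leb3 \x leb3)%E.
HB.instance Definition _ := Measure.copy leb6 (leb3 \x leb3)%E.
HB.instance Definition _ := Measure_isSigmaFinite.Build _ _ _ leb6
  (sigma_finite_product leb3 leb3).

End lebesgue_spaces.

Section complex_valued.
Context {d : measure_display} {T : measurableType d} {R : realType}.
Implicit Type f : T -> R[i].

Definition cmeasurable f : Prop :=
  measurable_fun [set: T] (fun x => complex.Re (f x)) /\
  measurable_fun [set: T] (fun x => complex.Im (f x)).

Definition cintegrable (mu : {measure set T -> \bar R}) f : Prop :=
  mu.-integrable [set: T] (fun x => (complex.Re (f x))%:E) /\
  mu.-integrable [set: T] (fun x => (complex.Im (f x))%:E).

Definition cintegral (mu : {measure set T -> \bar R}) f : R[i] :=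
  Rintegral mu [set: T] (fun x => complex.Re (f x)) +i*
  Rintegral mu [set: T] (fun x => complex.Im (f x)).

End complex_valued.

Section free_evolution.
Context {R : realType}.
Implicit Types (t : R) (f g : R6 R -> R[i]).

Definition dot3 (x y : R3 R) : R :=
  x.1.1 * y.1.1 + x.1.2 * y.1.2 + x.2 * y.2.

Definition dot6 (z w : R6 R) : R := dot3 z.1 w.1 + dot3 z.2 w.2.

Definition expi (a : R) : R[i] := cos a +i* sin a.

Definition fourier f (p : R6 R) : R[i] :=
  cintegral leb6 (fun z => expi (- dot6 p z) * f z).

(* The Laplacian of R^6, Delta_x + Delta_y, has Fourier symbol - |p|^2, so the
   evolution operator is the Fourier multiplier exp (- i t |p|^2). *)
Definition schrodinger t f (z : R6 R) : R[i] :=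
  (((2 * pi) ^+ 6)^-1)%:C *
  cintegral leb6 (fun p => expi (dot6 p z) * expi (- (t * dot6 p p)) * fourier f p).

(* The functions for which both integrals above converge absolutely; they
   include the Schwartz functions. *)
Definition nice f : Prop := cintegrable leb6 f /\ cintegrable leb6 (fourier f).

Definition mixed_norm (q : \bar R) f : \bar R :=
  Lnorm leb3 q (fun x => Lnorm leb3 2%:E (fun y => (Normc.normc (f (x, y)))%:E)).

Definition add3 (x y : R3 R) : R3 R := (x.1.1 + y.1.1, x.1.2 + y.1.2, x.2 + y.2).
Definition sub3 (x y : R3 R) : R3 R := (x.1.1 - y.1.1, x.1.2 - y.1.2, x.2 - y.2).
Definition scale3 (a : R) (x : R3 R) : R3 R := (a * x.1.1, a * x.1.2, a * x.2).

(* f in the variables u = (x - y) / sqrt 2, v = (x + y) / sqrt 2, that is,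
   x = (u + v) / sqrt 2 and y = (v - u) / sqrt 2. *)
Definition in_diff_sum f (uv : R6 R) : R[i] :=
  f (scale3 (Num.sqrt 2)^-1 (add3 uv.1 uv.2),
     scale3 (Num.sqrt 2)^-1 (sub3 uv.2 uv.1)).

Definition norm_x_y (q : \bar R) f : \bar R := mixed_norm q f.
Definition norm_diff_sum (q : \bar R) f : \bar R := mixed_norm q (in_diff_sum f).

(* g represents the value at f of the extension by density, from the norm N to
   the norm M, of the operator schrodinger t on nice functions. *)
Definition evolves_to (N M : (R6 R -> R[i]) -> \bar R) t f g : Prop :=
  cmeasurable g /\
  exists f_ : nat -> R6 R -> R[i],
    [/\ forall n, nice (f_ n),
        N (fun z => f_ n z - f z) @[n --> \oo] --> 0%E &
        M (fun z => schrodinger t (f_ n) z - g z) @[n --> \oo] --> 0%E].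

End free_evolution.

(* Main.v *)
(* The evolution of a nice f is the integral of f against a Gaussian phase of
   modulus c t^-3, a product of six Fresnel integrals: the chirps cut off to
   [-n, n] converge boundedly, by an integration by parts.  In the variables
   rot sg (u, v), fix u and integrate the squared modulus of the evolution in v
   against a large window.  The quadratic phases in v cancel, so the v-integral
   is the Fourier transform of the window at a frequency proportional to
   sg (x - x') + (y - y').  For fixed x and x' its modulus is at most a product
   of Lorentzians whose integrals in y and in y' are O(t^3), so Schur's test in
   y and y' gives the bound t^-3 times the squared L^1 L^2 norm, for every u.

   Nice functions are dense in L^1 L^2: trapezoids approximate intervals, and the
   pi-lambda theorem and dominated convergence do the rest.  Along an
   approximating sequence that converges geometrically, the evolutions converge
   almost everywhere on every slice, and their limit is the extension.
   The second estimate is the first one for the opposite rotation, because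
   rotations preserve the Lebesgue measure and commute with the evolution. *)
Require Import Defs.
From HB Require Import structures.
From mathcomp Require Import all_boot all_order all_algebra.
From mathcomp Require Import all_classical all_reals all_analysis measurable_realfun ess_sup_inf.
From mathcomp Require Import complex.
From mathcomp Require Import ring lra.
Import Order.TTheory GRing.Theory Num.Theory.
Import numFieldNormedType.Exports.
Local Open Scope classical_set_scope.
Local Open Scope ring_scope.
Local Open Scope complex_scope.
Set Implicit Arguments.
Unset Strict Implicit.
Unset Printing Implicit Defensive.

(** The bound must not see the size of the window. The window is therefore a trapezoid whose plateau
    and slopes both scale with [n]: its Fourier transform is a product of two interval transforms,
    hence at most [24 n / (1 + (n xi)^2)], and the integral of this Lorentzian is [24 pi] for every
    [n]. The indicator of an interval would fail, since its transform is not absolutely integrable.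
    Fatou's lemma then removes the window. A function of finite L^1 L^2 norm can be neither
    integrable nor square integrable on R^6, so its evolution is given by no integral formula and
    has to be a limit. Since the bound for nice data holds for every [u], and not just for almost
    every [u], the Cauchy property in L^2(dv) holds on each slice separately, and Fatou's lemma
    shows that the pointwise limit is also the limit in norm. No constant is sharp: moduli of
    complex integrals are bounded through real and imaginary parts, and the Fresnel integrals enter
    only through a modulus. *)

Local Notation normc := Normc.normc.
Local Notation Re := complex.Re.
Local Notation Im := complex.Im.

(** * Measurability of explicit expressions *)

Section measurability.
Context {R : realType} d (T : measurableType d).
Context d1 d2 (T1 : measurableType d1) (T2 : measurableType d2).

Lemma measurable_fun_fst (f : T -> T1 * T2) :
  measurable_fun [set: T] f -> measurable_fun [set: T] (fun x => (f x).1).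
Proof. exact: (measurableT_comp measurable_fst). Qed.

Lemma measurable_fun_snd (f : T -> T1 * T2) :
  measurable_fun [set: T] f -> measurable_fun [set: T] (fun x => (f x).2).
Proof. exact: (measurableT_comp measurable_snd). Qed.

Lemma measurable_fun_cos (f : T -> R) :
  measurable_fun [set: T] f -> measurable_fun [set: T] (fun x => cos (f x)).
Proof.
move=> mf; apply: (measurableT_comp _ mf).
by apply: continuous_measurable_fun => x; exact: continuous_cos.
Qed.

Lemma measurable_fun_sin (f : T -> R) :
  measurable_fun [set: T] f -> measurable_fun [set: T] (fun x => sin (f x)).
Proof.
move=> mf; apply: (measurableT_comp _ mf).
by apply: continuous_measurable_fun => x; exact: continuous_sin.
Qed.

Lemma measurable_fun_opp (f : T -> R) :
  measurable_fun [set: T] f -> measurable_fun [set: T] (fun x => - f x).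
Proof. exact: measurableT_comp. Qed.

Lemma measurable_fun_sqrt (f : T -> R) :
  measurable_fun [set: T] f -> measurable_fun [set: T] (fun x => Num.sqrt (f x)).
Proof.
move=> mf; apply: (measurableT_comp _ mf).
by apply: continuous_measurable_fun => x; exact: sqrt_continuous.
Qed.

End measurability.

Ltac mfun_step :=
  lazymatch goal with
  | |- measurable_fun _ (fun x => (_, _)) => apply: measurable_fun_pair
  | |- measurable_fun _ (fun x => fst (@?f x)) => apply: measurable_fun_fst
  | |- measurable_fun _ (fun x => snd (@?f x)) => apply: measurable_fun_snd
  | |- measurable_fun _ (fun x => cos (@?f x)) => apply: measurable_fun_cos
  | |- measurable_fun _ (fun x => sin (@?f x)) => apply: measurable_fun_sin
  | |- measurable_fun _ (fun x => GRing.add (@?f x) (GRing.opp (@?g x))) =>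
      apply: measurable_funB
  | |- measurable_fun _ (fun x => GRing.add (@?f x) (@?g x)) => apply: measurable_funD
  | |- measurable_fun _ (fun x => GRing.mul (@?f x) (@?g x)) => apply: measurable_funM
  | |- measurable_fun _ (fun x => GRing.opp (@?f x)) => apply: measurable_fun_opp
  | |- measurable_fun _ (fun x => GRing.exp (@?f x) _) => apply: measurable_funX
  | |- measurable_fun _ (fun x => Num.sqrt (@?f x)) => apply: measurable_fun_sqrt
  | |- measurable_fun _ (fun x => ?c) => exact: measurable_cst
  | |- measurable_fun _ (fun x => x) => exact: measurable_id
  | |- measurable_fun _ _ => assumption
  (* An implication is the unfolded form of [measurable_fun], folded back so that the rules above
     can match it. *)
  | |- _ -> _ => rewrite -/(measurable_fun _ _)
  end.
Ltac mfun := repeat mfun_step.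

Section measurability_R6.
Context {R : realType} d (T : measurableType d).

Lemma measurable_add3 (f g : T -> R3 R) :
  measurable_fun [set: T] f -> measurable_fun [set: T] g ->
  measurable_fun [set: T] (fun x => add3 (f x) (g x)).
Proof. by move=> mf mg; rewrite /add3; mfun. Qed.

Lemma measurable_sub3 (f g : T -> R3 R) :
  measurable_fun [set: T] f -> measurable_fun [set: T] g ->
  measurable_fun [set: T] (fun x => sub3 (f x) (g x)).
Proof. by move=> mf mg; rewrite /sub3; mfun. Qed.

Lemma measurable_scale3 (a : R) (f : T -> R3 R) :
  measurable_fun [set: T] f -> measurable_fun [set: T] (fun x => scale3 a (f x)).
Proof. by move=> mf; rewrite /scale3; mfun. Qed.

Lemma measurable_dot6 (f g : T -> R6 R) :
  measurable_fun [set: T] f -> measurable_fun [set: T] g ->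
  measurable_fun [set: T] (fun x => dot6 (f x) (g x)).
Proof. by move=> mf mg; rewrite /dot6 /dot3; mfun. Qed.

Definition sub6 (z w : R6 R) : R6 R := (sub3 z.1 w.1, sub3 z.2 w.2).

Lemma measurable_sub6 (f g : T -> R6 R) :
  measurable_fun [set: T] f -> measurable_fun [set: T] g ->
  measurable_fun [set: T] (fun x => sub6 (f x) (g x)).
Proof.
by move=> mf mg; apply: measurable_fun_pair; apply: measurable_sub3; mfun.
Qed.

End measurability_R6.

Ltac mfun6 := repeat
  lazymatch goal with
  | |- measurable_fun _ (fun x => add3 (@?f x) (@?g x)) => apply: measurable_add3
  | |- measurable_fun _ (fun x => sub3 (@?f x) (@?g x)) => apply: measurable_sub3
  | |- measurable_fun _ (fun x => scale3 _ (@?g x)) => apply: measurable_scale3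
  | |- measurable_fun _ (fun x => dot6 (@?f x) (@?g x)) => apply: measurable_dot6
  | |- measurable_fun _ (fun x => sub6 (@?f x) (@?g x)) => apply: measurable_sub6
  | |- measurable_fun _ (dot6 ?z) => apply: (measurable_dot6 (f := fun=> z))
  | |- measurable_fun _ (sub6 ?z) => apply: (measurable_sub6 (f := fun=> z))
  | |- _ => mfun_step
  end.

(** * Complex-valued integrals *)

Section complex_modulus.
Context {R : realType}.
Implicit Types z w : R[i].

Lemma normcE z : normc z = Num.sqrt (Re z ^+ 2 + Im z ^+ 2).
Proof. by case: z. Qed.

Lemma normc_ge0 z : 0 <= normc z.
Proof. by rewrite normcE sqrtr_ge0. Qed.

Lemma normc_sqr z : normc z ^+ 2 = Re z ^+ 2 + Im z ^+ 2.
Proof. by rewrite normcE sqr_sqrtr// addr_ge0// sqr_ge0. Qed.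

Lemma normc_Re z : `|Re z| <= normc z.
Proof.
by rewrite normcE -sqrtr_sqr ler_wsqrtr// lerDl sqr_ge0.
Qed.

Lemma normc_Im z : `|Im z| <= normc z.
Proof.
by rewrite normcE -sqrtr_sqr ler_wsqrtr// lerDr sqr_ge0.
Qed.

Lemma normc_le z : normc z <= `|Re z| + `|Im z|.
Proof.
rewrite normcE -[leRHS]ger0_norm ?addr_ge0// -sqrtr_sqr ler_wsqrtr//.
rewrite sqrrD !real_normK ?num_real// lerD2r// lerDl.
by rewrite mulrn_wge0// mulr_ge0.
Qed.

Lemma normc_realC (x : R) : normc (x%:C) = `|x|.
Proof. by rewrite normcE /= expr0n addr0 sqrtr_sqr. Qed.

Lemma normc_expi (a : R) : normc (expi a) = 1.
Proof. by rewrite normcE /= cos2Dsin2 sqrtr1. Qed.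

Lemma normc_conj z : normc z^*%C = normc z.
Proof. by case: z => a b /=; rewrite sqrrN. Qed.

Lemma normcD z w : normc (z + w) <= normc z + normc w.
Proof. exact: (@le_normcD R z w). Qed.

Lemma normcBC z w : normc (z - w) = normc (w - z).
Proof. by rewrite -[LHS](@normcN R) opprB. Qed.

Lemma expiD (a b : R) : expi (a + b) = expi a * expi b.
Proof.
by apply/eqP; rewrite eq_complex /= cosD sinD eqxx /= addrC [X in _ + X]mulrC.
Qed.

Lemma conj_expi (a : R) : (expi a)^*%C = expi (- a).
Proof. by rewrite /expi cosN sinN. Qed.

Lemma ReM z w : Re (z * w) = Re z * Re w - Im z * Im w.
Proof. by case: z => a b; case: w. Qed.

Lemma ImM z w : Im (z * w) = Re z * Im w + Im z * Re w.
Proof. by case: z => a b; case: w => c d. Qed.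

Lemma ReD z w : Re (z + w) = Re z + Re w.
Proof. by case: z => a b; case: w. Qed.

Lemma ImD z w : Im (z + w) = Im z + Im w.
Proof. by case: z => a b; case: w. Qed.

Lemma ReB z w : Re (z - w) = Re z - Re w.
Proof. by case: z => a b; case: w. Qed.

Lemma ImB z w : Im (z - w) = Im z - Im w.
Proof. by case: z => a b; case: w. Qed.

Lemma complex_eq z w : Re z = Re w -> Im z = Im w -> z = w.
Proof. by case: z => a b; case: w => c d /= -> ->. Qed.

End complex_modulus.

Section cmeasurable_theory.
Context d (T : measurableType d) (R : realType).
Implicit Types f g : T -> R[i].

Lemma cmeasurable_normc f : cmeasurable f ->
  measurable_fun [set: T] (fun x => normc (f x)).
Proof.
move=> [mr mi]; under eq_fun do rewrite normcE.
by mfun.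
Qed.

Lemma cmeasurable_cst (c : R[i]) : cmeasurable (fun _ : T => c).
Proof. by split; mfun. Qed.

Lemma cmeasurableD f g : cmeasurable f -> cmeasurable g ->
  cmeasurable (fun x => f x + g x).
Proof.
move=> [? ?] [? ?]; split.
- by under eq_fun do rewrite ReD; mfun.
- by under eq_fun do rewrite ImD; mfun.
Qed.

Lemma cmeasurableB f g : cmeasurable f -> cmeasurable g ->
  cmeasurable (fun x => f x - g x).
Proof.
move=> [? ?] [? ?]; split.
- by under eq_fun do rewrite ReB; mfun.
- by under eq_fun do rewrite ImB; mfun.
Qed.

Lemma cmeasurableM f g : cmeasurable f -> cmeasurable g ->
  cmeasurable (fun x => f x * g x).
Proof.
move=> [? ?] [? ?]; split.
- by under eq_fun do rewrite ReM; mfun.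
- by under eq_fun do rewrite ImM; mfun.
Qed.

Lemma cmeasurable_conj f : cmeasurable f -> cmeasurable (fun x => (f x)^*%C).
Proof.
move=> [? ?]; split.
- by rewrite (_ : (fun x => _) = (fun x => Re (f x)))//; apply/funext => x /=; case: (f x).
- by rewrite (_ : (fun x => _) = fun x => - Im (f x)); [mfun|apply/funext => x /=; case: (f x)].
Qed.

Lemma cmeasurable_realC (f : T -> R) : measurable_fun [set: T] f ->
  cmeasurable (fun x => (f x)%:C).
Proof. by move=> mf; split => //=; mfun. Qed.

Lemma cmeasurable_expi (f : T -> R) : measurable_fun [set: T] f ->
  cmeasurable (fun x => expi (f x)).
Proof. by move=> mf; split => /=; mfun. Qed.

Lemma cmeasurable_comp d' (T' : measurableType d') (h : T' -> T) f :
  measurable_fun [set: T'] h -> cmeasurable f -> cmeasurable (fun x => f (h x)).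
Proof. by move=> mh [mr mi]; split; [exact: measurableT_comp mr mh|exact: measurableT_comp mi mh]. Qed.

End cmeasurable_theory.

Section cintegrable_theory.
Context d (T : measurableType d) (R : realType).
Variable mu : {measure set T -> \bar R}.
Implicit Types f g : T -> R[i].
Local Open Scope ereal_scope.

Lemma cmeasurable_normE f : cmeasurable f ->
  measurable_fun [set: T] (fun x => (normc (f x))%:E).
Proof. by move=> mf; apply/measurable_EFinP; exact: cmeasurable_normc. Qed.

(** Reduces integrability to the modulus, the form in which domination and Tonelli are applied
    below. *)
Lemma cintegrableP f : cintegrable mu f <->
  cmeasurable f /\ \int[mu]_x (normc (f x))%:E < +oo.
Proof.
split=> [[iR iI]|[mf foo]].
  have mR : measurable_fun [set: T] (fun x => Re (f x)).
    exact/measurable_EFinP/(measurable_int _ iR).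
  have mI : measurable_fun [set: T] (fun x => Im (f x)).
    exact/measurable_EFinP/(measurable_int _ iI).
  split; first by [].
  apply: (@le_lt_trans _ _ (\int[mu]_x (`|(Re (f x))%:E| + `|(Im (f x))%:E|))).
    apply: ge0_le_integral => //.
    - by move=> x _; rewrite lee_fin normc_ge0.
    - exact: cmeasurable_normE.
    - by apply: emeasurable_funD; apply: measurableT_comp => //;
        exact/measurable_EFinP.
    - by move=> x _; rewrite -EFinD lee_fin normc_le.
  rewrite ge0_integralD//; last 2 first.
  - by apply: measurableT_comp => //; exact/measurable_EFinP.
  - by apply: measurableT_comp => //; exact/measurable_EFinP.
  by rewrite lte_add_pinfty//; [case/integrableP: iR|case/integrableP: iI].
have [mR mI] := mf; split; apply/integrableP; split; try exact/measurable_EFinP.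
- apply: le_lt_trans foo; apply: ge0_le_integral => //.
  + by apply: measurableT_comp => //; exact/measurable_EFinP.
  + exact: cmeasurable_normE.
  + by move=> x _; rewrite lee_fin normc_Re.
- apply: le_lt_trans foo; apply: ge0_le_integral => //.
  + by apply: measurableT_comp => //; exact/measurable_EFinP.
  + exact: cmeasurable_normE.
  + by move=> x _; rewrite lee_fin normc_Im.
Qed.

Lemma cintegrable_cmeasurable f : cintegrable mu f -> cmeasurable f.
Proof. by case/cintegrableP. Qed.

Lemma cintegrable_lty f : cintegrable mu f -> \int[mu]_x (normc (f x))%:E < +oo.
Proof. by case/cintegrableP. Qed.

Lemma cintegrable_norm f : cintegrable mu f ->
  mu.-integrable [set: T] (fun x => (normc (f x))%:E).
Proof.
case/cintegrableP => mf foo; apply/integrableP; split.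
  exact: cmeasurable_normE.
by under eq_integral do rewrite gee0_abs ?lee_fin ?normc_ge0//.
Qed.

Lemma cintegrable_normZ f (k : R) : cintegrable mu f ->
  mu.-integrable [set: T] (EFin \o (fun x => (k * normc (f x))%R)).
Proof.
move=> fi.
have -> : EFin \o (fun x => (k * normc (f x))%R) = fun x => k%:E * (normc (f x))%:E.
  by apply/funext => x; rewrite /= EFinM.
by apply: integrableZl => //; exact: cintegrable_norm.
Qed.

Lemma cintegrable_dominated f (g : T -> R) : cmeasurable f ->
  mu.-integrable [set: T] (fun x => (g x)%:E) ->
  (forall x, (normc (f x) <= g x)%R) -> cintegrable mu f.
Proof.
move=> mf ig fg; apply/cintegrableP; split => //.
case/integrableP: (ig) => mg; apply: le_lt_trans; apply: ge0_le_integral => //.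
- by move=> x _; rewrite lee_fin normc_ge0.
- exact: cmeasurable_normE.
- exact: measurableT_comp.
- by move=> x _; rewrite lee_fin (le_trans (fg x))// ler_norm.
Qed.

Lemma cintegrable_le f g (M : R) : cmeasurable f -> cintegrable mu g ->
  (forall x, (normc (f x) <= M * normc (g x))%R) -> cintegrable mu f.
Proof.
move=> mf ig fg; apply: (@cintegrable_dominated _ (fun x => M * normc (g x))%R) => //.
under eq_fun do rewrite EFinM.
by apply: integrableZl => //; exact: cintegrable_norm.
Qed.

Lemma cintegrableM_bounded f g (M : R) : cmeasurable f -> cintegrable mu g ->
  (forall x, (normc (f x) <= M)%R) -> cintegrable mu (fun x => (f x * g x)%R).
Proof.
move=> mf ig fM; apply: (@cintegrable_le _ g M) => //.
  by apply: cmeasurableM => //; exact: cintegrable_cmeasurable ig.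
by move=> x; rewrite Normc.normcM ler_wpM2r ?normc_ge0.
Qed.

Lemma cintegrableZ f (c : R[i]) : cintegrable mu f ->
  cintegrable mu (fun x => (c * f x)%R).
Proof. by move=> fi; apply: (@cintegrableM_bounded _ _ (normc c)) => //; exact: cmeasurable_cst. Qed.

Lemma cintegrableD f g : cintegrable mu f -> cintegrable mu g ->
  cintegrable mu (fun x => (f x + g x)%R).
Proof.
move=> [fR fI] [gR gI]; split.
- by under eq_fun do rewrite ReD EFinD; exact: integrableD.
- by under eq_fun do rewrite ImD EFinD; exact: integrableD.
Qed.

Lemma cintegrableB f g : cintegrable mu f -> cintegrable mu g ->
  cintegrable mu (fun x => (f x - g x)%R).
Proof.
move=> [fR fI] [gR gI]; split.
- by under eq_fun do rewrite ReB EFinB; exact: integrableB.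
- by under eq_fun do rewrite ImB EFinB; exact: integrableB.
Qed.

Lemma cintegrable_conj f : cintegrable mu f -> cintegrable mu (fun x => (f x)^*%C).
Proof.
move=> fi; apply: (@cintegrable_le _ f 1%R) => //.
  exact/cmeasurable_conj/cintegrable_cmeasurable.
by move=> x; rewrite normc_conj mul1r.
Qed.

Lemma eq_cintegral f g : f =1 g -> cintegral mu f = cintegral mu g.
Proof. by move=> /funext ->. Qed.

Lemma cintegralZ f (c : R[i]) : cintegrable mu f ->
  cintegral mu (fun x => (c * f x)%R) = (c * cintegral mu f)%R.
Proof.
move=> [fR fI]; rewrite /cintegral; apply: complex_eq.
- rewrite ReM /=; under eq_Rintegral do rewrite ReM.
  have i1 k : mu.-integrable setT (fun x => (k * Re (f x))%:E).
    by under eq_fun do rewrite EFinM; exact: integrableZl.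
  have i2 k : mu.-integrable setT (fun x => (k * Im (f x))%:E).
    by under eq_fun do rewrite EFinM; exact: integrableZl.
  by rewrite RintegralB//; [rewrite !RintegralZl|exact: i1|exact: i2].
- rewrite ImM /=; under eq_Rintegral do rewrite ImM.
  have i1 k : mu.-integrable setT (fun x => (k * Re (f x))%:E).
    by under eq_fun do rewrite EFinM; exact: integrableZl.
  have i2 k : mu.-integrable setT (fun x => (k * Im (f x))%:E).
    by under eq_fun do rewrite EFinM; exact: integrableZl.
  by rewrite RintegralD//; [rewrite !RintegralZl|exact: i2|exact: i1].
Qed.

Lemma cintegralD f g : cintegrable mu f -> cintegrable mu g ->
  cintegral mu (fun x => (f x + g x)%R) = (cintegral mu f + cintegral mu g)%R.
Proof.
move=> [fR fI] [gR gI]; rewrite /cintegral; apply: complex_eq => /=.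
- by under eq_Rintegral do rewrite ReD; exact: RintegralD.
- by under eq_Rintegral do rewrite ImD; exact: RintegralD.
Qed.

Lemma cintegralB f g : cintegrable mu f -> cintegrable mu g ->
  cintegral mu (fun x => (f x - g x)%R) = (cintegral mu f - cintegral mu g)%R.
Proof.
move=> [fR fI] [gR gI]; rewrite /cintegral; apply: complex_eq => /=.
- by under eq_Rintegral do rewrite ReB; exact: RintegralB.
- by under eq_Rintegral do rewrite ImB; exact: RintegralB.
Qed.

Lemma cintegral_conj f : cintegrable mu f ->
  cintegral mu (fun x => (f x)^*%C) = (cintegral mu f)^*%C.
Proof.
move=> [fR fI]; rewrite /cintegral /=; apply: complex_eq => /=.
- by apply: eq_Rintegral => x _; case: (f x).
- rewrite -mulN1r -RintegralZl//; apply: eq_Rintegral => x _.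
  by rewrite mulN1r; case: (f x).
Qed.

(* The factor 2, due to treating real and imaginary parts separately, is harmless. *)
Lemma normc_cintegral_le f : cintegrable mu f ->
  (normc (cintegral mu f))%:E <= 2%:E * \int[mu]_x (normc (f x))%:E.
Proof.
move=> fi; have [fR fI] := fi; have [mf foo] := (cintegrableP _).1 fi.
have bnd (h : T -> R) : mu.-integrable [set: T] (fun x => (h x)%:E) ->
    (forall x, `|h x|%R <= normc (f x))%R ->
    `|Rintegral mu [set: T] h|%:E <= \int[mu]_x (normc (f x))%:E.
  move=> ih hf; rewrite EFin_normr_Rintegral//.
  apply: le_trans (le_abse_integral _ _ _) _ => //; first exact: measurable_int ih.
  apply: ge0_le_integral => //.
  - by apply: measurableT_comp => //; exact: measurable_int ih.
  - exact: cmeasurable_normE.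
  - by move=> x _; rewrite lee_fin hf.
apply: (@le_trans _ _ (`|Re (cintegral mu f)|%:E + `|Im (cintegral mu f)|%:E)).
  by rewrite -EFinD lee_fin normc_le.
rewrite mule_natl mule2n leeD//; apply: bnd => // x; [exact: normc_Re|exact: normc_Im].
Qed.

End cintegrable_theory.

(** * Fubini for complex-valued functions *)

Section cfubini.
Context d1 d2 (T1 : measurableType d1) (T2 : measurableType d2) (R : realType).
Variable m1 : {sigma_finite_measure set T1 -> \bar R}.
Variable m2 : {sigma_finite_measure set T2 -> \bar R}.
Local Open Scope ereal_scope.

(** Sections of an integrable function are integrable only for almost every [x]; elsewhere [fine]
    may turn an infinite inner integral into 0, but only on a null set, which the outer integral
    ignores. *)
Lemma Rintegral_fubini1 (f : T1 * T2 -> R) :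
  (m1 \x m2).-integrable [set: T1 * T2] (EFin \o f) ->
  Rintegral (m1 \x m2) [set: T1 * T2] f =
  Rintegral m1 [set: T1] (fun x => Rintegral m2 [set: T2] (fun y => f (x, y))).
Proof.
move=> fi; rewrite /Rintegral -(integral12_prod_meas1 fi); congr fine.
apply: ae_eq_integral => //.
- exact: (measurable_fubini_F fi).
- apply/measurable_EFinP; apply: measurableT_comp => //.
  exact: (measurable_fubini_F fi).
- have := ae_integrable1 fi; apply: filterS => x ix _.
  by rewrite fineK//; exact: integrable_fin_num.
Qed.

Lemma Rintegral_fubini2 (f : T1 * T2 -> R) :
  (m1 \x m2).-integrable [set: T1 * T2] (EFin \o f) ->
  Rintegral (m1 \x m2) [set: T1 * T2] f =
  Rintegral m2 [set: T2] (fun y => Rintegral m1 [set: T1] (fun x => f (x, y))).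
Proof.
move=> fi; rewrite /Rintegral -(integral21_prod_meas1 fi); congr fine.
apply: ae_eq_integral => //.
- exact: (measurable_fubini_G fi).
- apply/measurable_EFinP; apply: measurableT_comp => //.
  exact: (measurable_fubini_G fi).
- have := ae_integrable2 fi; apply: filterS => x ix _.
  by rewrite fineK//; exact: integrable_fin_num.
Qed.

Lemma cintegral_fubini1 (f : T1 * T2 -> R[i]) : cintegrable (m1 \x m2) f ->
  cintegral (m1 \x m2) f =
  cintegral m1 (fun x => cintegral m2 (fun y => f (x, y))).
Proof. by move=> [fR fI]; rewrite /cintegral !Rintegral_fubini1. Qed.

Lemma cintegral_fubini2 (f : T1 * T2 -> R[i]) : cintegrable (m1 \x m2) f ->
  cintegral (m1 \x m2) f =
  cintegral m2 (fun y => cintegral m1 (fun x => f (x, y))).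
Proof. by move=> [fR fI]; rewrite /cintegral !Rintegral_fubini2. Qed.

Lemma cfubini (f : T1 * T2 -> R[i]) : cintegrable (m1 \x m2) f ->
  cintegral m1 (fun x => cintegral m2 (fun y => f (x, y))) =
  cintegral m2 (fun y => cintegral m1 (fun x => f (x, y))).
Proof. by move=> fi; rewrite -cintegral_fubini1// cintegral_fubini2. Qed.

Lemma integral_tensor (a : T1 -> \bar R) (b : T2 -> \bar R) :
  measurable_fun [set: T1] a -> measurable_fun [set: T2] b ->
  (forall x, 0 <= a x) -> (forall y, 0 <= b y) ->
  \int[m1 \x m2]_z (a z.1 * b z.2) = \int[m1]_x a x * \int[m2]_y b y.
Proof.
move=> ma mb a0 b0; rewrite fubini_tonelli1 /fubini_F/=.
- under eq_integral do rewrite ge0_integralZl//.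
  by rewrite ge0_integralZr// integral_ge0.
- apply: emeasurable_funM.
  + exact: (measurableT_comp ma).
  + exact: (measurableT_comp mb).
- by move=> z; rewrite mule_ge0.
Qed.

Lemma cintegrable_tensor (a : T1 -> R[i]) (b : T2 -> R[i]) :
  cintegrable m1 a -> cintegrable m2 b ->
  cintegrable (m1 \x m2) (fun z => (a z.1 * b z.2)%R).
Proof.
move=> /cintegrableP[ma ai] /cintegrableP[mb bi]; apply/cintegrableP; split.
  by apply: cmeasurableM; [apply: cmeasurable_comp ma|apply: cmeasurable_comp mb].
under eq_integral do rewrite Normc.normcM EFinM.
rewrite (integral_tensor (cmeasurable_normE ma) (cmeasurable_normE mb));
  try by move=> ?; rewrite lee_fin normc_ge0.
by rewrite lte_mul_pinfty// ?ge0_fin_numE// integral_ge0// => ? _;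
  rewrite lee_fin normc_ge0.
Qed.

Lemma cintegral_tensor (a : T1 -> R[i]) (b : T2 -> R[i]) :
  cintegrable m1 a -> cintegrable m2 b ->
  cintegral (m1 \x m2) (fun z => (a z.1 * b z.2)%R) =
  (cintegral m1 a * cintegral m2 b)%R.
Proof.
move=> ai bi; rewrite cintegral_fubini1; last exact: cintegrable_tensor.
rewrite /=; under eq_cintegral do rewrite cintegralZ// mulrC.
by rewrite cintegralZ// mulrC.
Qed.

(** Tonelli applies to the positive and to the negative part, so that parameters where the integral
    diverges are covered too. *)
Lemma measurable_Rintegral_param (f : T1 * T2 -> R) :
  measurable_fun [set: T1 * T2] f ->
  measurable_fun [set: T1] (fun x => Rintegral m2 [set: T2] (fun y => f (x, y))).
Proof.
move=> mf; have mEf : measurable_fun [set: T1 * T2] (EFin \o f).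
  exact/measurable_EFinP.
apply: (measurableT_comp (f := fine)) => //.
have -> : (fun x => \int[m2]_y (f (x, y))%:E) =
    (fun x => \int[m2]_y ((EFin \o f)^\+ (x, y)) - \int[m2]_y ((EFin \o f)^\- (x, y))).
  by apply/funext => x; rewrite [LHS]integralE; congr (_ - _); apply: eq_integral => y _; rewrite ?funeposE ?funenegE.
apply: emeasurable_funB.
- by apply: (measurable_fun_fubini_tonelli_F ((EFin \o f)^\+)) => //; exact: measurable_funepos.
- by apply: (measurable_fun_fubini_tonelli_F ((EFin \o f)^\-)) => //; exact: measurable_funeneg.
Qed.

Lemma cmeasurable_cintegral_param (f : T1 * T2 -> R[i]) : cmeasurable f ->
  cmeasurable (fun x => cintegral m2 (fun y => f (x, y))).
Proof.
move=> [mR mI]; split => /=.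
- exact: (measurable_Rintegral_param (f := fun z => Re (f z)) mR).
- exact: (measurable_Rintegral_param (f := fun z => Im (f z)) mI).
Qed.

End cfubini.

(** * Limits of complex sequences and of complex integrals *)

Section climit.
Context d (T : measurableType d) (R : realType).
Variable mu : {measure set T -> \bar R}.

(** Componentwise, like [cintegral], so that each part is a statement about real limits. *)
Definition ccvg (u : nat -> R[i]) (l : R[i]) : Prop :=
  Re (u n) @[n --> \oo] --> Re l /\ Im (u n) @[n --> \oo] --> Im l.

Lemma ccvg_cst l : ccvg (fun=> l) l.
Proof. by split; exact: cvg_cst. Qed.

Lemma ccvgM u v l m : ccvg u l -> ccvg v m -> ccvg (fun n => u n * v n) (l * m).
Proof.
move=> [uR uI] [vR vI]; split.
- under eq_fun do rewrite ReM.
  by rewrite ReM; apply: cvgB; exact: cvgM.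
- under eq_fun do rewrite ImM.
  by rewrite ImM; apply: cvgD; exact: cvgM.
Qed.

Lemma ccvg_unique u l m : ccvg u l -> ccvg u m -> l = m.
Proof.
move=> [uR uI] [vR vI]; apply: complex_eq.
- exact: cvg_unique uR vR.
- exact: cvg_unique uI vI.
Qed.

Lemma cintegral_dominated (f_ : nat -> T -> R[i]) (f : T -> R[i]) (g : T -> R) :
  (forall n, cmeasurable (f_ n)) ->
  (forall x, ccvg (f_^~ x) (f x)) ->
  mu.-integrable [set: T] (EFin \o g) ->
  (forall n x, normc (f_ n x) <= g x) ->
  ccvg (fun n => cintegral mu (f_ n)) (cintegral mu f).
Proof.
move=> mf ff ig fg.
have main (p_ : nat -> T -> R) (p : T -> R) :
    (forall n, measurable_fun [set: T] (p_ n)) ->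
    (forall x, p_ n x @[n --> \oo] --> p x) ->
    (forall n x, `|p_ n x| <= g x) ->
    Rintegral mu [set: T] (p_ n) @[n --> \oo] --> Rintegral mu [set: T] p.
  move=> mp pp pg; apply: fine_cvg.
  have mpl : measurable_fun [set: T] p.
    by apply: (measurable_fun_cvg mp) => x _; exact: pp.
  have ip : mu.-integrable [set: T] (EFin \o p).
    apply: (le_integrable measurableT _ _ ig); first exact/measurable_EFinP.
    move=> x _ /=; rewrite lee_fin (@le_trans _ _ (g x))// ?ler_norm//.
    have /cvg_norm pn := pp x.
    rewrite -(cvg_lim _ pn)//; apply: limr_le; first by apply: cvgP pn.
    by apply: nearW => n; exact: pg.
  rewrite fineK; last exact: integrable_fin_num.
  apply: (@dominated_cvg _ _ _ mu _ measurableT _ _ (EFin \o g)) => //.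
  - by move=> n; exact/measurable_EFinP.
  - by move=> x _; apply: cvg_EFin; [exact: nearW|exact: pp].
  - by move=> n x _; rewrite lee_fin.
split => /=; apply: main.
- by move=> n; case: (mf n).
- by move=> x; case: (ff x).
- by move=> n x; rewrite (le_trans (normc_Re _)).
- by move=> n; case: (mf n).
- by move=> x; case: (ff x).
- by move=> n x; rewrite (le_trans (normc_Im _)).
Qed.

End climit.

(** * Fresnel integrals *)

Section ftc_helpers.
Context {R : realType}.
Local Notation mu := (@lebesgue_measure R).

Lemma is_derive_continuous (F : R -> R) (x l : R) :
  is_derive x 1 F l -> {for x, continuous F}.
Proof.
by move=> dF; apply: differentiable_continuous; apply/derivable1_diffP; exact: ex_derive.
Qed.

Lemma integral_is_derive (F f : R -> R) (a b : R) : a < b ->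
  (forall x, a <= x <= b -> is_derive x 1 F (f x)) ->
  (forall x, a <= x <= b -> {for x, continuous f}) ->
  (\int[mu]_(x in `[a, b]) (f x)%:E = (F b - F a)%:E)%E.
Proof.
move=> ab dF cf; rewrite (@continuous_FTC2 _ f F)//.
- by apply: continuous_in_subspaceT => x; rewrite inE/= in_itv/= => /cf.
- split.
  + move=> x; rewrite in_itv/= => /andP[ax xb].
    by apply: ex_derive; apply: dF; rewrite !ltW.
  + apply: cvg_at_right_filter; apply: is_derive_continuous (dF a _).
    by rewrite lexx ltW.
  + apply: cvg_at_left_filter; apply: is_derive_continuous (dF b _).
    by rewrite lexx ltW.
- move=> x; rewrite in_itv/= => /andP[ax xb]; rewrite derive1E.
  by have := dF x; rewrite !ltW// => /(_ isT) dFx; exact: derive_val.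
Qed.

Lemma continuous_integrable_itv (f : R -> R) (a b : R) : continuous f ->
  mu.-integrable `[a, b] (EFin \o f).
Proof.
move=> cf; apply: continuous_compact_integrable; first exact: segment_compact.
exact: continuous_subspaceT.
Qed.

End ftc_helpers.

Section fresnel.
Context {R : realType}.
Local Notation mu := (@lebesgue_measure R).
Implicit Types (th a b x : R).

(** The phase [th] lets one real family cover both parts of [expi (- x^2)]: [th = 0] gives the
    cosine and [th = pi / 2] gives minus the sine. *)
Definition chirp th x : R := cos (x ^+ 2 + th).

Lemma is_derive_sqrD th x : is_derive x 1 (fun q : R => q ^+ 2 + th) (2 * x).
Proof.
have -> : (fun q : R => q ^+ 2 + th) = (id ^+ 2 + cst th) by [].
by apply: is_derive_eq; rewrite addr0 expr1 scaler1 -mulr_natl.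
Qed.

Lemma continuous_chirp th : continuous (chirp th).
Proof.
move=> x; apply: continuous_comp; last exact: continuous_cos.
exact: is_derive_continuous (is_derive_sqrD th x).
Qed.

Lemma chirp_le1 th x : `|chirp th x| <= 1.
Proof. by rewrite ler_norml cos_le1 cos_geN1. Qed.

(* [(sin (q^2 + th) - 1) / (2 q)] has a derivative larger than the chirp. *)
Lemma integral_chirp_le th a b : 0 < a -> a < b ->
  Rintegral mu `[a, b] (chirp th) <= a^-1.
Proof.
move=> a0 ab.
pose F (q : R) := (sin (q ^+ 2 + th) - 1) * (2 * q)^-1.
pose f (q : R) := cos (q ^+ 2 + th) + (1 - sin (q ^+ 2 + th)) / (2 * q ^+ 2).
have dF q : a <= q <= b -> is_derive q 1 F (f q).
  move=> /andP[aq qb]; have q0 : q != 0 by rewrite gt_eqF// (lt_le_trans a0).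
  have ds : is_derive q 1 (fun q : R => sin (q ^+ 2 + th)) (cos (q ^+ 2 + th) * (2 * q)).
    exact: (is_derive1_comp (f := sin) (is_derive_sin _) (is_derive_sqrD th q)).
  have dv : is_derive q 1 (fun q : R => (2 * q)^-1) (- (2 * q) ^- 2 * 2).
    have dl : is_derive q 1 (fun q : R => 2 * q) 2.
      have -> : (fun q : R => 2 * q) = 2 *: id by [].
      by apply: is_derive_eq; rewrite scaler1.
    by apply: (is_deriveV (f := fun q : R => 2 * q)) => //; rewrite mulf_neq0.
  have d1 : is_derive q 1 (fun q : R => sin (q ^+ 2 + th) - 1) (cos (q ^+ 2 + th) * (2 * q)).
    have -> : (fun q : R => sin (q ^+ 2 + th) - 1) = (fun q : R => sin (q ^+ 2 + th)) - cst 1 by [].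
    by apply: is_derive_eq; rewrite subr0.
  have -> : F = (fun q : R => sin (q ^+ 2 + th) - 1) * (fun q : R => (2 * q)^-1) by [].
  apply: is_derive_eq; rewrite /f /GRing.scale/=; field.
  by rewrite q0.
have cf q : a <= q <= b -> {for q, continuous f}.
  move=> /andP[aq qb]; have q0 : q != 0 by rewrite gt_eqF// (lt_le_trans a0).
  apply: cvgD; first exact: continuous_chirp.
  apply: cvgM.
    apply: cvgB; first exact: cvg_cst.
    apply: continuous_comp; last exact: continuous_sin.
    exact: is_derive_continuous (is_derive_sqrD th q).
  apply: cvgV; first by rewrite mulf_neq0// expf_neq0.
  apply: cvgM; first exact: cvg_cst.
  exact: exprn_continuous.
have ip : mu.-integrable `[a, b] (EFin \o chirp th).
  exact/continuous_integrable_itv/continuous_chirp.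
have if_ : mu.-integrable `[a, b] (EFin \o f).
  apply: continuous_compact_integrable; first exact: segment_compact.
  by apply: continuous_in_subspaceT => x; rewrite inE/= in_itv/= => /cf.
apply: (@le_trans _ _ (Rintegral mu `[a, b] f)).
  apply: le_Rintegral => //= x; rewrite in_itv/= => /andP[ax xb].
  rewrite /chirp lerDl; apply: divr_ge0; first by rewrite subr_ge0 sin_le1.
  by rewrite mulr_ge0// sqr_ge0.
rewrite /Rintegral (integral_is_derive ab dF cf)/=.
have b0 := lt_trans a0 ab.
have Fb : F b <= 0.
  by rewrite /F mulr_le0_ge0 ?subr_le0 ?sin_le1// invr_ge0 mulr_ge0// ltW.
have Fa : - a^-1 <= F a.
  rewrite /F invfM mulrA -[leLHS]mulN1r ler_pM2r ?invr_gt0//.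
  by have := sin_geN1 (a ^+ 2 + th); lra.
lra.
Qed.

(** Adding [pi] to the phase negates the chirp, so the one-sided bound, valid for every phase, is in
    fact two-sided. *)
Lemma integral_chirp_tail th a b : 0 < a -> a <= b ->
  `|Rintegral mu `[a, b] (chirp th)| <= a^-1.
Proof.
move=> a0; rewrite le_eqVlt => /predU1P[<-|ab].
  by rewrite set_itv1 Rintegral_set1 normr0 invr_ge0 ltW.
rewrite ler_norml integral_chirp_le// andbT lerNl.
have ip : mu.-integrable `[a, b] (EFin \o chirp th).
  exact/continuous_integrable_itv/continuous_chirp.
rewrite -mulN1r -RintegralZl//.
have -> : (fun x => -1 * chirp th x) = chirp (th + pi).
  by apply/funext => x; rewrite /chirp addrA cosDpi mulN1r.
exact: integral_chirp_le.
Qed.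


Lemma integral_chirp_split th a b c : a <= b -> b <= c ->
  Rintegral mu `[a, c] (chirp th) =
  Rintegral mu `[a, b] (chirp th) + Rintegral mu `[b, c] (chirp th).
Proof.
move=> ab bc; have ip x y : mu.-integrable `[x, y] (EFin \o chirp th).
  exact/continuous_integrable_itv/continuous_chirp.
rewrite -[in X in _ + X]Rintegral_itv_obnd_cbnd; last first.
  by apply: integrableS (ip b c) => //; exact: subset_itv_oc_cc.
rewrite -(Rintegral_itvB (ip a c)) ?bnd_simp//.
by rewrite addrC subrK.
Qed.

Lemma integral_chirp_itv0 th b : 0 <= b -> b <= 1 ->
  `|Rintegral mu `[0, b] (chirp th)| <= 1.
Proof.
move=> b0 b1.
have ip : mu.-integrable `[0, b] (EFin \o chirp th).
  exact/continuous_integrable_itv/continuous_chirp.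
apply: le_trans (le_normr_Rintegral _ ip) _ => //.
apply: (@le_trans _ _ (Rintegral mu `[0, b] (cst 1))).
  apply: le_Rintegral => //=.
  - apply: continuous_integrable_itv => x.
    by apply: cvg_norm; exact: continuous_chirp.
  - by apply: continuous_integrable_itv => x; exact: cvg_cst.
  - by move=> x _; exact: chirp_le1.
by rewrite Rintegral_cst//= lebesgue_measure_itv/= lte_fin; case: ifPn => //=; rewrite ?mul1r ?mulr0// subr0.
Qed.

(** The interval is split at 1: the trivial bound gives 1 on the left, and the tail bound [a^-1] at
    [a = 1] gives 1 on the right. *)
Lemma integral_chirp_bounded0 th b : 0 <= b ->
  `|Rintegral mu `[0, b] (chirp th)| <= 2.
Proof.
move=> b0; have [b1|b1] := leP b 1.
  by rewrite (le_trans (integral_chirp_itv0 _ _ _))// ler1n.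
rewrite (integral_chirp_split _ ler01 (ltW b1)).
rewrite (le_trans (ler_normD _ _))// -[2]/(1 + 1) lerD//.
  exact: integral_chirp_itv0.
by rewrite (le_trans (integral_chirp_tail _ _ _)) ?invr1// ltW.
Qed.

(** The odd primitive of the chirp, that is, its signed integral from 0 to [x]. *)
Definition fresnel th x : R :=
  if 0 <= x then Rintegral mu `[0, x] (chirp th)
  else - Rintegral mu `[0, - x] (chirp th).

Lemma fresnel_bounded th x : `|fresnel th x| <= 2.
Proof.
rewrite /fresnel; case: ifPn => x0; first exact: integral_chirp_bounded0.
by rewrite normrN integral_chirp_bounded0// oppr_ge0 ltW// ltNge.
Qed.

Lemma fresnelN th x : fresnel th (- x) = - fresnel th x.
Proof.
rewrite /fresnel oppr_ge0 opprK.
have [x0|x0|->] := ltgtP x 0; rewrite ?opprK//.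
by rewrite oppr0 set_itv1 Rintegral_set1 oppr0.
Qed.

Lemma integral_chirpN th a b : a <= b ->
  Rintegral mu `[- b, - a] (chirp th) = Rintegral mu `[a, b] (chirp th).
Proof.
move=> ab; rewrite /Rintegral integration_by_substitution_oppr//; last first.
  exact/continuous_subspaceT/continuous_chirp.
by congr fine; apply: eq_integral => x _; rewrite /= /chirp sqrrN.
Qed.

(** The chirp is even, so the negative part of the interval is reflected onto the positive
    half-line, where the formula is additivity of the integral. *)
Lemma integral_chirpE th a b : a <= b ->
  Rintegral mu `[a, b] (chirp th) = fresnel th b - fresnel th a.
Proof.
have pos x y : 0 <= x -> x <= y ->
    Rintegral mu `[x, y] (chirp th) = fresnel th y - fresnel th x.
  move=> x0 xy; rewrite /fresnel x0 (le_trans x0 xy).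
  by rewrite (@integral_chirp_split _ 0 x y)// addrAC subrr add0r.
move=> ab; have [a0|a0] := leP 0 a; first exact: pos.
have [b0|b0] := leP 0 b.
  have a0' : 0 <= - a by rewrite oppr_ge0 ltW.
  rewrite (integral_chirp_split _ (ltW a0) b0).
  have := integral_chirpN th a0'; rewrite opprK oppr0 => ->.
  rewrite !pos//.
  have -> : fresnel th 0 = 0 by rewrite /fresnel lexx set_itv1 Rintegral_set1.
  by rewrite !subr0 fresnelN addrC.
have ba : - b <= - a by rewrite lerN2.
have := integral_chirpN th ba; rewrite !opprK => ->.
have b0' : 0 <= - b by rewrite oppr_ge0 ltW.
by rewrite pos// !fresnelN opprK addrC.
Qed.

(** The tail bound [x^-1] is a Cauchy criterion; the chirp is not absolutely integrable, so
    oscillation is essential here. *)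
Lemma fresnel_cvg th : cvg (fresnel th x @[x --> +oo]).
Proof.
have tail x y : 0 < x -> x <= y -> `|fresnel th y - fresnel th x| <= x^-1.
  by move=> x0 xy; rewrite -integral_chirpE// integral_chirp_tail.
apply/cauchy_cvgP/cauchy_ballP => e e0; near_simpl.
near=> x y => /=.
rewrite /ball/=.
have xe : 2 / e < x by near: x; apply: nbhs_pinfty_gt; exact: num_real.
have ye : 2 / e < y by near: y; apply: nbhs_pinfty_gt; exact: num_real.
have e2 : 0 < 2 / e by rewrite divr_gt0.
have h z : 2 / e < z -> z^-1 < e.
  move=> ze; rewrite -[e]invrK ltf_pV2 ?posrE ?invr_gt0//; last exact: lt_trans ze.
  by apply: le_lt_trans ze; rewrite ler_peMl ?invr_ge0 ?ltW// ltr1n.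
have [xy|yx] := leP x y.
  by rewrite distrC (le_lt_trans (tail _ _ _ xy))// ?h// (lt_trans e2).
by rewrite (le_lt_trans (tail _ _ _ (ltW yx)))// ?h// (lt_trans e2).
Unshelve. all: by end_near. Qed.

Lemma is_derive_affine (a b x : R) : is_derive x 1 (fun p : R => a * p + b) a.
Proof.
have -> : (fun p : R => a * p + b) = a *: id + cst b by [].
by apply: is_derive_eq; rewrite addr0 /GRing.scale/= mulr1.
Qed.

Lemma integral_chirp_affine th a b (s c : R) : 0 < s -> a <= b ->
  Rintegral mu `[a, b] (fun p => chirp th (s * p - c)) =
  s^-1 * (fresnel th (s * b - c) - fresnel th (s * a - c)).
Proof.
move=> s0 ab; pose F (p : R) := s * p - c.
have dF x : is_derive x 1 F s := is_derive_affine s (- c) x.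
have F'E : derive1 F = cst s.
  by apply/funext => x; rewrite derive1E; have := dF x => dFx; exact: derive_val.
have FF x y : x < y -> F x < F y by move=> xy; rewrite /F ltrD2r ltr_pM2l.
have cF x : {for x, continuous F} by exact: is_derive_continuous (dF x).
rewrite -integral_chirpE; last by rewrite lerD2r ler_pM2l.
have := @integration_by_substitution_increasing _ F (chirp th) a b ab.
rewrite F'E /Rintegral => -> //.
- have ip : mu.-integrable `[a, b] (EFin \o (fun p => chirp th (F p))).
    apply: continuous_integrable_itv => x.
    by apply: continuous_comp; [exact: cF|exact: continuous_chirp].
  have -> : (\int[mu]_(x in `[a, b]) (((chirp th \o F) * cst s) x)%:E =
             s%:E * \int[mu]_(x in `[a, b]) (chirp th (F x))%:E)%E.
    rewrite -integralZl//.
    by apply: eq_integral => x _; rewrite -EFinM mulrC.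
  rewrite fineM//; last exact: integrable_fin_num.
  by rewrite /= mulrA mulVf ?mul1r// gt_eqF.
- by move=> x y _ _; exact: FF.
- by move=> x _; exact: cvg_cst.
- exact: is_cvg_cst.
- exact: is_cvg_cst.
- split.
  + by move=> x _; apply: ex_derive; exact: dF.
  + by apply: cvg_at_right_filter; exact: cF.
  + by apply: cvg_at_left_filter; exact: cF.
- exact/continuous_subspaceT/continuous_chirp.
Qed.

End fresnel.

(** * Integrals weighted by an indicator *)

Section indic_integral.
Context d (T : measurableType d) (R : realType).
Variable mu : {measure set T -> \bar R}.

Lemma integrable_indic_lty (D : set T) : measurable D -> (mu D < +oo)%E ->
  mu.-integrable [set: T] (fun x => (\1_D x : R)%:E).
Proof.
move=> mD Doo; apply/integrableP; split.
  by apply/measurable_EFinP; exact: measurable_indic.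
under eq_integral do rewrite gee0_abs ?lee_fin//.
by rewrite integral_indic// setIT.
Qed.

Lemma cmeasurable_indic (D : set T) : measurable D ->
  cmeasurable (fun x => (\1_D x : R)%:C).
Proof. by move=> mD; apply: cmeasurable_realC; exact: measurable_indic. Qed.

Lemma cintegrable_indicM (D : set T) (f : T -> R[i]) (M : R) : measurable D ->
  (mu D < +oo)%E -> cmeasurable f -> (forall x, normc (f x) <= M) ->
  cintegrable mu (fun x => (\1_D x)%:C * f x).
Proof.
move=> mD Doo mf fM.
apply: (@cintegrable_dominated _ _ _ _ _ (fun x => M * \1_D x)).
- by apply: cmeasurableM => //; exact: cmeasurable_indic.
- under eq_fun do rewrite EFinM.
  by apply: integrableZl => //; exact: integrable_indic_lty.
- move=> x; rewrite Normc.normcM normc_realC ger0_norm// mulrC.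
  by rewrite ler_wpM2r.
Qed.

Lemma cintegral_indicM (D : set T) (f : T -> R[i]) :
  cintegral mu (fun x => (\1_D x)%:C * f x) =
  Rintegral mu D (fun x => Re (f x)) +i* Rintegral mu D (fun x => Im (f x)).
Proof.
rewrite /cintegral; congr (_ +i* _); rewrite [RHS]Rintegral_mkcond;
  apply: eq_Rintegral => x _; rewrite patch_indic/=.
- by rewrite ReM/= mul0r subr0 mulrC.
- by rewrite ImM/= mul0r addr0 mulrC.
Qed.

End indic_integral.

(** * The one-dimensional kernel with cut-off frequencies *)

Section chirp_cutoff.
Context {R : realType}.
Local Notation mu := (@lebesgue_measure R).

(** Up to normalization, the kernel of the one-dimensional evolution with frequencies restricted to
    [[-n, n]]. Without the cutoff the integrand has modulus 1 on the whole line. *)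
Definition chirp_cutoff (t : R) (n : nat) (w : R) : R[i] :=
  cintegral mu (fun p => (\1_`[- n%:R, n%:R] p)%:C * expi (w * p - t * p ^+ 2)).

Definition fresnelC (x : R) : R[i] := fresnel 0 x +i* fresnel (pi / 2) x.

(** Completing the square: with [s = sqrt t] and [c = w / (2 s)], the phase [w p - t p^2] is
    [w^2 / (4 t) - (s p - c)^2]. The substitution [q = s p - c] gives a difference of two Fresnel
    values, which oddness turns into a sum. *)
Lemma chirp_cutoffE (t : R) n w : 0 < t ->
  chirp_cutoff t n w = ((Num.sqrt t)^-1)%:C * expi (w ^+ 2 / (4 * t)) *
    (fresnelC (Num.sqrt t * n%:R - w / (2 * Num.sqrt t)) +
     fresnelC (Num.sqrt t * n%:R + w / (2 * Num.sqrt t))).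
Proof.
move=> t0; rewrite /chirp_cutoff; set s := Num.sqrt t.
have s0 : 0 < s by rewrite sqrtr_gt0.
have ss : s ^+ 2 = t by rewrite sqr_sqrtr// ltW.
set c := w / (2 * s).
pose e (p : R) : R[i] := chirp 0 (s * p - c) +i* chirp (pi / 2) (s * p - c).
have eE p : expi (w * p - t * p ^+ 2) = expi (w ^+ 2 / (4 * t)) * e p.
  have -> : e p = expi (- (s * p - c) ^+ 2).
    by rewrite /e /expi /chirp addr0 cosN sinN -cosDpihalf.
  rewrite -expiD; congr expi; rewrite -ss /c; field.
  by rewrite gt_eqF.
under eq_cintegral do rewrite eE mulrCA.
rewrite cintegralZ; last first.
  apply: (@cintegrable_indicM _ _ _ _ _ _ 2) => //.
  - by rewrite /= lebesgue_measure_itv/=; case: ifPn => // _; rewrite -EFinB ltry.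
  - split => /=.
    + by rewrite /chirp; mfun.
    + by rewrite /chirp; mfun.
  - by move=> p; rewrite (le_trans (normc_le _))//= -[2]/(1 + 1) lerD// chirp_le1.
have nn : - n%:R <= n%:R :> R by rewrite (@le_trans _ _ 0)// oppr_le0.
rewrite cintegral_indicM/= !integral_chirp_affine//.
have -> : s * - n%:R - c = - (s * n%:R + c) by ring.
rewrite !fresnelN -mulrA [RHS]mulrCA; congr (_ * _).
by apply: complex_eq; rewrite ?ReM ?ImM ?ReD ?ImD/=; ring.
Qed.

Lemma fresnelC_bounded x : normc (fresnelC x) <= 4.
Proof.
rewrite (le_trans (normc_le _))//=.
by have := fresnel_bounded (0 : R) x; have := fresnel_bounded (pi / 2 : R) x; lra.
Qed.

(** Two Fresnel values of modulus at most 4. The bound is uniform in [n] and [w], as the domination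
    that removes the cutoff requires. *)
Lemma chirp_cutoff_bounded (t : R) n w : 0 < t ->
  normc (chirp_cutoff t n w) <= 8 / Num.sqrt t.
Proof.
move=> t0; rewrite chirp_cutoffE// !Normc.normcM normc_realC normc_expi mulr1.
rewrite ger0_norm ?invr_ge0 ?sqrtr_ge0// mulrC ler_wpM2r ?invr_ge0 ?sqrtr_ge0//.
apply: le_trans (normcD _ _) _.
have h x := fresnelC_bounded x.
apply: (@le_trans _ _ (4 + 4)); [exact: lerD|lra].
Qed.

(** The improper integral of [expi (- x^2)] over the whole line: each half-line contributes one
    limit to each part. *)
Definition fresnel_const : R[i] :=
  let l th := lim (fresnel th x @[x --> +oo]) in
  (l 0 + l 0) +i* (l (pi / 2) + l (pi / 2)).

Lemma chirp_cutoff_cvg (t w : R) : 0 < t ->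
  ccvg (fun n => chirp_cutoff t n w)
    (((Num.sqrt t)^-1)%:C * expi (w ^+ 2 / (4 * t)) * fresnel_const).
Proof.
move=> t0; under eq_fun do rewrite chirp_cutoffE//.
apply: ccvgM; first exact: ccvg_cst.
have s0 : 0 < Num.sqrt t by rewrite sqrtr_gt0.
have cv (c : R) : Num.sqrt t * n%:R + c @[n --> \oo] --> +oo.
  apply/cvgryPge => A; near=> n.
  rewrite -lerBlDr mulrC -ler_pdivrMr//.
  by near: n; exact: nbhs_infty_ger.
have cf th c : fresnel th (Num.sqrt t * n%:R + c) @[n --> \oo] -->
    lim (fresnel th x @[x --> +oo]).
  apply: (cvg_comp (fun n : nat => Num.sqrt t * n%:R + c) (fresnel th) (cv c)).
  exact: fresnel_cvg.
split => /=.
- by apply: cvgD; exact: cf.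
- by apply: cvgD; exact: cf.
Unshelve. all: by end_near. Qed.

End chirp_cutoff.

(** * Fourier transforms of intervals and Lorentzians *)

Section lorentzian.
Context {R : realType}.
Local Notation mu := (@lebesgue_measure R).

Lemma integralT_oneDsqr : (\int[mu]_x ((1 + x ^+ 2)^-1)%:E = pi%:E)%E.
Proof.
rewrite (@ge0_symfun_integralT _ (fun x : R => (1 + x ^+ 2)^-1)).
- have -> : [set x : R | 0 <= x] = `[0, +oo[%classic by rewrite set_itvcy.
  rewrite integral0y_oneDsqr -EFinM; congr (_%:E).
  by rewrite mulrC divfK.
- by move=> x; rewrite invr_ge0 addr_ge0// sqr_ge0.
- exact: continuous_oneDsqrV.
- by move=> x /=; rewrite sqrrN.
Qed.

Lemma measurable_lorentzian d (T : measurableType d) (f : T -> R) :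
  measurable_fun [set: T] f ->
  measurable_fun [set: T] (fun x => (1 + f x ^+ 2)^-1).
Proof.
move=> mf.
have mg : measurable_fun [set: R] (fun x : R => (1 + x ^+ 2)^-1).
  by apply: continuous_measurable_fun; exact: continuous_oneDsqrV.
exact: (measurableT_comp mg mf).
Qed.

Lemma integral_lorentzian_gt0 (a b : R) : 0 < a ->
  (\int[mu]_x ((1 + (a * x + b) ^+ 2)^-1)%:E = (pi / a)%:E)%E.
Proof.
move=> a0; pose F (x : R) := a * x + b.
have dF x := is_derive_affine a b x.
have F'E : derive1 F = cst a.
  by apply/funext => x; rewrite derive1E; have := dF x => dFx; exact: derive_val.
have /= H := @increasing_ge0_integration_by_substitutionT R F (fun x => (1 + x ^+ 2)^-1).
have {}H : (\int[mu]_x ((1 + x ^+ 2)^-1)%:E = \int[mu]_x ((1 + (a * x + b) ^+ 2)^-1 * a)%:E)%E.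
  rewrite H ?F'E//.
  - by move=> x y xy; rewrite /F ltrD2r ltr_pM2l.
  - by move=> x; exact: cvg_cst.
  - exact: is_cvg_cst.
  - exact: is_cvg_cst.
  - apply/cvgrNyPle => A; near=> x.
    by rewrite /F -lerBrDr mulrC -ler_pdivlMr//.
  - apply/cvgryPge => A; near=> x.
    by rewrite /F -lerBlDr mulrC -ler_pdivrMr//.
  - exact: continuous_oneDsqrV.
  - by move=> x; rewrite invr_ge0 addr_ge0// sqr_ge0.
rewrite integralT_oneDsqr in H.
have h0 x : (0 <= (1 + (a * x + b) ^+ 2)^-1) by rewrite invr_ge0 addr_ge0// sqr_ge0.
have -> : (\int[mu]_x ((1 + (a * x + b) ^+ 2)^-1)%:E =
  \int[mu]_x ((a^-1)%:E * ((1 + (a * x + b) ^+ 2)^-1 * a)%:E))%E.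
  by apply: eq_integral => x _; rewrite -EFinM mulrCA mulVf ?mulr1// gt_eqF.
rewrite ge0_integralZl//.
- by rewrite -H -EFinM mulrC.
- apply/measurable_EFinP; apply: measurable_funM => //.
  by apply: (measurable_lorentzian (f := fun x : R1 R => a * x + b)); mfun.
- by move=> x _; rewrite lee_fin mulr_ge0// ltW.
- by rewrite lee_fin invr_ge0 ltW.
Unshelve. all: by end_near. Qed.

Lemma integral_lorentzian (a b : R) : a != 0 ->
  (\int[mu]_x ((1 + (a * x + b) ^+ 2)^-1)%:E = (pi / `|a|)%:E)%E.
Proof.
move=> a0; have [a1|a1] := ltP 0 a.
  by rewrite integral_lorentzian_gt0// gtr0_norm.
have {a0}a1 : a < 0 by rewrite lt_neqAle a0.
rewrite -(@integral_lorentzian_gt0 `|a| (- b)) ?normr_gt0 ?lt_eqF//.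
apply: eq_integral => x _; rewrite ltr0_norm// -[in LHS]sqrrN opprD mulNr.
by [].
Qed.


End lorentzian.

Section interval_fourier.
Context {R : realType}.
Local Notation mu := (@lebesgue_measure R).

Definition fourier1 (f : R1 R -> R[i]) (xi : R) : R[i] :=
  cintegral mu (fun x => expi (- (xi * x)) * f x).

Lemma lebesgue_measure_itv_lty (a b : R) : (mu `[a, b] < +oo)%E.
Proof. by rewrite /= lebesgue_measure_itv/=; case: ifPn => // _; rewrite -EFinB ltry. Qed.

Lemma lebesgue_measure_itvE (a b : R) : a <= b -> mu `[a, b]%classic = (b - a)%:E.
Proof.
rewrite /= lebesgue_measure_itv/= lte_fin le_eqVlt => /predU1P[->|->//].
by rewrite ltxx subrr.
Qed.

Lemma continuous_trig_le (f : R -> R) (a b xi : R) : a <= b -> continuous f ->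
  (forall x, `|f x| <= 1) -> `|Rintegral mu `[a, b] f| <= b - a.
Proof.
move=> ab cf f1.
have ip : mu.-integrable `[a, b] (EFin \o f) by exact: continuous_integrable_itv.
apply: le_trans (le_normr_Rintegral _ ip) _ => //.
apply: (@le_trans _ _ (Rintegral mu `[a, b] (cst 1))).
  apply: le_Rintegral => //=.
  - apply: continuous_integrable_itv => x.
    by apply: cvg_norm; exact: cf.
  - by apply: continuous_integrable_itv => x; exact: cvg_cst.
by rewrite Rintegral_cst//= lebesgue_measure_itvE//= mul1r.
Qed.

Lemma integral_cos_itv (a b xi th : R) : a < b -> xi != 0 ->
  `|Rintegral mu `[a, b] (fun x => cos (xi * x + th))| <= 2 / `|xi|.
Proof.
move=> ab xi0.
have dF (x : R) : is_derive x 1 (fun x : R => xi^-1 * sin (xi * x + th)) (cos (xi * x + th)).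
  have -> : (fun x : R => xi^-1 * sin (xi * x + th)) =
      xi^-1 *: (sin \o (fun x : R => xi * x + th)) by [].
  have ds := is_derive1_comp (f := sin) (is_derive_sin _) (is_derive_affine xi th x).
  by apply: is_derive_eq; rewrite /GRing.scale/= mulrCA mulVf// mulr1.
have cf : continuous (fun x : R => cos (xi * x + th)).
  move=> x; apply: continuous_comp; last exact: continuous_cos.
  exact: is_derive_continuous (is_derive_affine xi th x).
rewrite /Rintegral (integral_is_derive ab (fun x _ => dF x) (fun x _ => cf x))/=.
rewrite -mulrBr normrM normfV mulrC ler_wpM2r ?invr_ge0//.
rewrite (le_trans (ler_normB _ _))// -[2]/(1 + 1) lerD//.
- by rewrite ler_norml sin_le1 sin_geN1.
- by rewrite ler_norml sin_le1 sin_geN1.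
Qed.

Definition itv_fun (a b : R) (x : R1 R) : R[i] := (\1_`[a, b] x : R)%:C.

Lemma cintegrable_itv_fun a b : cintegrable mu (itv_fun a b).
Proof.
rewrite /itv_fun; under eq_fun do rewrite -[_%:C]mulr1.
apply: (@cintegrable_indicM _ _ _ _ _ _ 1) => //.
- exact: lebesgue_measure_itv_lty.
- by move=> _; rewrite Normc.normc1.
Qed.

(* The bounds [|hat 1| <= 2 (b - a)] and [|xi hat 1| <= 4] in one inequality. *)
Lemma normc_fourier1_itv (a b xi : R) : a < b ->
  normc (fourier1 (itv_fun a b) xi) <= 2 * (b - a) /\
  `|xi| * normc (fourier1 (itv_fun a b) xi) <= 4.
Proof.
move=> ab; rewrite /fourier1; under eq_cintegral do rewrite mulrC.
rewrite cintegral_indicM.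
have RE : (fun x : R1 R => Re (expi (- (xi * x)))) = fun x : R => cos (xi * x + 0).
  by apply/funext => x /=; rewrite cosN addr0.
have IE : (fun x : R1 R => Im (expi (- (xi * x)))) = fun x : R => cos (xi * x + pi / 2).
  by apply/funext => x /=; rewrite sinN cosDpihalf.
rewrite RE IE; split.
- rewrite (le_trans (normc_le _))//= mulr_natl mulr2n lerD//;
    apply: continuous_trig_le => //; try exact: ltW.
  + move=> x; apply: continuous_comp; last exact: continuous_cos.
    exact: is_derive_continuous (is_derive_affine xi _ x).
  + by move=> x; rewrite ler_norml cos_le1 cos_geN1.
  + move=> x; apply: continuous_comp; last exact: continuous_cos.
    exact: is_derive_continuous (is_derive_affine xi _ x).
  + by move=> x; rewrite ler_norml cos_le1 cos_geN1.
- have [->|xi0] := eqVneq xi 0; first by rewrite normr0 mul0r.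
  rewrite mulrC -ler_pdivlMr ?normr_gt0//.
  rewrite (le_trans (normc_le _))//=.
  have h th := integral_cos_itv th ab xi0.
  by rewrite (le_trans (lerD (h _) (h _)))// -mulrDl -natrD.
Qed.

End interval_fourier.

(** * Rotations preserve the Lebesgue measure *)

Section measure_preserving.
Context d (T : measurableType d) (R : realType).
Variable mu : {measure set T -> \bar R}.

(** Invariance is stated for integrals of nonnegative functions rather than for measures of sets:
    this form composes and passes through Tonelli one factor at a time. *)
Definition preserves_integral (h : T -> T) : Prop :=
  measurable_fun [set: T] h /\
  forall f : T -> \bar R, measurable_fun [set: T] f -> (forall x, 0 <= f x)%E ->
    (\int[mu]_x f (h x) = \int[mu]_x f x)%E.

Lemma preserves_integral_comp (g h : T -> T) :
  preserves_integral g -> preserves_integral h -> preserves_integral (fun x => g (h x)).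
Proof.
move=> [mg ig] [mh ih]; split; first exact: (measurableT_comp mg mh).
move=> f mf f0; rewrite (ih (fun x => f (g x))) ?ig//.
exact: (measurableT_comp mf mg).
Qed.

Lemma cintegral_preserves (h : T -> T) (f : T -> R[i]) : preserves_integral h ->
  cmeasurable f -> cintegral mu (fun x => f (h x)) = cintegral mu f.
Proof.
move=> [mh ih] [mR mI].
have main (p : T -> R) : measurable_fun [set: T] p ->
    Rintegral mu [set: T] (fun x => p (h x)) = Rintegral mu [set: T] p.
  move=> mp; rewrite /Rintegral; congr fine.
  have mEp : measurable_fun [set: T] (EFin \o p) by exact/measurable_EFinP.
  rewrite [LHS]integralE [RHS]integralE.
  rewrite -[in RHS]ih//; last exact: measurable_funepos.
  rewrite -[X in _ = (_ - X)%E]ih//; last exact: measurable_funeneg.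
  by congr (_ - _)%E; apply: eq_integral => y _; rewrite ?funeposE ?funenegE.
by rewrite /cintegral (main _ mR) (main _ mI).
Qed.

Lemma cintegrable_preserves (h : T -> T) (f : T -> R[i]) : preserves_integral h ->
  cintegrable mu f -> cintegrable mu (fun x => f (h x)).
Proof.
move=> [mh ih] /cintegrableP[mf foo]; apply/cintegrableP; split.
  exact: cmeasurable_comp mf.
rewrite (ih (fun x => (normc (f x))%:E))//; first exact: cmeasurable_normE.
by move=> x; rewrite lee_fin normc_ge0.
Qed.

End measure_preserving.

Section preserving_product.
Context d1 d2 (T1 : measurableType d1) (T2 : measurableType d2) (R : realType).
Variable m1 : {sigma_finite_measure set T1 -> \bar R}.
Variable m2 : {sigma_finite_measure set T2 -> \bar R}.

(** Tonelli with the moved coordinate innermost: for fixed [y] the map is [g y]. As [g] may depend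
    on [y], this covers shears. *)
Lemma preserves_integral_fst (g : T2 -> T1 -> T1) :
  measurable_fun [set: T1 * T2] (fun z => g z.2 z.1) ->
  (forall y, preserves_integral m1 (g y)) ->
  preserves_integral (m1 \x m2)%E (fun z => (g z.2 z.1, z.2)).
Proof.
move=> mg pg.
have mh : measurable_fun [set: T1 * T2] (fun z : T1 * T2 => (g z.2 z.1, z.2)) by mfun.
split => // f mf f0.
rewrite (fubini_tonelli2 (fun z => f (g z.2 z.1, z.2)))//; last exact: (measurableT_comp mf mh).
rewrite [RHS]fubini_tonelli2//; apply: eq_integral => y _; rewrite /fubini_G/=.
have [mgy ig] := pg y; rewrite (ig (fun x => f (x, y)))//.
exact: measurable_fun_pair1.
Qed.

Lemma preserves_integral_snd (g : T1 -> T2 -> T2) :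
  measurable_fun [set: T1 * T2] (fun z => g z.1 z.2) ->
  (forall x, preserves_integral m2 (g x)) ->
  preserves_integral (m1 \x m2)%E (fun z => (z.1, g z.1 z.2)).
Proof.
move=> mg pg.
have mh : measurable_fun [set: T1 * T2] (fun z : T1 * T2 => (z.1, g z.1 z.2)) by mfun.
split => // f mf f0.
rewrite (fubini_tonelli1 (fun z => f (z.1, g z.1 z.2)))//; last exact: (measurableT_comp mf mh).
rewrite [RHS]fubini_tonelli1//; apply: eq_integral => x _; rewrite /fubini_F/=.
have [mgx ig] := pg x; rewrite (ig (fun y => f (x, y)))//.
exact: measurable_fun_pair2.
Qed.

End preserving_product.

(** * Translations, shears and rotations of R^6 *)

Section translations.
Context {R : realType}.
Local Notation mu := (@lebesgue_measure R).

Definition shiftR (c : R) : R1 R -> R1 R := fun x : R => x + c.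

Lemma measurable_shiftR c : measurable_fun [set: R1 R] (shiftR c).
Proof. by rewrite /shiftR; apply: measurable_funD; mfun. Qed.

HB.instance Definition _ c := isMeasurableFun.Build _ _ _ _ (shiftR c) (measurable_shiftR c).

(** The pushforward gives every half-open interval its length, so it is the Lebesgue measure by
    uniqueness. *)
Lemma preserves_integral_shiftR (c : R) : preserves_integral mu (shiftR c).
Proof.
split; first exact: measurable_shiftR.
move=> f mf f0.
have := @ge0_integral_pushforward _ _ _ _ R (shiftR c) (measurable_shiftR c) mu setT f measurableT mf (fun y _ => f0 y).
rewrite preimage_setT => <-.
apply: eq_measure_integral => A mA _.
apply/esym/lebesgue_measure_unique => //= _ [[a b]] _ <-.
have -> : pushforward mu (shiftR c) `]a, b]%classic = mu (`]a - c, b - c]%classic).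
  rewrite /pushforward; congr (mu _); apply/seteqP; split => x /=;
    rewrite !in_itv/= /shiftR => /andP[h1 h2]; apply/andP; split; lra.
rewrite !lebesgue_measure_itv/= !lte_fin ltrD2r.
by rewrite -!EFinB opprB addrA subrK.
Qed.

Lemma preserves_integral_add3 (c : R3 R) :
  preserves_integral leb3 (fun x => add3 x c).
Proof.
have h1 : preserves_integral leb2 (fun z : R1 R * R1 R => (shiftR c.1.1 z.1, z.2)).
  apply: (@preserves_integral_fst _ _ (R1 R) (R1 R) R mu mu (fun=> shiftR c.1.1)).
  - by rewrite /shiftR; apply: measurable_funD; mfun.
  - by move=> _; exact: preserves_integral_shiftR.
have h2 : preserves_integral leb2 (fun z : R1 R * R1 R => (z.1, shiftR c.1.2 z.2)).
  apply: (@preserves_integral_snd _ _ (R1 R) (R1 R) R mu mu (fun=> shiftR c.1.2)).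
  - by rewrite /shiftR; apply: measurable_funD; mfun.
  - by move=> _; exact: preserves_integral_shiftR.
have h12 := preserves_integral_comp h1 h2.
have h3 : preserves_integral leb3 (fun z : R3 R => ((shiftR c.1.1 z.1.1, shiftR c.1.2 z.1.2), z.2)).
  apply: (@preserves_integral_fst _ _ (R1 R * R1 R)%type (R1 R) R leb2 mu (fun=> fun z : R1 R * R1 R => (shiftR c.1.1 z.1, shiftR c.1.2 z.2))).
  - by rewrite /shiftR; apply: measurable_fun_pair; apply: measurable_funD; mfun.
  - by move=> _; exact: h12.
have h4 : preserves_integral leb3 (fun z : R3 R => (z.1, shiftR c.2 z.2)).
  apply: (@preserves_integral_snd _ _ (R1 R * R1 R)%type (R1 R) R leb2 mu (fun=> shiftR c.2)).
  - by rewrite /shiftR; apply: measurable_funD; mfun.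
  - by move=> _; exact: preserves_integral_shiftR.
exact: preserves_integral_comp h3 h4.
Qed.

Definition shear1 (a : R) (z : R6 R) : R6 R := (add3 z.1 (scale3 a z.2), z.2).
Definition shear2 (a : R) (z : R6 R) : R6 R := (z.1, add3 z.2 (scale3 a z.1)).

Lemma preserves_integral_shear1 a : preserves_integral leb6 (shear1 a).
Proof.
apply: (@preserves_integral_fst _ _ (R3 R) (R3 R) R leb3 leb3 (fun y x => add3 x (scale3 a y))).
- by mfun6.
- by move=> y; exact: preserves_integral_add3.
Qed.

Lemma preserves_integral_shear2 a : preserves_integral leb6 (shear2 a).
Proof.
apply: (@preserves_integral_snd _ _ (R3 R) (R3 R) R leb3 leb3 (fun y x => add3 x (scale3 a y))).
- by mfun6.
- by move=> y; exact: preserves_integral_add3.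
Qed.

(** A rotation when [s] is 1 or -1: [rot 1] sends [(u, v)] to [(x, y)], and [rot (- 1)] is its
    inverse. Keeping the sign as a parameter lets one estimate serve both halves of the theorem. *)
Definition rot (s : R) (z : R6 R) : R6 R :=
  (scale3 (Num.sqrt 2)^-1 (add3 z.1 (scale3 s z.2)),
   scale3 (Num.sqrt 2)^-1 (add3 z.2 (scale3 (- s) z.1))).

(* A rotation by an eighth of a turn is a product of three shears, with
   coefficients tan (pi / 8) = sqrt 2 - 1 and sin (pi / 4) = 1 / sqrt 2. *)
Lemma rot_shears (s : R) z : s ^+ 2 = 1 -> rot s z =
  shear1 (s * (Num.sqrt 2 - 1)) (shear2 (- s * (Num.sqrt 2)^-1) (shear1 (s * (Num.sqrt 2 - 1)) z)).
Proof.
move=> s1; pose r : R := Num.sqrt 2.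
have r2 : r ^+ 2 = 2 by rewrite sqr_sqrtr.
have r0 : r != 0 by rewrite gt_eqF// sqrtr_gt0.
have A (x y : R) : r^-1 * (x + s * y) = (x + s * (r - 1) * y) + s * (r - 1) * (y + - s * r^-1 * (x + s * (r - 1) * y)).
  apply: (mulfI r0); rewrite mulrA mulfV// mul1r.
  transitivity (r * (x + s * (r - 1) * y) + s * (r - 1) * (r * y - s * (x + s * (r - 1) * y))).
    have -> : r * (x + s * (r - 1) * y) + s * (r - 1) * (r * y - s * (x + s * (r - 1) * y)) =
      x + s * y + (r ^+ 2 - 2) * s * y + (1 - s ^+ 2) * ((r - 1) * x + s * (r - 1) ^+ 2 * y).
      ring.
    by rewrite r2 s1 !subrr !mul0r !addr0.
  by field.
have B (x y : R) : r^-1 * (y + - s * x) = y + - s * r^-1 * (x + s * (r - 1) * y).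
  apply: (mulfI r0); rewrite mulrA mulfV// mul1r.
  transitivity (r * y - s * (x + s * (r - 1) * y)); last by field.
  have -> : r * y - s * (x + s * (r - 1) * y) = y + - s * x + (1 - s ^+ 2) * (r - 1) * y by ring.
  by rewrite s1 subrr !mul0r addr0.
by rewrite /rot /shear1 /shear2 /add3 /scale3/= -/r !A !B.
Qed.

Lemma preserves_integral_rot (s : R) : s ^+ 2 = 1 -> preserves_integral leb6 (rot s).
Proof.
move=> s1.
have -> : rot s = fun z => shear1 (s * (Num.sqrt 2 - 1))
    (shear2 (- s * (Num.sqrt 2)^-1) (shear1 (s * (Num.sqrt 2 - 1)) z)).
  by apply/funext => z; exact: rot_shears.
apply: preserves_integral_comp; first exact: preserves_integral_shear1.
apply: preserves_integral_comp; first exact: preserves_integral_shear2.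
exact: preserves_integral_shear1.
Qed.

Lemma rotK (s : R) : s ^+ 2 = 1 -> cancel (rot s) (rot (- s)).
Proof.
move=> s1 z; pose r : R := Num.sqrt 2.
have r2 : r ^+ 2 = 2 by rewrite sqr_sqrtr.
have r0 : r != 0 by rewrite gt_eqF// sqrtr_gt0.
have k : r^-1 * r^-1 * (1 + s ^+ 2) = 1.
  by rewrite s1 -invfM -expr2 r2 -[1 + 1]/(2%:R) mulVf.
have A (x y : R) : r^-1 * (r^-1 * (x + s * y) + - s * (r^-1 * (y + - s * x))) = x.
  by rewrite -[RHS]mul1r -k; ring.
have B (x y : R) : r^-1 * (r^-1 * (y + - s * x) + - - s * (r^-1 * (x + s * y))) = y.
  by rewrite -[RHS]mul1r -k; ring.
rewrite /rot /add3 /scale3/= -/r !A !B.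
by case: z => [[[? ?] ?] [[? ?] ?]].
Qed.

Lemma in_diff_sumE (f : R6 R -> R[i]) : in_diff_sum f = fun z => f (rot 1 z).
Proof.
apply/funext => z; rewrite /in_diff_sum /rot /scale3 /add3 /sub3/=.
by rewrite !mul1r !mulN1r.
Qed.

Lemma measurable_rot s : measurable_fun [set: R6 R] (rot s).
Proof.
by rewrite /rot; mfun6.
Qed.

Lemma dot6_rot (s : R) (z w : R6 R) : s ^+ 2 = 1 -> dot6 (rot s z) (rot s w) = dot6 z w.
Proof.
move=> s1; pose r : R := Num.sqrt 2.
have r2 : r ^+ 2 = 2 by rewrite sqr_sqrtr.
have k : r^-1 ^+ 2 * (1 + s ^+ 2) = 1.
  by rewrite s1 exprVn r2 -[1 + 1]/(2%:R) mulVf.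
by rewrite /dot6 /dot3 /rot /scale3 /add3/= -/r -[RHS]mul1r -k; ring.
Qed.

End translations.

(** * Trapezoids *)

Section convolution.
Context {R : realType}.
Local Notation mu := (@lebesgue_measure R).
Implicit Types f g : R1 R -> R[i].

Definition conv f g (x : R1 R) : R[i] :=
  cintegral mu (fun y : R1 R => f y * g (x - y : R)).

Lemma cmeasurable_sub g : cmeasurable g ->
  cmeasurable (fun z : R1 R * R1 R => g (z.1 - z.2 : R)).
Proof.
move=> mg; apply: (cmeasurable_comp (h := fun z : R1 R * R1 R => (z.1 - z.2 : R) : R1 R)) mg.
by apply: measurable_funB; mfun.
Qed.

Lemma cintegrable_conv f g : cintegrable mu f -> cintegrable mu g ->
  cintegrable (mu \x mu)%E (fun z : R1 R * R1 R => f z.2 * g (z.1 - z.2 : R)).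
Proof.
move=> /cintegrableP[mf foo] /cintegrableP[mg goo].
have m1 : cmeasurable (fun z : R1 R * R1 R => f z.2).
  exact: (cmeasurable_comp measurable_snd mf).
have m2 := cmeasurable_sub mg.
have m12 := cmeasurableM m1 m2.
apply/cintegrableP; split => //.
rewrite fubini_tonelli2; last 2 first.
- exact: cmeasurable_normE m12.
- by move=> z; rewrite lee_fin normc_ge0.
rewrite /fubini_G/=.
have inner (y : R1 R) : (\int[mu]_x (normc (f y * g (x - y : R)))%:E =
    (normc (f y))%:E * \int[mu]_x (normc (g x))%:E)%E.
  under eq_integral do rewrite Normc.normcM EFinM.
  rewrite ge0_integralZl//.
  - congr (_ * _)%E.
    have [_ ip] := preserves_integral_shiftR (- y : R).
    apply: (ip (fun x => (normc (g x))%:E)); first exact: cmeasurable_normE.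
    by move=> x; rewrite lee_fin normc_ge0.
  - apply: (cmeasurable_normE (f := fun x : R1 R => g (x - y : R))).
    exact: (cmeasurable_comp (measurable_shiftR (- y : R)) mg).
  - by move=> x _; rewrite lee_fin normc_ge0.
  - by rewrite lee_fin normc_ge0.
under eq_integral do rewrite inner.
rewrite ge0_integralZr//.
- by rewrite lte_mul_pinfty// ?ge0_fin_numE// ?integral_ge0// => x _; rewrite lee_fin normc_ge0.
- exact: cmeasurable_normE.
- by move=> x _; rewrite lee_fin normc_ge0.
- by rewrite integral_ge0// => x _; rewrite lee_fin normc_ge0.
Qed.

Lemma cintegrable_character f (xi : R) : cintegrable mu f ->
  cintegrable mu (fun x : R1 R => expi (- (xi * x)) * f x).
Proof.
move=> fi; apply: (@cintegrableM_bounded _ _ _ _ _ _ 1) => //.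
  by apply: cmeasurable_expi; mfun.
by move=> x; rewrite normc_expi.
Qed.

(** The bound on [g] makes the convolution integrand integrable in [y] for every [x], so the phase
    in [x] can be moved in and out of the inner integral everywhere. *)
Lemma fourier1_conv f g (xi M : R) : cintegrable mu f -> cintegrable mu g ->
  (forall x, normc (g x) <= M) ->
  fourier1 (conv f g) xi = fourier1 f xi * fourier1 g xi.
Proof.
move=> fi gi gM.
pose F (z : R1 R * R1 R) : R[i] := expi (- (xi * z.1)) * (f z.2 * g (z.1 - z.2 : R)).
have iF : cintegrable (mu \x mu)%E F.
  apply: (@cintegrableM_bounded _ _ _ _ _ _ 1).
  - by apply: cmeasurable_expi; mfun.
  - exact: cintegrable_conv.
  - by move=> z; rewrite normc_expi.
have inner (y : R1 R) : cintegral mu (fun x => F (x, y)) = fourier1 g xi * (expi (- (xi * y)) * f y).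
  have gs : cintegrable mu (fun x : R1 R => expi (- (xi * (x - y : R))) * g (x - y : R)).
    apply: (cintegrable_preserves (f := fun x : R1 R => expi (- (xi * x)) * g x) (preserves_integral_shiftR (- y : R))).
    exact: cintegrable_character.
  rewrite (@eq_cintegral _ _ _ _ _ (fun x : R1 R => (expi (- (xi * y)) * f y) * (expi (- (xi * (x - y : R))) * g (x - y : R)))).
    rewrite cintegralZ// mulrC; congr (_ * _).
    rewrite (cintegral_preserves (f := fun x : R1 R => expi (- (xi * x)) * g x) (preserves_integral_shiftR (- y : R)))//.
    exact: (cintegrable_cmeasurable (cintegrable_character xi gi)).
  move=> x; rewrite /F/=.
  have -> : - (xi * x) = - (xi * y) + - (xi * (x - y : R)) by ring.
  by rewrite expiD; ring.
have := cfubini iF.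
under eq_cintegral.
  move=> x; rewrite /F/= cintegralZ; last first.
    under eq_fun do rewrite mulrC.
    apply: (@cintegrableM_bounded _ _ _ _ _ _ M) => //.
    apply: cmeasurable_comp (cintegrable_cmeasurable gi).
    by apply: measurable_funB; mfun.
  over.
rewrite -/(fourier1 (conv f g) xi) => ->.
under eq_cintegral do rewrite inner.
by rewrite cintegralZ 1?mulrC//; exact: cintegrable_character.
Qed.

End convolution.

Section trapezoid.
Context {R : realType}.
Local Notation mu := (@lebesgue_measure R).
Variables (a b dl : R).

(** The average over shifts of size at most [dl] of the indicator of [[a - dl, b + dl]]: for
    [a <= b] it is 1 on [[a, b]] and 0 outside [[a - 2 dl, b + 2 dl]]. Being a normalized
    convolution of two indicators, it has a Fourier transform that decays quadratically. *)
Definition trapezoid (x : R1 R) : R :=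
  (2 * dl)^-1 * Rintegral mu `[- dl, dl] (fun y : R1 R => \1_`[a - dl, b + dl] (x - y : R)).

Lemma measurable_box (x : R1 R) :
  measurable_fun [set: R1 R] (fun y : R1 R => \1_`[a - dl, b + dl] (x - y : R) : R).
Proof.
apply: (@measurableT_comp _ _ _ _ _ _ (\1_`[a - dl, b + dl] : R1 R -> R) _ (fun y : R1 R => (x - y : R) : R1 R)).
  exact: measurable_indic.
by apply: measurable_funB; mfun.
Qed.

Lemma trapezoidE x : (trapezoid x)%:C =
  ((2 * dl)^-1)%:C * conv (itv_fun (- dl) dl) (itv_fun (a - dl) (b + dl)) x.
Proof.
rewrite /conv /itv_fun cintegral_indicM /trapezoid /=.
rewrite [X in _ +i* X](_ : _ = 0); last by rewrite /Rintegral integral0.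
by apply: complex_eq; rewrite ?ReM ?ImM/= ?mul0r ?mulr0 ?subr0 ?addr0.
Qed.

Hypotheses (ab : a <= b) (dl0 : 0 < dl).

Let dl2 : 0 < 2 * dl. Proof. by rewrite mulr_gt0. Qed.

Let Rint_cst (k : R) : Rintegral mu `[- dl, dl] (cst k) = k * (2 * dl).
Proof.
rewrite Rintegral_cst//= lebesgue_measure_itvE/=; last by move: dl0; lra.
by congr (_ * _); ring.
Qed.

Lemma trapezoid_ge0 x : 0 <= trapezoid x.
Proof.
apply: mulr_ge0; first by rewrite invr_ge0 ltW.
by apply: Rintegral_ge0.
Qed.

Lemma trapezoid_le1 x : trapezoid x <= 1.
Proof.
rewrite /trapezoid ler_pdivrMl// mulr1 -[leRHS]mul1r -Rint_cst.
have ic : mu.-integrable `[- dl, dl] (EFin \o cst (1:R)).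
  by apply: continuous_integrable_itv => y; exact: cvg_cst.
apply: le_Rintegral => //=.
apply: (le_integrable _ _ _ ic) => //.
  by apply/measurable_EFinP; apply: measurable_funTS; exact: measurable_box.
by move=> y _ /=; rewrite lee_fin normr1 ger0_norm// indicE lern1 leq_b1.
Qed.

Lemma trapezoid1 x : a <= x <= b -> trapezoid x = 1.
Proof.
move=> /andP[ax xb]; rewrite /trapezoid.
rewrite (@eq_Rintegral _ _ _ _ _ (cst 1)); last first.
  move=> y; rewrite inE/= in_itv/= => /andP[y1 y2].
  by rewrite indicE mem_set//= in_itv/=; apply/andP; split; move: ax xb y1 y2; lra.
by rewrite Rint_cst mul1r mulVf// gt_eqF.
Qed.

Lemma trapezoid0 x : ~~ (a - 2 * dl <= x <= b + 2 * dl) -> trapezoid x = 0.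
Proof.
move=> xab; rewrite /trapezoid.
rewrite (@eq_Rintegral _ _ _ _ _ (cst 0)); last first.
  move=> y; rewrite inE/= in_itv/= => /andP[y1 y2].
  rewrite indicE memNset//= in_itv/= => /andP[h1 h2].
  by move/negP: xab; apply; apply/andP; split; move: h1 h2 y1 y2; lra.
by rewrite Rint_cst mul0r mulr0.
Qed.

Lemma cmeasurable_trapezoid : cmeasurable (fun x : R1 R => (trapezoid x)%:C).
Proof.
under eq_fun do rewrite trapezoidE.
apply: cmeasurableM; first exact: cmeasurable_cst.
apply: (cmeasurable_cintegral_param mu (f := fun z : R1 R * R1 R =>
  itv_fun (- dl) dl z.2 * itv_fun (a - dl) (b + dl) (z.1 - z.2 : R))).
apply: cmeasurableM.
- exact: (cmeasurable_comp measurable_snd (cintegrable_cmeasurable (cintegrable_itv_fun _ _))).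
- exact: (cmeasurable_sub (cintegrable_cmeasurable (cintegrable_itv_fun _ _))).
Qed.

Lemma measurable_trapezoid : measurable_fun [set: R1 R] trapezoid.
Proof. by have [] := cmeasurable_trapezoid. Qed.

Lemma cintegrable_trapezoid : cintegrable mu (fun x : R1 R => (trapezoid x)%:C).
Proof.
apply: (@cintegrable_dominated _ _ _ _ _ (\1_`[a - 2 * dl, b + 2 * dl] : R1 R -> R)).
- exact: cmeasurable_trapezoid.
- by apply: integrable_indic_lty => //; exact: lebesgue_measure_itv_lty.
- move=> x; rewrite normc_realC ger0_norm ?trapezoid_ge0// indicE.
  have [_|/negP xn] := boolP (x \in _); first exact: trapezoid_le1.
  rewrite trapezoid0//; apply/negP => xi; apply: xn.
  by rewrite inE/= in_itv.
Qed.

(** The transform is a product of two interval transforms. In the weight, the term 1 is paired with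
    the size bounds of both factors and the term [(c xi)^2] with their decay bounds. The scale [c]
    is free: [c = n] for the window, [c = 1] for mere integrability. *)
Lemma fourier1_trapezoid (c xi : R) :
  normc (fourier1 (fun x : R1 R => (trapezoid x)%:C) xi) * (1 + (c * xi) ^+ 2) <=
  (2 * dl)^-1 * (8 * dl * (b - a + 2 * dl) + 16 * c ^+ 2).
Proof.
have -> : fourier1 (fun x : R1 R => (trapezoid x)%:C) xi =
    ((2 * dl)^-1)%:C * (fourier1 (itv_fun (- dl) dl) xi * fourier1 (itv_fun (a - dl) (b + dl)) xi).
  rewrite -(@fourier1_conv _ _ _ _ 1); try exact: cintegrable_itv_fun; last first.
    by move=> x; rewrite /itv_fun normc_realC ger0_norm// indicE lern1 leq_b1.
  have cE x : conv (itv_fun (- dl) dl) (itv_fun (a - dl) (b + dl)) x =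
      (2 * dl)%:C * (trapezoid x)%:C.
    rewrite trapezoidE mulrA -[_%:C * _%:C]rmorphM mulfV ?mul1r//.
    by rewrite gt_eqF.
  rewrite [in RHS]/fourier1; under [in RHS]eq_cintegral do rewrite cE mulrCA.
  rewrite cintegralZ; last exact: cintegrable_character cintegrable_trapezoid.
  by rewrite mulrA -[_%:C * _%:C]rmorphM mulVf ?mul1r// gt_eqF.
have h1 : - dl < dl by move: dl0; lra.
have h2 : a - dl < b + dl by move: dl0 ab; lra.
have k0 : 0 < (2 * dl)^-1 by rewrite invr_gt0.
rewrite !Normc.normcM normc_realC (gtr0_norm k0) -[leLHS]mulrA (ler_pM2l k0).
have [p1 p2] := normc_fourier1_itv xi h1; have [q1 q2] := normc_fourier1_itv xi h2.
move: p1 p2 q1 q2; set p := normc _; set q := normc _ => p1 p2 q1 q2.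
have p0 : 0 <= p by exact: normc_ge0.
have q0 : 0 <= q by exact: normc_ge0.
have -> : p * q * (1 + (c * xi) ^+ 2) = p * q + (`|xi| * p) * (`|xi| * q) * c ^+ 2.
  by rewrite exprMn -[xi ^+ 2]real_normK ?num_real//; ring.
apply: lerD.
- have -> : 8 * dl * (b - a + 2 * dl) = (2 * (dl - - dl)) * (2 * (b + dl - (a - dl))) by ring.
  exact: ler_pM.
- rewrite ler_wpM2r ?sqr_ge0//.
  have -> : 16 = 4 * 4 :> R by ring.
  by apply: ler_pM => //; rewrite mulr_ge0.
Qed.

End trapezoid.

(** * The evolution as a Gaussian convolution *)

Section tensors.
Context {R : realType}.
Local Notation mu := (@lebesgue_measure R).
Implicit Types (a b c : R1 R -> R[i]).

Definition tensor3 a b c (x : R3 R) : R[i] := a x.1.1 * b x.1.2 * c x.2.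
Definition tensor6 (F G : R3 R -> R[i]) (z : R6 R) : R[i] := F z.1 * G z.2.

Lemma cintegrable_tensor2 a b : cintegrable mu a -> cintegrable mu b ->
  cintegrable leb2 (fun x : R1 R * R1 R => a x.1 * b x.2).
Proof. exact: (@cintegrable_tensor _ _ _ _ R mu mu). Qed.

Lemma cintegrable_tensor3 a b c : cintegrable mu a -> cintegrable mu b ->
  cintegrable mu c -> cintegrable leb3 (tensor3 a b c).
Proof.
move=> ai bi ci.
exact: (@cintegrable_tensor _ _ _ _ R leb2 mu _ _ (cintegrable_tensor2 ai bi) ci).
Qed.

Lemma cintegral_tensor3 a b c : cintegrable mu a -> cintegrable mu b ->
  cintegrable mu c ->
  cintegral leb3 (tensor3 a b c) = cintegral mu a * cintegral mu b * cintegral mu c.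
Proof.
move=> ai bi ci.
have H := @cintegral_tensor _ _ _ _ R leb2 mu _ _ (cintegrable_tensor2 ai bi) ci.
apply: (etrans H); congr (_ * _).
exact: (@cintegral_tensor _ _ _ _ R mu mu).
Qed.

Lemma cintegrable_tensor6 F G : cintegrable leb3 F -> cintegrable leb3 G ->
  cintegrable leb6 (tensor6 F G).
Proof. exact: (@cintegrable_tensor _ _ _ _ R leb3 leb3). Qed.

Lemma cintegral_tensor6 F G : cintegrable leb3 F -> cintegrable leb3 G ->
  cintegral leb6 (tensor6 F G) = cintegral leb3 F * cintegral leb3 G.
Proof. exact: (@cintegral_tensor _ _ _ _ R leb3 leb3). Qed.

End tensors.

Section propagator.
Context {R : realType}.
Local Notation mu := (@lebesgue_measure R).

Definition box_indic (n : nat) (x : R1 R) : R[i] := itv_fun (- n%:R) n%:R x.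
Definition box3 n := tensor3 (box_indic n) (box_indic n) (box_indic n).
Definition box6 n := tensor6 (box3 n) (box3 n).

Lemma cintegrable_box6 n : cintegrable leb6 (box6 n).
Proof.
have h := @cintegrable_itv_fun R.
by apply: cintegrable_tensor6; apply: cintegrable_tensor3; exact: h.
Qed.

Lemma normc_box_indic n x : normc (box_indic n x) <= 1.
Proof. by rewrite normc_realC ger0_norm// indicE lern1 leq_b1. Qed.

Lemma normc_box6 n z : normc (box6 n z) <= 1.
Proof.
rewrite /box6 /tensor6 /box3 /tensor3 !Normc.normcM.
by rewrite !mulr_ile1 ?normc_box_indic ?mulr_ge0 ?normc_ge0.
Qed.

Lemma box_indic_cvg x : ccvg (box_indic ^~ x) 1.
Proof.
split => /=; last exact: cvg_cst.
apply: cvg_near_cst; near=> n.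
rewrite indicE mem_set//= in_itv/= -ler_norml.
by near: n; exact: nbhs_infty_ger.
Unshelve. all: by end_near. Qed.

Lemma box6_cvg z : ccvg (box6 ^~ z) 1.
Proof.
have -> : (1 : R[i]) = (1 * 1 * 1) * (1 * 1 * 1) by rewrite !mulr1.
by rewrite /box6 /tensor6 /box3 /tensor3; do !apply: ccvgM; exact: box_indic_cvg.
Qed.

(** The inverse transform, without normalization, of the multiplier [expi (- t |p|^2)] restricted to
    the cube [[-n, n]^6]. *)
Definition cutoff_kernel (t : R) (n : nat) (w : R6 R) : R[i] :=
  cintegral leb6 (fun p => box6 n p * expi (dot6 p w - t * dot6 p p)).

Lemma cutoff_kernelE t n w : cutoff_kernel t n w =
  (chirp_cutoff t n w.1.1.1 * chirp_cutoff t n w.1.1.2 * chirp_cutoff t n w.1.2) *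
  (chirp_cutoff t n w.2.1.1 * chirp_cutoff t n w.2.1.2 * chirp_cutoff t n w.2.2).
Proof.
pose e (w : R) (p : R1 R) : R[i] := (\1_`[- n%:R, n%:R] p)%:C * expi (w * p - t * p ^+ 2).
have ei (v : R) : cintegrable mu (e v).
  apply: (@cintegrable_indicM _ _ _ _ _ _ 1) => //.
  - exact: lebesgue_measure_itv_lty.
  - by apply: cmeasurable_expi; apply: measurable_funB; mfun.
  - by move=> p; rewrite normc_expi.
have E3 u v s := @cintegral_tensor3 R _ _ _ (ei u) (ei v) (ei s).
have I3 u v s := @cintegrable_tensor3 R _ _ _ (ei u) (ei v) (ei s).
rewrite /chirp_cutoff -!/(e _) -!E3 -cintegral_tensor6//.
apply: eq_cintegral => p.
rewrite /box6 /tensor6 /box3 /tensor3 /e /box_indic /itv_fun.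
have -> : dot6 p w - t * dot6 p p =
  ((w.1.1.1 * p.1.1.1 - t * p.1.1.1 ^+ 2) + (w.1.1.2 * p.1.1.2 - t * p.1.1.2 ^+ 2) + (w.1.2 * p.1.2 - t * p.1.2 ^+ 2)) +
  ((w.2.1.1 * p.2.1.1 - t * p.2.1.1 ^+ 2) + (w.2.1.2 * p.2.1.2 - t * p.2.1.2 ^+ 2) + (w.2.2 * p.2.2 - t * p.2.2 ^+ 2)).
  by rewrite /dot6 /dot3; ring.
by rewrite !expiD; ring.
Qed.

Definition fresnel_factor (t : R) : R[i] := ((Num.sqrt t)^-1)%:C * fresnel_const.

Lemma cutoff_kernel_cvg (t : R) (w : R6 R) : 0 < t ->
  ccvg (fun n => cutoff_kernel t n w) (fresnel_factor t ^+ 6 * expi (dot6 w w / (4 * t))).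
Proof.
move=> t0; under eq_fun do rewrite cutoff_kernelE.
have -> : fresnel_factor t ^+ 6 * expi (dot6 w w / (4 * t)) =
  let k v := ((Num.sqrt t)^-1)%:C * expi (v ^+ 2 / (4 * t)) * fresnel_const in
  (k w.1.1.1 * k w.1.1.2 * k w.1.2) * (k w.2.1.1 * k w.2.1.2 * k w.2.2).
  rewrite /fresnel_factor /=.
  have -> : dot6 w w / (4 * t) =
    (w.1.1.1 ^+ 2 / (4 * t) + w.1.1.2 ^+ 2 / (4 * t) + w.1.2 ^+ 2 / (4 * t)) +
    (w.2.1.1 ^+ 2 / (4 * t) + w.2.1.2 ^+ 2 / (4 * t) + w.2.2 ^+ 2 / (4 * t)).
    by rewrite /dot6 /dot3; ring.
  by rewrite !expiD; ring.
by do !apply: ccvgM; exact: chirp_cutoff_cvg.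
Qed.

Lemma cutoff_kernel_bounded (t : R) n (w : R6 R) : 0 < t ->
  normc (cutoff_kernel t n w) <= (8 / Num.sqrt t) ^+ 6.
Proof.
move=> t0; rewrite cutoff_kernelE !Normc.normcM.
set k := 8 / _.
have k0 : 0 <= k by rewrite divr_ge0// sqrtr_ge0.
have h v : normc (chirp_cutoff t n v) <= k by exact: chirp_cutoff_bounded.
have h3 u v s : normc (chirp_cutoff t n u) * normc (chirp_cutoff t n v) * normc (chirp_cutoff t n s) <= k * k * k.
  by rewrite !ler_pM// ?mulr_ge0 ?normc_ge0.
have -> : k ^+ 6 = (k * k * k) * (k * k * k) by ring.
by rewrite ler_pM// ?mulr_ge0 ?normc_ge0.
Qed.

Definition propagator_const (t : R) : R[i] :=
  (((2 * pi) ^+ 6)^-1)%:C * fresnel_factor t ^+ 6.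

Definition gauss_phase (t : R) (z w : R6 R) : R[i] :=
  expi (dot6 (sub6 z w) (sub6 z w) / (4 * t)).

Definition propagator (t : R) (f : R6 R -> R[i]) (z : R6 R) : R[i] :=
  propagator_const t * cintegral leb6 (fun w => gauss_phase t z w * f w).

Lemma cmeasurable_gauss_phase d (T : measurableType d) t (f g : T -> R6 R) :
  measurable_fun [set: T] f -> measurable_fun [set: T] g ->
  cmeasurable (fun x => gauss_phase t (f x) (g x)).
Proof.
move=> mf mg; by apply: cmeasurable_expi; mfun6.
Qed.

(** The double integral in the frequency [p] and the point [w] is not absolutely convergent, so the
    order can only be exchanged after inserting [box6 n]. The integrals before and after the
    exchange are equal for each [n], and each has its own limit. *)
Lemma schrodingerE (t : R) (f : R6 R -> R[i]) (z : R6 R) : 0 < t -> nice f ->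
  schrodinger t f z = propagator t f z.
Proof.
move=> t0 [fi Ffi]; rewrite /schrodinger /propagator /propagator_const -mulrA; congr (_ * _).
pose ph (p : R6 R) : R[i] := expi (dot6 p z) * expi (- (t * dot6 p p)).
have mph : cmeasurable ph.
  apply: cmeasurableM; apply: cmeasurable_expi.
  - by mfun6.
  - by mfun6.
have nph p : normc (ph p) = 1 by rewrite Normc.normcM !normc_expi mulr1.
have mF := cintegrable_cmeasurable Ffi.
have mf := cintegrable_cmeasurable fi.
(* On the frequency side, the domination is the integrability of [fourier f]. *)
have lim1 : ccvg (fun n => cintegral leb6 (fun p => box6 n p * (ph p * fourier f p)))
    (cintegral leb6 (fun p => ph p * fourier f p)).
  apply: (@cintegral_dominated _ _ _ _ _ _ (fun p => normc (fourier f p))).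
  - move=> n; apply: cmeasurableM; first exact: cintegrable_cmeasurable (cintegrable_box6 n).
    exact: cmeasurableM.
  - move=> p; rewrite -[X in ccvg _ X]mul1r; apply: ccvgM; first exact: box6_cvg.
    exact: ccvg_cst.
  - exact: cintegrable_norm.
  - move=> n p; rewrite Normc.normcM (Normc.normcM (ph p)) nph mul1r -[leRHS]mul1r ler_wpM2r ?normc_ge0//.
    exact: normc_box6.
(* On the space side, it is the uniform Fresnel bound times the integrable [f]. *)
have lim2 : ccvg (fun n => cintegral leb6 (fun w => cutoff_kernel t n (sub6 z w) * f w))
    (cintegral leb6 (fun w => fresnel_factor t ^+ 6 * gauss_phase t z w * f w)).
  apply: (@cintegral_dominated _ _ _ _ _ _ (fun w => (8 / Num.sqrt t) ^+ 6 * normc (f w))).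
  - move=> n; apply: cmeasurableM; last exact: mf.
    rewrite /cutoff_kernel.
    apply: (cmeasurable_cintegral_param leb6 (f := fun x : R6 R * R6 R => box6 n x.2 * expi (dot6 x.2 (sub6 z x.1) - t * dot6 x.2 x.2))).
    apply: cmeasurableM.
      exact: (cmeasurable_comp measurable_snd (cintegrable_cmeasurable (cintegrable_box6 n))).
    by apply: cmeasurable_expi; mfun6.
  - move=> w; apply: ccvgM; last exact: ccvg_cst.
    exact: cutoff_kernel_cvg.
  - exact: cintegrable_normZ.
  - move=> n w; rewrite Normc.normcM ler_wpM2r ?normc_ge0//.
    exact: cutoff_kernel_bounded.
have eq12 n : cintegral leb6 (fun p => box6 n p * (ph p * fourier f p)) =
    cintegral leb6 (fun w => cutoff_kernel t n (sub6 z w) * f w).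
  (* Unimodular phases times a tensor product of integrable functions, hence integrable on the
     product. *)
  pose G (x : R6 R * R6 R) : R[i] := ph x.1 * expi (- dot6 x.1 x.2) * (box6 n x.1 * f x.2).
  have iG : cintegrable (leb6 \x leb6)%E G.
    apply: (@cintegrableM_bounded _ _ _ _ _ _ 1).
    - apply: cmeasurableM; first exact: (cmeasurable_comp measurable_fst mph).
      by apply: cmeasurable_expi; mfun6.
    - exact: (cintegrable_tensor (cintegrable_box6 n) fi).
    - by move=> x; rewrite (Normc.normcM (ph x.1)) normc_expi mulr1 nph.
  have L p : cintegral leb6 (fun w => G (p, w)) = box6 n p * (ph p * fourier f p).
    rewrite /fourier mulrA -cintegralZ.
      by apply: eq_cintegral => w; rewrite /G/=; ring.
    apply: (@cintegrableM_bounded _ _ _ _ _ _ 1) => //.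
      by apply: cmeasurable_expi; mfun6.
    by move=> w; rewrite normc_expi.
  have K w : cintegral leb6 (fun p => G (p, w)) = cutoff_kernel t n (sub6 z w) * f w.
    rewrite /cutoff_kernel mulrC -cintegralZ.
      apply: eq_cintegral => p; rewrite /G/= /ph.
      have -> : dot6 p (sub6 z w) - t * dot6 p p = dot6 p z + - (t * dot6 p p) + - dot6 p w.
        by rewrite /dot6 /dot3 /sub6 /sub3/=; ring.
      by rewrite !expiD; ring.
    under eq_fun do rewrite mulrC.
    apply: (@cintegrableM_bounded _ _ _ _ _ _ 1).
    - by apply: cmeasurable_expi; mfun6.
    - exact: cintegrable_box6.
    - by move=> p; rewrite normc_expi.
  have := cfubini iG.
  by under eq_cintegral do rewrite L; under [in X in _ = X -> _]eq_cintegral do rewrite K.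
have lim1' : ccvg (fun n => cintegral leb6 (fun w => cutoff_kernel t n (sub6 z w) * f w))
    (cintegral leb6 (fun p => ph p * fourier f p)).
  by under eq_fun do rewrite -eq12.
rewrite (ccvg_unique lim1' lim2).
under eq_cintegral do rewrite -mulrA.
rewrite cintegralZ//.
apply: (@cintegrableM_bounded _ _ _ _ _ _ 1) => //.
  by apply: cmeasurable_gauss_phase; mfun6.
by move=> w; rewrite normc_expi.
Qed.

End propagator.

(** * Schur's test *)

Section L2norm.
Context d (T : measurableType d) (R : realType).
Variable m : {measure set T -> \bar R}.
Local Open Scope ereal_scope.

Lemma Lnorm2E (a : T -> R) :
  Lnorm m 2%:E (EFin \o a) = sqrte (\int[m]_x (a x ^+ 2)%:E).
Proof.
rewrite unlock poweR12_sqrt; last by apply: integral_ge0 => x _; exact: poweR_ge0.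
congr sqrte; apply: eq_integral => x _.
by rewrite /comp abse_EFin poweR_EFin powR_mulrn// real_normK// num_real.
Qed.

Lemma Lnorm2_sqr (a : T -> R) :
  Lnorm m 2%:E (EFin \o a) ^+ 2 = \int[m]_x (a x ^+ 2)%:E.
Proof.
rewrite Lnorm2E sqr_sqrte//; apply: integral_ge0 => x _.
by rewrite lee_fin sqr_ge0.
Qed.

Lemma Lnorm2_le (a : T -> R) (B : R) : (0 <= B)%R ->
  \int[m]_x (a x ^+ 2)%:E <= (B ^+ 2)%:E -> Lnorm m 2%:E (EFin \o a) <= B%:E.
Proof.
move=> B0 h; rewrite Lnorm2E.
apply: le_trans (_ : sqrte (B ^+ 2)%:E <= _).
  by rewrite lee_sqrt// lee_fin sqr_ge0.
by rewrite /= sqrtr_sqr ger0_norm.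
Qed.

End L2norm.

Section schur.
Context d (T : measurableType d) (R : realType).
Variable m : {sigma_finite_measure set T -> \bar R}.
Local Open Scope ereal_scope.

(** The kernel is split into two square roots, and Cauchy-Schwarz on the product space separates
    [a sqrt k] from [b sqrt k]. Integrating out the other variable first bounds each squared norm by
    [L] times that of [a] or [b]. *)
Lemma schur_test (k : T * T -> R) (a b : T -> R) (L : R) :
  measurable_fun [set: T * T] k -> measurable_fun [set: T] a ->
  measurable_fun [set: T] b -> (forall z, (0 <= k z)%R) ->
  (forall x, (0 <= a x)%R) -> (forall x, (0 <= b x)%R) -> (0 <= L)%R ->
  (forall y, \int[m]_x (k (y, x))%:E <= L%:E) ->
  (forall x, \int[m]_y (k (y, x))%:E <= L%:E) ->
  \int[m]_y \int[m]_x (a y * b x * k (y, x))%:E <=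
  L%:E * (Lnorm m 2%:E (EFin \o a) * Lnorm m 2%:E (EFin \o b)).
Proof.
move=> mk ma mb k0 a0 b0 L0 kL1 kL2.
pose f1 (z : T * T) := (a z.1 * Num.sqrt (k z))%R.
pose g1 (z : T * T) := (b z.2 * Num.sqrt (k z))%R.
have mak : measurable_fun [set: T * T] (fun z => a z.1) by exact: (measurableT_comp ma).
have mbk : measurable_fun [set: T * T] (fun z => b z.2) by exact: (measurableT_comp mb).
have mf1 : measurable_fun [set: T * T] f1 by rewrite /f1; mfun.
have mg1 : measurable_fun [set: T * T] g1 by rewrite /g1; mfun.
have mabk : measurable_fun [set: T * T] (fun z => a z.1 * b z.2 * k z)%R by mfun.
rewrite -(fubini_tonelli1 (fun z => (a z.1 * b z.2 * k z)%:E)); last 2 first.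
- exact/measurable_EFinP.
- by move=> z; rewrite lee_fin !mulr_ge0.
have h12 : (2^-1 + 2^-1 = 1 :> R)%R by rewrite [RHS]splitr !mul1r.
have := @hoelder _ _ _ (m \x m) f1 g1 2%R 2%R mf1 mg1 (ltr0Sn R 1) (ltr0Sn R 1) h12.
rewrite Lnorm1.
have -> : \int[m \x m]_z `|(EFin \o (f1 \* g1)%R) z| = \int[m \x m]_z (a z.1 * b z.2 * k z)%:E.
  apply: eq_integral => z _; rewrite /= -abse_EFin/= ger0_norm /f1 /g1.
    by rewrite mulrACA -expr2 sqr_sqrtr.
  by rewrite !mulr_ge0// ?sqrtr_ge0.
move/le_trans; apply.
have bound (p : T -> R) (q : T * T -> R) : measurable_fun [set: T] p ->
    (\int[m \x m]_z (q z ^+ 2)%:E <= L%:E * \int[m]_x (p x ^+ 2)%:E) ->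
    Lnorm (m \x m) 2%:E (EFin \o q) <= sqrte L%:E * Lnorm m 2%:E (EFin \o p).
  move=> mp h; rewrite !Lnorm2E -sqrteM ?lee_fin// lee_sqrt// mule_ge0 ?lee_fin//.
  by apply: integral_ge0 => x _; rewrite lee_fin sqr_ge0.
have LL : L%:E = sqrte L%:E * sqrte L%:E by rewrite -sqrteM ?lee_fin// -expe2 sqrte_sqr/= ger0_norm.
rewrite {1}LL muleACA; apply: lee_pmul; rewrite ?Lnorm_ge0//.
- apply: bound => //.
  rewrite fubini_tonelli1; last 2 first.
  + by apply/measurable_EFinP; mfun.
  + by move=> z; rewrite lee_fin sqr_ge0.
  rewrite -ge0_integralZl//; last 2 first.
  + by apply/measurable_EFinP; mfun.
  + by move=> x _; rewrite lee_fin sqr_ge0.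
  apply: ge0_le_integral => //.
  + by move=> x _; apply: integral_ge0 => y _; rewrite lee_fin sqr_ge0.
  + apply: (measurable_fun_fubini_tonelli_F (fun z => (f1 z ^+ 2)%:E)).
      by apply/measurable_EFinP; mfun.
    by move=> z; rewrite lee_fin sqr_ge0.
  + by apply: emeasurable_funM => //; apply/measurable_EFinP; mfun.
  + move=> x _; rewrite /fubini_F/= /f1/=.
    under eq_integral do rewrite exprMn sqr_sqrtr// EFinM.
    rewrite ge0_integralZl//.
    * by rewrite muleC lee_wpmul2r// lee_fin sqr_ge0.
    * by apply/measurable_EFinP; exact: (measurable_fun_pair2 _ mk).
    * by move=> y _; rewrite lee_fin.
    * by rewrite lee_fin sqr_ge0.
- apply: bound => //.
  rewrite fubini_tonelli2; last 2 first.
  + by apply/measurable_EFinP; mfun.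
  + by move=> z; rewrite lee_fin sqr_ge0.
  rewrite -ge0_integralZl//; last 2 first.
  + by apply/measurable_EFinP; mfun.
  + by move=> x _; rewrite lee_fin sqr_ge0.
  apply: ge0_le_integral => //.
  + by move=> x _; apply: integral_ge0 => y _; rewrite lee_fin sqr_ge0.
  + apply: (measurable_fun_fubini_tonelli_G (fun z => (g1 z ^+ 2)%:E)).
      by apply/measurable_EFinP; mfun.
    by move=> z; rewrite lee_fin sqr_ge0.
  + by apply: emeasurable_funM => //; apply/measurable_EFinP; mfun.
  + move=> x _; rewrite /fubini_G/= /g1/=.
    under eq_integral do rewrite exprMn sqr_sqrtr// EFinM.
    rewrite ge0_integralZl//.
    * by rewrite muleC lee_wpmul2r// lee_fin sqr_ge0.
    * by apply/measurable_EFinP; exact: (measurable_fun_pair1 _ mk).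
    * by move=> y _; rewrite lee_fin.
    * by rewrite lee_fin sqr_ge0.
Qed.

End schur.

Section ge0_integral.
Context d (T : measurableType d) (R : realType).
Variable m : {measure set T -> \bar R}.
Local Open Scope ereal_scope.

(** The integral of a nonnegative function is a supremum over the simple functions below it, so a
    larger function has more of them. *)
Lemma ge0_le_integralT (f g : T -> \bar R) : (forall x, 0 <= f x) ->
  (forall x, f x <= g x) -> \int[m]_x f x <= \int[m]_x g x.
Proof.
move=> f0 fg; have g0 x : 0 <= g x := le_trans (f0 x) (fg x).
rewrite !ge0_integralTE//; apply: le_ereal_sup => _ [h hf <-].
by exists h => // x; exact: le_trans (hf x) (fg x).
Qed.

End ge0_integral.

Section mixed_schur.
Context {R : realType}.
Local Open Scope ereal_scope.

Lemma mixed_norm1E (f : R6 R -> R[i]) : mixed_norm 1%E f =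
  \int[leb3]_x Lnorm leb3 2%:E (fun y => (normc (f (x, y)))%:E).
Proof.
by rewrite /mixed_norm Lnorm1; apply: eq_integral => x _; rewrite gee0_abs// Lnorm_ge0.
Qed.

Lemma measurable_Lnorm2_section (F : R6 R -> R) : measurable_fun [set: R6 R] F ->
  measurable_fun [set: R3 R] (fun x : R3 R => Lnorm leb3 2%:E (fun y => (F (x, y))%:E)).
Proof.
move=> mF.
have -> : (fun x : R3 R => Lnorm leb3 2%:E (fun y => (F (x, y))%:E)) =
    (fun x : R3 R => (\int[leb3]_y (F (x, y) ^+ 2)%:E) `^ 2^-1).
  apply/funext => x; rewrite (@Lnorm2E _ _ _ leb3 (fun y => F (x, y))) poweR12_sqrt//.
  by apply: integral_ge0 => y _; rewrite lee_fin sqr_ge0.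
apply: (measurableT_comp (measurable_poweR _)).
apply: (measurable_fun_fubini_tonelli_F (m2 := leb3) (fun z => (F z ^+ 2)%:E)).
  by apply/measurable_EFinP; mfun.
by move=> z; rewrite lee_fin sqr_ge0.
Qed.

(** Since [L] is uniform in [x] and [x'], Schur's test in [y] and [y'] leaves the product of the L^2
    norms of the slices at [x] and [x'], whose double integral is a square. *)
Lemma mixed_schur (F : R6 R -> R) (k : R6 R * R6 R -> R) (L : R) :
  measurable_fun [set: R6 R] F -> measurable_fun [set: R6 R * R6 R] k ->
  (forall z, (0 <= F z)%R) -> (forall z, (0 <= k z)%R) -> (0 <= L)%R ->
  (forall x y x', \int[leb3]_y' (k ((x, y), (x', y')))%:E <= L%:E) ->
  (forall x x' y', \int[leb3]_y (k ((x, y), (x', y')))%:E <= L%:E) ->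
  \int[leb6]_w \int[leb6]_w' (F w * F w' * k (w, w'))%:E <=
  L%:E * (\int[leb3]_x Lnorm leb3 2%:E (fun y => (F (x, y))%:E)) ^+ 2.
Proof.
move=> mF mk F0 k0 L0 kL1 kL2.
pose H (z : R6 R * R6 R) : R := (F z.1 * F z.2 * k z)%R.
have mF1 : measurable_fun [set: R6 R * R6 R] (fun z => F z.1) by exact: (measurableT_comp mF).
have mF2 : measurable_fun [set: R6 R * R6 R] (fun z => F z.2) by exact: (measurableT_comp mF).
have mH : measurable_fun [set: R6 R * R6 R] H by rewrite /H; mfun.
have H0 z : (0 <= H z)%R by rewrite !mulr_ge0.
have mHE : measurable_fun [set: R6 R * R6 R] (fun z => (H z)%:E) by exact/measurable_EFinP.
pose N x := Lnorm leb3 2%:E (fun y => (F (x, y))%:E).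
have mN : measurable_fun [set: R3 R] N by exact: measurable_Lnorm2_section.
have N0 x : 0 <= N x by exact: Lnorm_ge0.
have E1 : \int[leb6]_w \int[leb6]_w' (H (w, w'))%:E =
    \int[leb3]_x \int[leb3]_y \int[leb6]_w' (H ((x, y), w'))%:E.
  apply: (@fubini_tonelli1 _ _ _ _ R leb3 leb3 (fun w => \int[leb6]_w' (H (w, w'))%:E)).
    exact: (measurable_fun_fubini_tonelli_F (m2 := leb6) (fun z => (H z)%:E)).
  by move=> w; apply: integral_ge0 => w' _; rewrite lee_fin.
(* Moves [x'] outside [y], so that [y] and [y'] are the two innermost variables. *)
have E2 x : \int[leb3]_y \int[leb6]_w' (H ((x, y), w'))%:E =
    \int[leb3]_x' \int[leb3]_y \int[leb3]_y' (H ((x, y), (x', y')))%:E.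
  transitivity (\int[leb3]_y \int[leb3]_x' \int[leb3]_y' (H ((x, y), (x', y')))%:E).
    apply: eq_integral => y _.
    apply: (@fubini_tonelli1 _ _ _ _ R leb3 leb3 (fun w' => (H ((x, y), w'))%:E)).
      exact: (measurable_fun_pair2 (x, y) mHE).
    by move=> w'; rewrite lee_fin.
  apply: (@fubini_tonelli _ _ _ _ R leb3 leb3 (fun z => \int[leb3]_y' (H ((x, z.1), (z.2, y')))%:E)).
    apply: (measurable_fun_fubini_tonelli_F (m2 := leb3) (fun z : (R3 R * R3 R) * R3 R => (H ((x, z.1.1), (z.1.2, z.2)))%:E)).
      have mg : measurable_fun [set: (R3 R * R3 R) * R3 R]
          (fun z => ((x, z.1.1), (z.1.2, z.2)) : R6 R * R6 R) by mfun.
      exact: (measurableT_comp mHE mg).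
    by move=> z; rewrite lee_fin.
  by move=> z; apply: integral_ge0 => y' _; rewrite lee_fin.
rewrite [leLHS]E1; under eq_integral do rewrite E2.
apply: (@le_trans _ _ (\int[leb3]_x \int[leb3]_x' (L%:E * (N x * N x')))).
  apply: ge0_le_integralT => x.
    by do 3 (apply: integral_ge0 => ? _); rewrite lee_fin.
  apply: ge0_le_integralT => x'.
    by do 2 (apply: integral_ge0 => ? _); rewrite lee_fin.
  have mg : measurable_fun [set: R3 R * R3 R]
      (fun z => ((x, z.1), (x', z.2)) : R6 R * R6 R) by mfun.
  exact: (@schur_test _ (R3 R) R leb3 (fun z => k ((x, z.1), (x', z.2)))
    (fun y => F (x, y)) (fun y => F (x', y)) L (measurableT_comp mk mg)
    (measurable_fun_pair2 _ mF) (measurable_fun_pair2 _ mF) (fun=> k0 _)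
    (fun=> F0 _) (fun=> F0 _) L0 (fun y => kL1 x y x') (fun y' => kL2 x x' y')).
have iN : 0 <= \int[leb3]_x N x by apply: integral_ge0.
under eq_integral.
  move=> x _; rewrite ge0_integralZl//; last 2 first.
  - by apply: emeasurable_funM.
  - by move=> x' _; rewrite mule_ge0.
  rewrite ge0_integralZl//.
  over.
rewrite ge0_integralZl//; last 2 first.
- by apply: emeasurable_funM.
- by move=> x _; rewrite mule_ge0.
by rewrite ge0_integralZr// expe2.
Qed.

End mixed_schur.

Lemma conjCM (R : realType) (z w : R[i]) : (z * w)^*%C = z^*%C * w^*%C.
Proof. by case: z => a b; case: w => c d; apply: complex_eq => /=; ring. Qed.

Lemma realCM (R : realType) (a b : R) : (a * b)%:C = a%:C * b%:C.
Proof. by rewrite rmorphM. Qed.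

Lemma conjC_mul (R : realType) (z : R[i]) : z^*%C * z = (normc z ^+ 2)%:C.
Proof. by apply: complex_eq; rewrite normc_sqr; case: z => a b /=; ring. Qed.

(** * The a priori estimate *)

Section lorentzian_kernel.
Context {R : realType}.
Local Notation mu := (@lebesgue_measure R).

(** The factor is the bound of [fourier1_trapezoid] on [[-n, n]] with [dl = c = n], namely
    [(2 n)^-1 (32 n^2 + 16 n^2) = 24 n]. *)
Definition lorentz (n : nat) (xi : R) : R := 24 * n%:R * (1 + (n%:R * xi) ^+ 2)^-1.

Lemma lorentz_ge0 n xi : 0 <= lorentz n xi.
Proof. by rewrite mulr_ge0 ?mulr_ge0// invr_ge0 addr_ge0// sqr_ge0. Qed.

Lemma lorentz_le n xi : lorentz n xi <= 24 * n%:R.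
Proof.
rewrite /lorentz ler_piMr ?mulr_ge0// invf_le1 ?lerDl ?sqr_ge0//.
by rewrite ltr_pwDl// sqr_ge0.
Qed.

Lemma measurable_fun_lorentz d (T : measurableType d) n (f : T -> R) :
  measurable_fun [set: T] f -> measurable_fun [set: T] (fun x => lorentz n (f x)).
Proof.
move=> mf; rewrite /lorentz; apply: measurable_funM; first exact: measurable_cst.
by apply: (measurable_lorentzian (f := fun x => n%:R * f x)); mfun.
Qed.

(** Scaling cancels [n], which makes the Schur bound uniform in the window. The sign [e] serves [y]
    and [y'], which enter the frequency with opposite signs. *)
Lemma integral_lorentz n (k e c : R) : (0 < n)%N -> 0 < k -> e ^+ 2 = 1 ->
  (\int[mu]_x (lorentz n (k * (e * x + c)))%:E = (24 * pi / k)%:E)%E.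
Proof.
move=> n0 k0 e1; have n1 : 0 < n%:R :> R by rewrite ltr0n.
have nke : n%:R * k * e != 0.
  have e0 : e != 0 by apply: contra_eq_neq e1 => ->; rewrite expr0n/= eq_sym oner_eq0.
  by apply: mulf_neq0 => //; rewrite gt_eqF// mulr_gt0.
transitivity ((24 * n%:R)%:E * \int[mu]_x ((1 + (n%:R * k * e * x + n%:R * k * c) ^+ 2)^-1)%:E)%E.
  rewrite -ge0_integralZl//.
  - apply: eq_integral => x _; rewrite -EFinM /lorentz; congr ((_ * (1 + _ ^+ 2)^-1)%:E).
    by ring.
  - apply/measurable_EFinP.
    by apply: (measurable_lorentzian (f := fun x : R1 R => n%:R * k * e * x + n%:R * k * c)); mfun.
  - by move=> x _; rewrite lee_fin invr_ge0 addr_ge0// sqr_ge0.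
rewrite integral_lorentzian// -EFinM; congr (_%:E).
have -> : `|n%:R * k * e| = n%:R * k.
  rewrite normrM gtr0_norm ?mulr_gt0//.
  by have /eqP := congr1 Num.sqrt e1; rewrite sqrtr_sqr sqrtr1 => /eqP ->; rewrite mulr1.
by field; rewrite !gt_eqF.
Qed.

Lemma integral_tensor3 (a b c : R1 R -> R) :
  measurable_fun [set: R1 R] a -> measurable_fun [set: R1 R] b -> measurable_fun [set: R1 R] c ->
  (forall x, 0 <= a x) -> (forall x, 0 <= b x) -> (forall x, 0 <= c x) ->
  (\int[leb3]_x (a x.1.1 * b x.1.2 * c x.2)%:E =
   \int[mu]_x (a x)%:E * \int[mu]_x (b x)%:E * \int[mu]_x (c x)%:E)%E.
Proof.
move=> ma mb mc a0 b0 c0.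
have mab : measurable_fun [set: R1 R * R1 R] (fun x : R1 R * R1 R => (a x.1 * b x.2)%:E).
  apply/measurable_EFinP; apply: measurable_funM.
  - exact: (measurableT_comp ma).
  - exact: (measurableT_comp mb).
have := @integral_tensor _ _ _ _ R leb2 mu (fun x => (a x.1 * b x.2)%:E) (fun x => (c x)%:E) mab.
move=> H; under eq_integral do rewrite EFinM.
rewrite H; [|exact/measurable_EFinP|by move=> x; rewrite lee_fin mulr_ge0|by []].
congr (_ * _)%E; under eq_integral do rewrite EFinM.
apply: (@integral_tensor _ _ _ _ R mu mu (fun x => (a x)%:E) (fun x => (b x)%:E)) => //;
  exact/measurable_EFinP.
Qed.

Lemma integral_lorentz3 n (k e : R) (c : R3 R) : (0 < n)%N -> 0 < k -> e ^+ 2 = 1 ->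
  (\int[leb3]_y (lorentz n (k * (e * y.1.1 + c.1.1)) * lorentz n (k * (e * y.1.2 + c.1.2)) *
     lorentz n (k * (e * y.2 + c.2)))%:E = ((24 * pi / k) ^+ 3)%:E)%E.
Proof.
move=> n0 k0 e1.
have mL (c0 : R) : measurable_fun [set: R1 R] (fun y : R1 R => lorentz n (k * (e * y + c0))).
  by apply: (measurable_fun_lorentz n (f := fun y : R1 R => k * (e * y + c0))); mfun.
rewrite (integral_tensor3 (mL c.1.1) (mL c.1.2) (mL c.2)); try by move=> ?; exact: lorentz_ge0.
by rewrite !integral_lorentz// -!EFinM; congr (_%:E); ring.
Qed.

(** Plateau [[-n, n]] and support in [[-3 n, 3 n]]: all windows are dilates of one profile. *)
Definition window (n : nat) (x : R1 R) : R := trapezoid (- n%:R) n%:R n%:R x.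

Lemma normc_fourier1_window n xi : (0 < n)%N ->
  normc (fourier1 (fun x : R1 R => (window n x)%:C) xi) <= lorentz n xi.
Proof.
move=> n0; have n1 : 0 < n%:R :> R by rewrite ltr0n.
have nn : - n%:R <= n%:R :> R by rewrite (@le_trans _ _ 0)// oppr_le0.
have := fourier1_trapezoid nn n1 n%:R xi.
rewrite /lorentz ler_pdivlMr; last by rewrite ltr_pwDl// sqr_ge0.
move=> /le_trans; apply; rewrite le_eqVlt; apply/orP; left; apply/eqP.
by field; rewrite gt_eqF.
Qed.

End lorentzian_kernel.

Section quadratic_estimate.
Context {R : realType}.
Variables (t sg : R) (f : R6 R -> R[i]) (u : R3 R) (n : nat).
Hypotheses (t0 : 0 < t) (fi : cintegrable leb6 f) (n0 : (0 < n)%N).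

(** The coefficient of [v] in the Gaussian phase: the cross term of the squared distance carries
    [2 / sqrt 2], and the phase divides it by [4 t]. *)
Let kp : R := (Num.sqrt 2)^-1 / (2 * t).

Let freq (w w' : R6 R) : R3 R :=
  scale3 kp (add3 (scale3 sg (sub3 w.1 w'.1)) (sub3 w.2 w'.2)).

Definition schur_kernel (z : R6 R * R6 R) : R :=
  lorentz n (freq z.1 z.2).1.1 * lorentz n (freq z.1 z.2).1.2 * lorentz n (freq z.1 z.2).2.

Let kp0 : 0 < kp. Proof. by rewrite divr_gt0 ?invr_gt0 ?sqrtr_gt0 ?mulr_gt0. Qed.

Lemma schur_kernel_ge0 z : 0 <= schur_kernel z.
Proof.
have h0 := @lorentz_ge0 R n.
by apply: mulr_ge0; [apply: mulr_ge0; exact: h0|exact: h0].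
Qed.

Lemma schur_kernel_le z : schur_kernel z <= (24 * n%:R) ^+ 3.
Proof.
have -> : (24 * n%:R) ^+ 3 = (24 * n%:R) * (24 * n%:R) * (24 * n%:R) :> R by ring.
have h0 := @lorentz_ge0 R n; have h := @lorentz_le R n.
by apply: ler_pM => //; [exact: mulr_ge0|exact: ler_pM].
Qed.

Lemma measurable_schur_kernel : measurable_fun [set: R6 R * R6 R] schur_kernel.
Proof.
by rewrite /schur_kernel /freq; apply: measurable_funM; [apply: measurable_funM|];
  apply: measurable_fun_lorentz; mfun6.
Qed.

Lemma schur_kernel_int1 x y x' :
  (\int[leb3]_y' (schur_kernel ((x, y), (x', y')))%:E <= ((24 * pi / kp) ^+ 3)%:E)%E.
Proof.
have e1 : (-1) ^+ 2 = 1 :> R by rewrite sqrrN expr1n.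
pose c := add3 (scale3 sg (sub3 x x')) y.
rewrite -(integral_lorentz3 c n0 kp0 e1) le_eqVlt; apply/orP; left; apply/eqP.
apply: eq_integral => y' _; rewrite /schur_kernel /freq /c /add3 /sub3 /scale3/=.
by congr ((lorentz n (_ * _) * lorentz n (_ * _) * lorentz n (_ * _))%:E); ring.
Qed.

Lemma schur_kernel_int2 x x' y' :
  (\int[leb3]_y (schur_kernel ((x, y), (x', y')))%:E <= ((24 * pi / kp) ^+ 3)%:E)%E.
Proof.
have e1 : 1 ^+ 2 = 1 :> R by rewrite expr1n.
pose c := sub3 (scale3 sg (sub3 x x')) y'.
rewrite -(integral_lorentz3 c n0 kp0 e1) le_eqVlt; apply/orP; left; apply/eqP.
apply: eq_integral => y _; rewrite /schur_kernel /freq /c /add3 /sub3 /scale3/=.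
by congr ((lorentz n (_ * _) * lorentz n (_ * _) * lorentz n (_ * _))%:E); ring.
Qed.

Definition window3 (v : R3 R) : R := window n v.1.1 * window n v.1.2 * window n v.2.

Let windowC := tensor3 (fun x : R1 R => (window n x)%:C) (fun x => (window n x)%:C) (fun x => (window n x)%:C).

Let n1 : 0 < n%:R :> R. Proof. by rewrite ltr0n. Qed.
Let nn : - n%:R <= n%:R :> R. Proof. by rewrite (@le_trans _ _ 0)// oppr_le0. Qed.

Let windowCE v : windowC v = (window3 v)%:C.
Proof. by rewrite /windowC /tensor3 /window3 !rmorphM. Qed.

Let windowC_int : cintegrable leb3 windowC.
Proof.
have h := cintegrable_trapezoid (- n%:R) n%:R n1.
exact: cintegrable_tensor3.
Qed.

Let gp (v : R3 R) (w : R6 R) : R[i] := gauss_phase t (rot sg (u, v)) w.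

Let normc_gp v w : normc (gp v w) = 1. Proof. exact: normc_expi. Qed.

Let measurable_rotu d (T : measurableType d) (h : T -> R3 R) : measurable_fun [set: T] h ->
  measurable_fun [set: T] (fun x => rot sg (u, h x)).
Proof.
move=> mh; apply: (measurableT_comp (measurable_rot sg)).
by mfun.
Qed.

Let cmeasurable_gp d (T : measurableType d) (h : T -> R3 R) (g : T -> R6 R) :
  measurable_fun [set: T] h -> measurable_fun [set: T] g ->
  cmeasurable (fun x => gp (h x) (g x)).
Proof.
by move=> mh mg; apply: cmeasurable_gauss_phase => //; exact: measurable_rotu.
Qed.

Lemma cintegral_window (w w' : R6 R) :
  normc (cintegral leb3 (fun v => gp v w * (gp v w')^*%C * windowC v)) <= schur_kernel (w, w').
Proof.
(* The phase difference at [v = 0]. It does not depend on [v], so it contributes only a constant of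
   modulus 1. *)
pose A := (dot6 (sub6 (rot sg (u, (0, 0, 0))) w) (sub6 (rot sg (u, (0, 0, 0))) w) -
  dot6 (sub6 (rot sg (u, (0, 0, 0))) w') (sub6 (rot sg (u, (0, 0, 0))) w')) / (4 * t).
pose q := freq w w'.
pose ch (xi : R) (x : R1 R) : R[i] := expi (- (xi * x)) * (window n x)%:C.
have E v : gp v w * (gp v w')^*%C * windowC v =
    expi A * tensor3 (ch q.1.1) (ch q.1.2) (ch q.2) v.
  rewrite /gp /gauss_phase conj_expi -expiD.
  have -> : dot6 (sub6 (rot sg (u, v)) w) (sub6 (rot sg (u, v)) w) / (4 * t) +
      - (dot6 (sub6 (rot sg (u, v)) w') (sub6 (rot sg (u, v)) w') / (4 * t)) =
    A + (- (q.1.1 * v.1.1) + - (q.1.2 * v.1.2) + - (q.2 * v.2)).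
    rewrite /A /q /freq /kp /dot6 /dot3 /sub6 /sub3 /rot /add3 /scale3/=.
    by field; rewrite !gt_eqF// sqrtr_gt0.
  rewrite !expiD /windowC /tensor3 /ch; ring.
under eq_cintegral do rewrite E.
have chi xi : cintegrable lebesgue_measure (ch xi).
  exact: cintegrable_character (cintegrable_trapezoid (- n%:R) n%:R n1).
rewrite cintegralZ; last exact: cintegrable_tensor3.
rewrite Normc.normcM normc_expi mul1r cintegral_tensor3// !Normc.normcM.
have h xi := normc_fourier1_window xi n0.
apply: ler_pM; [by rewrite mulr_ge0 ?normc_ge0|exact: normc_ge0| |exact: h].
by apply: ler_pM; [exact: normc_ge0|exact: normc_ge0|exact: h|exact: h].
Qed.


(** The propagator on the slice [u], without its constant. *)
Let field_integral (v : R3 R) : R[i] := cintegral leb6 (fun w => gp v w * f w).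

Let mf : cmeasurable f. Proof. exact: cintegrable_cmeasurable fi. Qed.

Let gpf_int v : cintegrable leb6 (fun w => gp v w * f w).
Proof.
apply: (@cintegrableM_bounded _ _ _ _ _ _ 1) => //.
- by apply: cmeasurable_gp; mfun.
- by move=> w; rewrite normc_gp.
Qed.

Let field_measurable : cmeasurable field_integral.
Proof.
apply: (cmeasurable_cintegral_param leb6 (f := fun z : R3 R * R6 R => gp z.1 z.2 * f z.2)).
apply: cmeasurableM; first by apply: cmeasurable_gp; mfun.
exact: (cmeasurable_comp measurable_snd mf).
Qed.

(** The L^1 norm on R^6 is used to justify the exchanges of integrals; it does not enter the final
    bound. *)
Let mass : R := fine (\int[leb6]_w (normc (f w))%:E).

Let massE : (\int[leb6]_w (normc (f w))%:E = mass%:E)%E.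
Proof.
rewrite fineK// ge0_fin_numE; first exact: cintegrable_lty.
by apply: integral_ge0 => w _; rewrite lee_fin normc_ge0.
Qed.

Let field_bounded v : normc (field_integral v) <= 2 * mass.
Proof.
rewrite -lee_fin (le_trans (normc_cintegral_le (gpf_int v)))// EFinM -massE.
rewrite lee_wpmul2l//; apply: ge0_le_integralT => w; first by rewrite lee_fin normc_ge0.
by rewrite lee_fin Normc.normcM normc_gp mul1r.
Qed.

Let inner (w : R6 R) : R[i] :=
  cintegral leb3 (fun v => gp v w * (field_integral v)^*%C * windowC v).

Let inner2 (w w' : R6 R) : R[i] :=
  cintegral leb3 (fun v => gp v w * (gp v w')^*%C * windowC v).

Let inner2_measurable : cmeasurable (fun z : R6 R * R6 R => inner2 z.1 z.2).
Proof.
apply: (cmeasurable_cintegral_param leb3 (f := fun z : (R6 R * R6 R) * R3 R =>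
  gp z.2 z.1.1 * (gp z.2 z.1.2)^*%C * windowC z.2)).
apply: cmeasurableM; last exact: (cmeasurable_comp measurable_snd (cintegrable_cmeasurable windowC_int)).
apply: cmeasurableM; first by apply: cmeasurable_gp; mfun.
by apply: cmeasurable_conj; apply: cmeasurable_gp; mfun.
Qed.

Let finner2_int w : cintegrable leb6 (fun w' => inner2 w w' * (f w')^*%C).
Proof.
apply: (@cintegrableM_bounded _ _ _ _ _ _ ((24 * n%:R) ^+ 3)).
- split.
  + exact: (measurable_fun_pair2 w inner2_measurable.1).
  + exact: (measurable_fun_pair2 w inner2_measurable.2).
- exact: cintegrable_conj.
- by move=> w'; rewrite (le_trans (cintegral_window w w'))// schur_kernel_le.
Qed.

(** The second of two exchanges: the conjugate field is expanded as an integral in [w'], which is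
    then moved outside the integral in [v]. *)
Let innerE w : inner w = cintegral leb6 (fun w' => inner2 w w' * (f w')^*%C).
Proof.
pose H (z : R3 R * R6 R) := gp z.1 w * (gp z.1 z.2)^*%C * (windowC z.1 * (f z.2)^*%C).
have iH : cintegrable (leb3 \x leb6)%E H.
  apply: (@cintegrableM_bounded _ _ _ _ _ _ 1).
  - apply: cmeasurableM; first by apply: cmeasurable_gp; mfun.
    by apply: cmeasurable_conj; apply: cmeasurable_gp; mfun.
  - exact: (cintegrable_tensor windowC_int (cintegrable_conj fi)).
  - by move=> z; rewrite (Normc.normcM (gp _ _)) normc_conj !normc_gp mulr1.
have A v : cintegral leb6 (fun w' => H (v, w')) = gp v w * (field_integral v)^*%C * windowC v.
  rewrite -cintegral_conj// mulrAC -cintegralZ; last exact: cintegrable_conj.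
  by apply: eq_cintegral => w'; rewrite /H [fst _]/= [snd _]/= conjCM; ring.
have B w' : cintegral leb3 (fun v => H (v, w')) = inner2 w w' * (f w')^*%C.
  rewrite [RHS]mulrC -cintegralZ.
    by apply: eq_cintegral => v; rewrite /H [fst _]/= [snd _]/=; ring.
  apply: (@cintegrableM_bounded _ _ _ _ _ _ 1).
  - apply: cmeasurableM; first by apply: cmeasurable_gp; mfun.
    by apply: cmeasurable_conj; apply: cmeasurable_gp; mfun.
  - exact: windowC_int.
  - by move=> v; rewrite (Normc.normcM (gp _ _)) normc_conj !normc_gp mulr1.
have := cfubini iH.
under eq_cintegral do rewrite A.
by under [in X in _ = X -> _]eq_cintegral do rewrite B.
Qed.

Let inner_le w : ((normc (inner w))%:E <=
  2%:E * \int[leb6]_w' (normc (f w') * schur_kernel (w, w'))%:E)%E.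
Proof.
rewrite innerE (le_trans (normc_cintegral_le (finner2_int w)))// lee_wpmul2l//.
apply: ge0_le_integralT => w'; first by rewrite lee_fin normc_ge0.
rewrite lee_fin Normc.normcM normc_conj mulrC ler_wpM2l ?normc_ge0//.
exact: cintegral_window.
Qed.

Let inner_measurable : cmeasurable inner.
Proof.
apply: (cmeasurable_cintegral_param leb3 (f := fun z : R6 R * R3 R =>
  gp z.2 z.1 * (field_integral z.2)^*%C * windowC z.2)).
apply: cmeasurableM; last exact: (cmeasurable_comp measurable_snd (cintegrable_cmeasurable windowC_int)).
apply: cmeasurableM; first by apply: cmeasurable_gp; mfun.
by apply: cmeasurable_conj; exact: (cmeasurable_comp measurable_snd field_measurable).
Qed.

Let finner_int : cintegrable leb6 (fun w => inner w * f w).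
Proof.
apply: (@cintegrableM_bounded _ _ _ _ _ _ (2 * (mass * (24 * n%:R) ^+ 3))) => //.
move=> w; rewrite -lee_fin (le_trans (inner_le w))// EFinM lee_wpmul2l// EFinM -massE.
rewrite -ge0_integralZr//.
- apply: ge0_le_integralT => w'.
    by rewrite lee_fin mulr_ge0 ?normc_ge0 ?schur_kernel_ge0.
  by rewrite -EFinM lee_fin ler_wpM2l ?normc_ge0 ?schur_kernel_le.
- exact: cmeasurable_normE.
- by move=> w' _; rewrite lee_fin normc_ge0.
Qed.

(** The squared modulus is the field times its conjugate. Only the first factor is expanded here,
    the second one in [innerE], so that each exchange is Fubini for two variables. Each passage to
    the modulus costs a factor 2, hence the 4. *)
Lemma windowed_estimate :
  (\int[leb3]_v (window3 v * normc (cintegral leb6 (fun w => gauss_phase t (rot sg (u, v)) w * f w)) ^+ 2)%:E <=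
   4%:E * \int[leb6]_w \int[leb6]_w' (normc (f w) * normc (f w') * schur_kernel (w, w'))%:E)%E.
Proof.
pose H (z : R3 R * R6 R) := gp z.1 z.2 * (field_integral z.1)^*%C * (windowC z.1 * f z.2).
have mass2 : 0 <= 2 * mass by apply: le_trans (normc_ge0 _) (field_bounded u).
have iH : cintegrable (leb3 \x leb6)%E H.
  apply: (@cintegrableM_bounded _ _ _ _ _ _ (2 * mass)).
  - apply: cmeasurableM; first by apply: cmeasurable_gp; mfun.
    by apply: cmeasurable_conj; exact: (cmeasurable_comp measurable_fst field_measurable).
  - exact: (cintegrable_tensor windowC_int fi).
  - by move=> z; rewrite (Normc.normcM (gp _ _)) normc_conj normc_gp mul1r field_bounded.
have A v : cintegral leb6 (fun w => H (v, w)) = (window3 v * normc (field_integral v) ^+ 2)%:C.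
  transitivity (windowC v * (field_integral v)^*%C * field_integral v).
    by rewrite -cintegralZ//; apply: eq_cintegral => w; rewrite /H [fst _]/= [snd _]/=; ring.
  by rewrite windowCE -mulrA conjC_mul realCM.
have B w : cintegral leb3 (fun v => H (v, w)) = inner w * f w.
  rewrite [RHS]mulrC -cintegralZ.
    by apply: eq_cintegral => v; rewrite /H [fst _]/= [snd _]/=; ring.
  apply: (@cintegrableM_bounded _ _ _ _ _ _ (2 * mass)).
  - apply: cmeasurableM; first by apply: cmeasurable_gp; mfun.
    exact: cmeasurable_conj.
  - exact: windowC_int.
  - by move=> v; rewrite (Normc.normcM (gp _ _)) normc_conj normc_gp mul1r field_bounded.
have := cfubini iH.
under eq_cintegral do rewrite A.
under [in X in _ = X -> _]eq_cintegral do rewrite B.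
move=> fub.
pose p (v : R3 R) : R := window3 v * normc (field_integral v) ^+ 2.
have ip : leb3.-integrable [set: R3 R] (fun v => (p v)%:E).
  suff: cintegrable leb3 (fun v => (p v)%:C) by case.
  have -> : (fun v => (p v)%:C) = fun v => ((field_integral v)^*%C * field_integral v) * windowC v.
    by apply/funext => v; rewrite windowCE /p conjC_mul realCM mulrC.
  apply: (@cintegrableM_bounded _ _ _ _ _ _ ((2 * mass) * (2 * mass))).
  - by apply: cmeasurableM => //; exact: cmeasurable_conj.
  - exact: windowC_int.
  - by move=> v; rewrite Normc.normcM normc_conj ler_pM ?normc_ge0// field_bounded.
rewrite -[leLHS]fineK; last exact: integrable_fin_num.
(* The windowed integral is the real part of this complex integral, hence at most its modulus. *)
apply: (@le_trans _ _ (normc (cintegral leb6 (fun w => inner w * f w)))%:E).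
  rewrite lee_fin -fub (le_trans _ (normc_Re _))//=.
  exact: ler_norm.
apply: le_trans (normc_cintegral_le finner_int) _.
have -> : (4%:E = 2%:E * 2%:E :> \bar R)%E by rewrite -EFinM; congr (_%:E); ring.
rewrite -muleA lee_wpmul2l//.
have mk2 : measurable_fun [set: R6 R * R6 R] (fun z : R6 R * R6 R => normc (f z.1) * normc (f z.2) * schur_kernel z).
  have mnf := cmeasurable_normc mf.
  have m1' : measurable_fun [set: R6 R * R6 R] (fun z : R6 R * R6 R => normc (f z.1)) by exact: (measurableT_comp mnf).
  have m2' : measurable_fun [set: R6 R * R6 R] (fun z : R6 R * R6 R => normc (f z.2)) by exact: (measurableT_comp mnf).
  have m3' := measurable_schur_kernel.
  by apply: measurable_funM => //; exact: measurable_funM.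
have k0 z : 0 <= normc (f z.1) * normc (f z.2) * schur_kernel z.
  by apply: mulr_ge0; [apply: mulr_ge0; exact: normc_ge0|exact: schur_kernel_ge0].
rewrite -ge0_integralZl//; last 2 first.
- apply: (measurable_fun_fubini_tonelli_F (m2 := leb6) (fun z : R6 R * R6 R => (normc (f z.1) * normc (f z.2) * schur_kernel z)%:E)).
    exact/measurable_EFinP.
  by move=> z; rewrite lee_fin.
- by move=> w _; apply: integral_ge0 => w' _; rewrite lee_fin (k0 (w, w')).
apply: ge0_le_integralT => w; first by rewrite lee_fin normc_ge0.
rewrite Normc.normcM mulrC EFinM.
have -> : (\int[leb6]_w' (normc (f w) * normc (f w') * schur_kernel (w, w'))%:E =
    (normc (f w))%:E * \int[leb6]_w' (normc (f w') * schur_kernel (w, w'))%:E)%E.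
  rewrite -ge0_integralZl//; last 3 first.
  - apply/measurable_EFinP; apply: measurable_funM; first exact: cmeasurable_normc.
    exact: (measurable_fun_pair2 w measurable_schur_kernel).
  - by move=> w' _; rewrite lee_fin mulr_ge0 ?normc_ge0 ?schur_kernel_ge0.
  - by rewrite lee_fin normc_ge0.
  by apply: eq_integral => w' _; rewrite -[RHS]EFinM; congr EFin; rewrite -[LHS]mulrA.
by rewrite muleCA lee_wpmul2l ?lee_fin ?normc_ge0.
Qed.

End quadratic_estimate.

(** * L^2 norms of complex-valued functions *)

Section slice_norm.
Context d (T : measurableType d) (R : realType).
Variable m : {measure set T -> \bar R}.
Local Open Scope ereal_scope.

Definition l2norm (h : T -> R[i]) : \bar R := Lnorm m 2%:E (fun y => (normc (h y))%:E).

Lemma l2normE h : l2norm h = sqrte (\int[m]_x (normc (h x) ^+ 2)%:E).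
Proof. exact: (@Lnorm2E _ _ _ m (fun y => normc (h y))). Qed.

Lemma l2norm_ge0 h : 0 <= l2norm h. Proof. exact: Lnorm_ge0. Qed.

Lemma l2norm_sqr h : l2norm h ^+ 2 = \int[m]_x (normc (h x) ^+ 2)%:E.
Proof. exact: (@Lnorm2_sqr _ _ _ m (fun y => normc (h y))). Qed.

Lemma le_l2norm g h : (forall x, normc (g x) <= normc (h x))%R -> l2norm g <= l2norm h.
Proof.
move=> gh; rewrite !l2normE lee_sqrt; last by apply: integral_ge0 => x _; rewrite lee_fin sqr_ge0.
apply: ge0_le_integralT => x; first by rewrite lee_fin sqr_ge0.
by rewrite lee_fin lerXn2r ?nnegrE ?normc_ge0.
Qed.

Lemma l2norm_triangle f g h : cmeasurable g -> cmeasurable h ->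
  (forall x, normc (f x) <= normc (g x) + normc (h x))%R ->
  l2norm f <= l2norm g + l2norm h.
Proof.
move=> mg mh fgh.
have h12 : (1 <= 2 :> R)%R by rewrite ler1n.
have := @minkowski_EFin _ _ _ m (fun x => normc (g x)) (fun x => normc (h x)) 2%R
  (cmeasurable_normc mg) (cmeasurable_normc mh) h12.
apply: le_trans; rewrite l2normE.
rewrite (@Lnorm2E _ _ _ m ((fun x => normc (g x)) \+ (fun x => normc (h x)))%R).
rewrite lee_sqrt; last by apply: integral_ge0 => x _; rewrite lee_fin sqr_ge0.
apply: ge0_le_integralT => x; first by rewrite lee_fin sqr_ge0.
by rewrite lee_fin lerXn2r ?nnegrE ?normc_ge0// addr_ge0 ?normc_ge0.
Qed.

End slice_norm.

(** * Measurability of the propagator and of the window *)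

Section propagator_measurability.
Context {R : realType}.

Lemma cmeasurable_gauss_integral (t : R) (f : R6 R -> R[i]) : cmeasurable f ->
  cmeasurable (fun z => cintegral leb6 (fun w => gauss_phase t z w * f w)).
Proof.
move=> mf; apply: (cmeasurable_cintegral_param leb6 (f := fun z : R6 R * R6 R => gauss_phase t z.1 z.2 * f z.2)).
apply: cmeasurableM; first by apply: cmeasurable_gauss_phase; mfun.
exact: (cmeasurable_comp measurable_snd mf).
Qed.

Lemma cmeasurable_propagator (t : R) (f : R6 R -> R[i]) : cmeasurable f ->
  cmeasurable (propagator t f).
Proof.
by move=> mf; apply: cmeasurableM; [exact: cmeasurable_cst|exact: cmeasurable_gauss_integral].
Qed.

Lemma measurable_rot_slice (sg : R) (u : R3 R) :
  measurable_fun [set: R3 R] (fun v => rot sg (u, v)).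
Proof.
have h : measurable_fun [set: R3 R] (fun v => (u, v) : R6 R) by mfun.
exact: (measurableT_comp (measurable_rot sg) h).
Qed.

Lemma measurable_window3 n : measurable_fun [set: R3 R] (@window3 R n).
Proof.
have mw : measurable_fun [set: R1 R] (@window R n) by exact: measurable_trapezoid.
rewrite /window3; apply: measurable_funM; first apply: measurable_funM.
- have h : measurable_fun [set: R3 R] (fun v => v.1.1) by mfun.
  exact: (measurableT_comp mw h).
- have h : measurable_fun [set: R3 R] (fun v => v.1.2) by mfun.
  exact: (measurableT_comp mw h).
- have h : measurable_fun [set: R3 R] (fun v => v.2) by mfun.
  exact: (measurableT_comp mw h).
Qed.

Lemma window3_ge0 n v : 0 <= @window3 R n v.
Proof.
have [->|n0] := posnP n.
  (* The degenerate window vanishes, because the inverse of 0 is 0. *)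
  by rewrite /window3 /window /trapezoid mulr0 invr0 !mul0r.
have n1 : 0 < n%:R :> R by rewrite ltr0n.
have h (x : R1 R) : 0 <= window n x by exact: (trapezoid_ge0 _ _ n1).
by rewrite /window3; apply: mulr_ge0; [exact: mulr_ge0|exact: h].
Qed.

End propagator_measurability.

(** * The dispersive bound for integrable data *)

Section apriori.
Context {R : realType}.
Local Open Scope ereal_scope.

(** Every point eventually lies in the plateau. The index is shifted because a trapezoid needs
    slopes of positive width. *)
Lemma window3_cvg (v : R3 R) : (window3 n.+1 v)%:E @[n --> \oo] --> (1%R : R)%:E.
Proof.
apply: cvg_near_cst; near=> n; congr EFin.
have h (x : R1 R) : (`|x| <= n%:R)%R -> window n.+1 x = 1%R.
  move=> xn; apply: trapezoid1; first by rewrite ltr0n.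
  by rewrite -ler_norml (le_trans xn)// ler_nat.
rewrite /window3 !h ?mulr1//; near: n; exact: nbhs_infty_ger.
Unshelve. all: by end_near. Qed.

(** The first factors are the modulus of [propagator_const] without its [t^-3]; the 2 is the square
    root of the 4 in [windowed_estimate]; [(48 sqrt 2 pi)^3] is the Schur constant [(24 pi / kp)^3]
    without its [t^3]. Adding 1 makes the constant positive without knowing that [fresnel_const] is
    nonzero. *)
Definition dispersion_const : R :=
  (((2 * pi) ^+ 6)^-1 * normc (fresnel_const : R[i]) ^+ 6 * 2 *
   Num.sqrt ((48 * Num.sqrt 2 * pi) ^+ 3) + 1)%R.

Lemma dispersion_const_gt0 : (0 < dispersion_const)%R.
Proof.
rewrite /dispersion_const ltr_wpDl// !mulr_ge0 ?sqrtr_ge0 ?exprn_ge0 ?normc_ge0//.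
by rewrite invr_ge0 exprn_ge0// mulr_ge0// pi_ge0.
Qed.

Lemma powR32 (t : R) : (0 < t)%R -> (t `^ (3 / 2) = Num.sqrt t ^+ 3)%R.
Proof.
move=> t0; rewrite -powR12_sqrt ?ltW// -powR_mulrn ?powR_ge0// -powRrM.
by rewrite mulrC.
Qed.

(** The bound is pointwise in [u]: on integrable data the propagator is an honest integral at every
    point, so each slice can be treated alone. *)
Lemma propagator_apriori (t sg : R) (f : R6 R -> R[i]) (u : R3 R) : (0 < t)%R ->
  cintegrable leb6 f ->
  l2norm leb3 (fun v => propagator t f (rot sg (u, v))) <=
  (dispersion_const / t `^ (3 / 2))%:E * mixed_norm 1 f.
Proof.
move=> t0 fi.
have tau0 : (0 < Num.sqrt t)%R by rewrite sqrtr_gt0.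
have tau2 : (Num.sqrt t ^+ 2 = t)%R by rewrite sqr_sqrtr// ltW.
have K0 : (0 < dispersion_const / t `^ (3 / 2))%R by rewrite divr_gt0 ?dispersion_const_gt0 ?powR_gt0.
have N0 : 0 <= mixed_norm 1 f by exact: Lnorm_ge0.
have [Noo|] := eqVneq (mixed_norm 1 f) +oo; first by rewrite Noo gt0_muley ?lte_fin// leey.
rewrite -ltey -ge0_fin_numE// => /fineK; set r := fine _ => rE.
have r0 : (0 <= r)%R by rewrite -lee_fin rE.
pose I (v : R3 R) : R[i] := cintegral leb6 (fun w => gauss_phase t (rot sg (u, v)) w * f w)%R.
pose kp : R := ((Num.sqrt 2)^-1 / (2 * t))%R.
pose L : R := ((24 * pi / kp) ^+ 3)%R.
have kp0 : (0 < kp)%R by rewrite divr_gt0 ?invr_gt0 ?sqrtr_gt0 ?mulr_gt0.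
have L0 : (0 <= L)%R by rewrite exprn_ge0// divr_ge0 ?(ltW kp0)// mulr_ge0// pi_ge0.
have mf := cintegrable_cmeasurable fi.
have est n : (0 < n)%N -> \int[leb3]_v (window3 n v * normc (I v) ^+ 2)%:E <= (4 * (L * r ^+ 2))%:E.
  move=> n0; have W := windowed_estimate sg u t0 fi n0; apply: (le_trans W).
  rewrite EFinM lee_wpmul2l//.
  have := @mixed_schur R (fun z => normc (f z)) (@schur_kernel R t sg n) L (cmeasurable_normc mf)
    (@measurable_schur_kernel R t sg n).
  move=> H; apply: le_trans (H _ _ L0 _ _) _.
  - by move=> z; exact: normc_ge0.
  - by move=> z; exact: schur_kernel_ge0.
  - by move=> x y x'; exact: schur_kernel_int1.
  - by move=> x x' y'; exact: schur_kernel_int2.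
  - by rewrite -mixed_norm1E -rE EFinM -EFin_expe.
have mI : measurable_fun [set: R3 R] (fun v => normc (I v)).
  apply: cmeasurable_normc.
  exact: (cmeasurable_comp (measurable_rot_slice sg u) (cmeasurable_gauss_integral t mf)).
(* Fatou removes the window; no monotonicity in [n] is involved. *)
have est2 : \int[leb3]_v (normc (I v) ^+ 2)%:E <= (4 * (L * r ^+ 2))%:E.
  pose w n (v : R3 R) := (window3 n.+1 v * normc (I v) ^+ 2)%:E.
  have mw n : measurable_fun [set: R3 R] (w n).
    apply/measurable_EFinP; apply: measurable_funM; first exact: measurable_window3.
    exact: measurable_funX.
  have w0 n v : 0 <= w n v by rewrite lee_fin mulr_ge0 ?window3_ge0 ?sqr_ge0.
  have wl v : limn_einf (w ^~ v) = (normc (I v) ^+ 2)%:E.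
    have cv : w n v @[n --> \oo] --> (normc (I v) ^+ 2)%:E.
      have -> : (normc (I v) ^+ 2)%:E = (1%R : R)%:E * (normc (I v) ^+ 2)%:E by rewrite mul1e.
      rewrite /w; under eq_fun do rewrite EFinM.
      by apply: cvgeZr => //; exact: window3_cvg.
    rewrite is_cvg_limn_einfE; last by apply/cvg_ex; exists (normc (I v) ^+ 2)%:E.
    exact: cvg_lim.
  have := fatou leb3 measurableT mw (fun n v _ => w0 n v).
  under eq_integral do rewrite wl.
  move/le_trans; apply; rewrite limn_einf_lim.
  apply: lime_le; first exact: is_cvg_einfs.
  apply: nearW => n; apply: (@le_trans _ _ (\int[leb3]_v w n v)); last exact: est.
  by apply: ereal_inf_lbound; exists n => /=.
have A0 : (0 <= 48 * Num.sqrt 2 * pi :> R)%R by rewrite !mulr_ge0 ?sqrtr_ge0 ?pi_ge0.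
rewrite -rE -EFinM; apply: (@Lnorm2_le _ _ _ leb3 (fun v => normc (propagator t f (rot sg (u, v))))).
  exact: mulr_ge0 (ltW K0) r0.
have -> : \int[leb3]_v (normc (propagator t f (rot sg (u, v))) ^+ 2)%:E =
    (normc (propagator_const t) ^+ 2)%:E * \int[leb3]_v (normc (I v) ^+ 2)%:E.
  rewrite -ge0_integralZl//; last 3 first.
  - by apply/measurable_EFinP; exact: measurable_funX.
  - by move=> v _; rewrite lee_fin sqr_ge0.
  - by rewrite lee_fin sqr_ge0.
  by apply: eq_integral => v _; rewrite -EFinM /propagator Normc.normcM exprMn.
apply: (@le_trans _ _ ((normc (propagator_const t) ^+ 2)%:E * (4 * (L * r ^+ 2))%:E)).
  by rewrite lee_wpmul2l// lee_fin sqr_ge0.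
rewrite -EFinM lee_fin powR32//.
set tau := Num.sqrt t in tau0 tau2 *.
pose a : R := (((2 * pi) ^+ 6)^-1 * normc (fresnel_const : R[i]) ^+ 6 * 2 *
   Num.sqrt ((48 * Num.sqrt 2 * pi) ^+ 3))%R.
have a0 : (0 <= a)%R.
  rewrite /a !mulr_ge0 ?sqrtr_ge0 ?exprn_ge0 ?normc_ge0//.
  by rewrite invr_ge0 exprn_ge0// mulr_ge0// pi_ge0.
(* With [tau = sqrt t], the squared constant contributes [tau^-12] and [L] contributes [tau^6],
   which leaves the square of [tau^-3]. *)
have -> : (normc (propagator_const t) ^+ 2 * (4 * (L * r ^+ 2)) = (a / tau ^+ 3 * r) ^+ 2)%R.
  have nX (z : R[i]) k : (normc (z ^+ k) = normc z ^+ k)%R.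
    by elim: k => [|k IH]; rewrite ?expr0 ?Normc.normc1// !exprS Normc.normcM IH.
  rewrite /propagator_const /fresnel_factor Normc.normcM nX Normc.normcM !normc_realC -/tau.
  rewrite (@ger0_norm _ tau^-1%R) ?invr_ge0 ?ltW//.
  rewrite (@ger0_norm _ ((2 * pi) ^+ 6)^-1%R); last by rewrite invr_ge0 exprn_ge0// mulr_ge0// pi_ge0.
  have LE : (L = (48 * Num.sqrt 2 * pi) ^+ 3 * tau ^+ 6)%R.
    rewrite /L /kp -tau2; field.
    by rewrite !gt_eqF// sqrtr_gt0.
  have key (p F A : R) : (0 <= A -> (p * (tau^-1 * F) ^+ 6) ^+ 2 * (4 * (A ^+ 3 * tau ^+ 6 * r ^+ 2)) =
      (p * F ^+ 6 * 2 * Num.sqrt (A ^+ 3) / tau ^+ 3 * r) ^+ 2)%R.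
    move=> hA; set q := Num.sqrt _.
    have q2 : (q ^+ 2 = A ^+ 3)%R by rewrite sqr_sqrtr// exprn_ge0.
    by rewrite -q2; field; rewrite gt_eqF.
  by rewrite LE; exact: key.
have i0 : (0 <= (tau ^+ 3)^-1)%R by rewrite invr_ge0 exprn_ge0// ltW.
have la : (a <= dispersion_const)%R by rewrite /dispersion_const -/a lerDl.
apply: lerXn2r; rewrite ?nnegrE.
- exact: mulr_ge0 (mulr_ge0 a0 i0) r0.
- exact: mulr_ge0 (mulr_ge0 (ltW dispersion_const_gt0) i0) r0.
- by apply: ler_wpM2r => //; exact: ler_wpM2r.
Qed.

End apriori.

(** * Convergence to zero in the extended reals *)

Section ereal_cvg0.
Context {R : realType}.
Local Open Scope ereal_scope.
Implicit Types u : nat -> \bar R.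

Lemma cvge0_near u (e : R) : u k @[k --> \oo] --> 0 -> (0 < e)%R ->
  \forall k \near \oo, u k <= e%:E.
Proof.
move=> /fine_cvgP[uf u0] e0.
have /cvgrPdist_le /(_ e e0) := u0.
apply: filterS2 uf => k uk; rewrite sub0r normrN => ue.
by rewrite -(fineK uk) lee_fin (le_trans (ler_norm _)).
Qed.

Lemma cvge0I u : (forall k, 0 <= u k) ->
  (forall e : R, (0 < e)%R -> \forall k \near \oo, u k <= e%:E) ->
  u k @[k --> \oo] --> 0.
Proof.
move=> u0 ue; apply/fine_cvgP; split.
  have := ue 1%R ltr01; apply: filterS => k uk.
  by rewrite ge0_fin_numE// (le_lt_trans uk)// ltry.
apply/cvgrPdist_le => e e0; have := ue e e0; apply: filterS => k uk.
rewrite sub0r normrN /= ger0_norm ?fine_ge0// -lee_fin fineK//.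
by rewrite ge0_fin_numE// (le_lt_trans uk)// ltry.
Qed.

End ereal_cvg0.

(** * Density of nice functions *)

Section mixed_norm_theory.
Context {R : realType}.
Local Open Scope ereal_scope.
Implicit Types f g h : R6 R -> R[i].

Definition slice f (x : R3 R) : R3 R -> R[i] := fun y => f (x, y).

Lemma mixed_norm1_l2 f : mixed_norm 1 f = \int[leb3]_x l2norm leb3 (slice f x).
Proof. exact: mixed_norm1E. Qed.

Lemma mixed_norm_ge0 q f : 0 <= mixed_norm q f.
Proof. exact: Lnorm_ge0. Qed.

Lemma cmeasurable_slice f x : cmeasurable f -> cmeasurable (slice f x).
Proof.
by move=> [mR mI]; split; [exact: (measurable_fun_pair2 x mR)|exact: (measurable_fun_pair2 x mI)].
Qed.

Lemma measurable_l2norm_slice f : cmeasurable f ->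
  measurable_fun [set: R3 R] (fun x => l2norm leb3 (slice f x)).
Proof.
by move=> mf; exact: (measurable_Lnorm2_section (cmeasurable_normc mf)).
Qed.

Lemma mixed_norm1_le f g : (forall z, normc (f z) <= normc (g z))%R ->
  mixed_norm 1 f <= mixed_norm 1 g.
Proof.
move=> fg; rewrite !mixed_norm1_l2; apply: ge0_le_integralT => x.
  exact: l2norm_ge0.
by apply: le_l2norm => y; exact: fg.
Qed.

Lemma mixed_norm1_triangle f g h : cmeasurable g -> cmeasurable h ->
  (forall z, normc (f z) <= normc (g z) + normc (h z))%R ->
  mixed_norm 1 f <= mixed_norm 1 g + mixed_norm 1 h.
Proof.
move=> mg mh fgh; rewrite !mixed_norm1_l2 -ge0_integralD//; last 4 first.
- by move=> x _; exact: l2norm_ge0.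
- exact: measurable_l2norm_slice.
- by move=> x _; exact: l2norm_ge0.
- exact: measurable_l2norm_slice.
apply: ge0_le_integralT => x; first exact: l2norm_ge0.
by apply: l2norm_triangle; [exact: cmeasurable_slice|exact: cmeasurable_slice|move=> y; exact: fgh].
Qed.

Lemma l2normZ d (T : measurableType d) (m : {measure set T -> \bar R}) (c : R[i]) (h : T -> R[i]) :
  cmeasurable h -> l2norm m (fun x => c * h x)%R = (normc c)%:E * l2norm m h.
Proof.
move=> mh; rewrite !l2normE.
have -> : (normc c)%:E = sqrte ((normc c) ^+ 2)%:E by rewrite /= sqrtr_sqr ger0_norm ?normc_ge0.
rewrite -sqrteM ?lee_fin ?sqr_ge0//; congr sqrte.
rewrite -ge0_integralZl//; last 3 first.
- by apply/measurable_EFinP; apply: measurable_funX; exact: cmeasurable_normc.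
- by move=> x _; rewrite lee_fin sqr_ge0.
- by rewrite lee_fin sqr_ge0.
by apply: eq_integral => x _; rewrite Normc.normcM exprMn EFinM.
Qed.

Lemma mixed_norm1Z (c : R[i]) f : cmeasurable f ->
  mixed_norm 1 (fun z => c * f z)%R = (normc c)%:E * mixed_norm 1 f.
Proof.
move=> mf; rewrite !mixed_norm1_l2 -ge0_integralZl//; last 3 first.
- exact: measurable_l2norm_slice.
- by move=> x _; exact: l2norm_ge0.
- by rewrite lee_fin normc_ge0.
by apply: eq_integral => x _; rewrite /slice l2normZ//; exact: cmeasurable_slice.
Qed.

Lemma mixed_norm1_tensor (F G : R3 R -> R[i]) : cmeasurable F -> cmeasurable G ->
  mixed_norm 1 (tensor6 F G) = \int[leb3]_x (normc (F x))%:E * l2norm leb3 G.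
Proof.
move=> mF mG; rewrite mixed_norm1_l2 -ge0_integralZr//; last 3 first.
- exact: cmeasurable_normE.
- by move=> x _; rewrite lee_fin normc_ge0.
- exact: l2norm_ge0.
by apply: eq_integral => x _; rewrite /slice /tensor6/= l2normZ.
Qed.

(** Dominated convergence twice: in [y] on almost every slice, namely where the slice of [r] has
    finite L^2 norm, and then in [x], with these norms as the dominating function. *)
Lemma mixed_norm1_dominated (h_ : nat -> R6 R -> R[i]) (r : R6 R -> R[i]) :
  (forall k, cmeasurable (h_ k)) -> cmeasurable r -> mixed_norm 1 r < +oo ->
  (forall z, normc (h_ k z) @[k --> \oo] --> (0%R : R)) ->
  (forall k z, normc (h_ k z) <= normc (r z))%R ->
  mixed_norm 1 (h_ k) @[k --> \oo] --> 0.
Proof.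
move=> mh mr roo h0 hr.
have ir : leb3.-integrable [set: R3 R] (fun x => l2norm leb3 (slice r x)).
  apply/integrableP; split; first exact: measurable_l2norm_slice.
  by under eq_integral do rewrite gee0_abs ?l2norm_ge0//; rewrite -mixed_norm1_l2.
have mS k := measurable_l2norm_slice (mh k).
have cS : \forall x \ae leb3, [set: R3 R] x ->
    l2norm leb3 (slice (h_ k) x) @[k --> \oo] --> (cst 0 x : \bar R).
  have := integrable_ae measurableT ir; apply: filterS => x /(_ I) rx _.
  have rx2 : \int[leb3]_y (normc (slice r x y) ^+ 2)%:E < +oo.
    by rewrite -l2norm_sqr expe2 lte_mul_pinfty ?l2norm_ge0// ltey_eq rx.
  have ms k := cmeasurable_normc (cmeasurable_slice x (mh k)).
  have D : \int[leb3]_y (normc (slice (h_ k) x y) ^+ 2)%:E @[k --> \oo] -->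
      \int[leb3]_y (cst 0 y : \bar R).
    apply: (@dominated_cvg _ _ _ leb3 _ measurableT _ _ (fun y => (normc (slice r x y) ^+ 2)%:E)).
    - by move=> k; apply/measurable_EFinP; exact: measurable_funX.
    - move=> y _; have -> : (cst 0 y : \bar R) = (0%R : R)%:E by [].
      have c2 : (normc (slice (h_ k) x y) ^+ 2)%R @[k --> \oo] --> (0 : R)%R.
        have -> : (0 : R)%R = (0 * 0)%R by rewrite mulr0.
        by under eq_fun do rewrite expr2; apply: cvgM; exact: h0.
      by apply: cvg_EFin; [exact: nearW|exact: c2].
    - by [].
    - apply/integrableP; split.
        by apply/measurable_EFinP; apply: measurable_funX; exact: cmeasurable_normc (cmeasurable_slice x mr).
      by under eq_integral do rewrite gee0_abs ?lee_fin ?sqr_ge0//.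
    - move=> k y _; rewrite gee0_abs ?lee_fin ?sqr_ge0//.
      by rewrite lerXn2r ?nnegrE ?normc_ge0// hr.
  rewrite integral0 in D; apply: cvge0I => [k|e e0]; first exact: l2norm_ge0.
  have := cvge0_near D (exprn_gt0 2 e0); apply: filterS => k hk.
  exact: (@Lnorm2_le _ _ _ leb3 (fun y => normc (slice (h_ k) x y)) e (ltW e0)).
under eq_fun do rewrite mixed_norm1_l2.
have dom : \forall x \ae leb3, forall k, [set: R3 R] x ->
    `|l2norm leb3 (slice (h_ k) x)| <= l2norm leb3 (slice r x).
  apply: aeW => x k _; rewrite gee0_abs ?l2norm_ge0//.
  by apply: le_l2norm => y; exact: hr.
have [_ _] := dominated_convergence measurableT mS (measurable_cst _) cS ir dom.
by rewrite integral0.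
Qed.

End mixed_norm_theory.

(** * Nice functions: sums, multiples and tensor products *)

Section nice_functions.
Context {R : realType}.
Local Notation mu := (@lebesgue_measure R).
Implicit Types f g h : R6 R -> R[i].

Lemma cintegrable_character6 f (p : R6 R) : cintegrable leb6 f ->
  cintegrable leb6 (fun z => expi (- dot6 p z) * f z).
Proof.
move=> fi; apply: (@cintegrableM_bounded _ _ _ _ _ _ 1) => //.
- by apply: cmeasurable_expi; mfun6.
- by move=> z; rewrite normc_expi.
Qed.

Lemma fourierD f g p : cintegrable leb6 f -> cintegrable leb6 g ->
  fourier (fun z => f z + g z) p = fourier f p + fourier g p.
Proof.
move=> fi gi; rewrite /fourier -cintegralD; try exact: cintegrable_character6.
by apply: eq_cintegral => z; rewrite mulrDr.
Qed.

Lemma fourierZ f c p : cintegrable leb6 f ->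
  fourier (fun z => c * f z) p = c * fourier f p.
Proof.
move=> fi; rewrite /fourier -cintegralZ; last exact: cintegrable_character6.
by apply: eq_cintegral => z; rewrite mulrCA.
Qed.

Lemma niceD f g : nice f -> nice g -> nice (fun z => f z + g z).
Proof.
move=> [fi Ffi] [gi Fgi]; split; first exact: cintegrableD.
rewrite (_ : fourier _ = fun p => fourier f p + fourier g p).
  exact: cintegrableD.
by apply/funext => p; exact: fourierD.
Qed.

Lemma niceZ f c : nice f -> nice (fun z => c * f z).
Proof.
move=> [fi Ffi]; split; first exact: cintegrableZ.
rewrite (_ : fourier _ = fun p => c * fourier f p).
  exact: cintegrableZ.
by apply/funext => p; exact: fourierZ.
Qed.

Definition nice1 (a : R1 R -> R[i]) : Prop :=
  cintegrable mu a /\ cintegrable mu (fourier1 a).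

Lemma nice_tensor (a b c a' b' c' : R1 R -> R[i]) : nice1 a -> nice1 b -> nice1 c ->
  nice1 a' -> nice1 b' -> nice1 c' -> nice (tensor6 (tensor3 a b c) (tensor3 a' b' c')).
Proof.
move=> [ai Fa] [bi Fb] [ci Fc] [ai' Fa'] [bi' Fb'] [ci' Fc']; split.
  by apply: cintegrable_tensor6; exact: cintegrable_tensor3.
have -> : fourier (tensor6 (tensor3 a b c) (tensor3 a' b' c')) =
    tensor6 (tensor3 (fourier1 a) (fourier1 b) (fourier1 c))
            (tensor3 (fourier1 a') (fourier1 b') (fourier1 c')).
  apply/funext => p.
  pose e (k : R1 R -> R[i]) (xi : R) (x : R1 R) : R[i] := expi (- (xi * x)) * k x.
  have ei k xi : cintegrable mu k -> cintegrable mu (e k xi) by exact: cintegrable_character.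
  transitivity (cintegral leb6 (tensor6 (tensor3 (e a p.1.1.1) (e b p.1.1.2) (e c p.1.2))
      (tensor3 (e a' p.2.1.1) (e b' p.2.1.2) (e c' p.2.2)))).
    apply: eq_cintegral => z; rewrite /tensor6 /tensor3 /e.
    have -> : - dot6 p z = (- (p.1.1.1 * z.1.1.1) + - (p.1.1.2 * z.1.1.2) + - (p.1.2 * z.1.2)) +
        (- (p.2.1.1 * z.2.1.1) + - (p.2.1.2 * z.2.1.2) + - (p.2.2 * z.2.2)).
      by rewrite /dot6 /dot3; ring.
    by rewrite !expiD; ring.
  rewrite cintegral_tensor6; [|by apply: cintegrable_tensor3; exact: ei..].
  by rewrite !cintegral_tensor3//; exact: ei.
by apply: cintegrable_tensor6; exact: cintegrable_tensor3.
Qed.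

(** The weight is written [1 * x] to match [fourier1_trapezoid] at scale [c = 1]. *)
Lemma cintegrable_lorentzian (f : R1 R -> R[i]) (K : R) : cmeasurable f ->
  (forall x, normc (f x) * (1 + (1 * x) ^+ 2) <= K) -> cintegrable mu f.
Proof.
move=> mf fK; apply: (@cintegrable_dominated _ _ _ _ _ (fun x : R1 R => K * (1 + (1 * x + 0) ^+ 2)^-1)) => //.
- apply/integrableP; split.
    apply/measurable_EFinP; apply: measurable_funM; first exact: measurable_cst.
    by apply: (measurable_lorentzian (f := fun x : R1 R => 1 * x + 0)); mfun.
  have K0 : 0 <= K.
    by apply: le_trans (fK 0); rewrite mulr_ge0 ?normc_ge0// addr_ge0// sqr_ge0.
  have l0 (x : R) : 0 <= (1 + (1 * x + 0) ^+ 2)^-1 by rewrite invr_ge0 addr_ge0// sqr_ge0.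
  under eq_integral do rewrite gee0_abs ?lee_fin ?mulr_ge0// EFinM.
  rewrite ge0_integralZl//.
  + by rewrite integral_lorentzian ?oner_eq0// -EFinM ltry.
  + apply/measurable_EFinP.
    by apply: (measurable_lorentzian (f := fun x : R1 R => 1 * x + 0)); mfun.
  + by move=> x _; rewrite lee_fin.
- move=> x; rewrite ler_pdivlMr ?addr0//.
  by rewrite ltr_pwDl// sqr_ge0.
Qed.

Lemma nice1_trapezoid (a b dl : R) : a <= b -> 0 < dl ->
  nice1 (fun x : R1 R => (trapezoid a b dl x)%:C).
Proof.
move=> ab dl0; split; first exact: cintegrable_trapezoid.
apply: (cintegrable_lorentzian _ (fourier1_trapezoid ab dl0 1)).
apply: (cmeasurable_cintegral_param mu (f := fun z : R1 R * R1 R =>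
  expi (- (z.1 * z.2)) * (trapezoid a b dl z.2)%:C)).
apply: cmeasurableM; first by apply: cmeasurable_expi; mfun.
exact: (cmeasurable_comp measurable_snd (cmeasurable_trapezoid a b dl)).
Qed.

Lemma nice1_0 : nice1 (fun _ => 0).
Proof.
have z0 : cintegrable mu (fun _ : R1 R => (0 : R[i])).
  by split; exact: integrable0.
split=> //; rewrite (_ : fourier1 _ = fun=> 0)//.
apply/funext => xi; rewrite /fourier1; under eq_cintegral do rewrite mulr0.
by apply: complex_eq; rewrite /= /Rintegral integral0.
Qed.

End nice_functions.

(** * Functions approximable by nice functions *)

Section approximable.
Context {R : realType}.
Implicit Types f g h : R6 R -> R[i].

Definition approximable f : Prop := forall e : R, 0 < e ->
  exists h, nice h /\ (mixed_norm 1 (fun z => (h z - f z)%R) <= e%:E)%E.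

Lemma nice_cmeasurable h : nice h -> cmeasurable h.
Proof. by case=> hi _; exact: cintegrable_cmeasurable hi. Qed.

Lemma nice_approximable h : nice h -> approximable h.
Proof.
move=> hn e e0; exists h; split => //.
have -> : (fun z => h z - h z) = (fun z => 0 * h z) by apply/funext => z; rewrite subrr mul0r.
rewrite mixed_norm1Z; last exact: nice_cmeasurable.
by rewrite Normc.normc0 mul0e lee_fin ltW.
Qed.

Lemma approximableD f g : cmeasurable f -> cmeasurable g ->
  approximable f -> approximable g -> approximable (fun z => f z + g z).
Proof.
move=> mf mg af ag e e0; have e2 : 0 < e / 2 by rewrite divr_gt0.
have [h [hn hf]] := af _ e2; have [k [kn kg]] := ag _ e2.
exists (fun z => h z + k z); split; first exact: niceD.
have -> : e%:E = ((e / 2)%:E + (e / 2)%:E)%E by rewrite -EFinD -splitr.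
apply: le_trans (leeD hf kg); apply: mixed_norm1_triangle.
- by apply: cmeasurableB => //; exact: nice_cmeasurable.
- by apply: cmeasurableB => //; exact: nice_cmeasurable.
- by move=> z; rewrite opprD addrACA normcD.
Qed.

Lemma approximableZ f (c : R[i]) : cmeasurable f ->
  approximable f -> approximable (fun z => c * f z).
Proof.
move=> mf af e e0; have c0 : 0 < normc c + 1 by rewrite ltr_wpDl// normc_ge0.
have [h [hn hf]] := af (e / (normc c + 1)) (divr_gt0 e0 c0).
exists (fun z => c * h z); split; first exact: niceZ.
have -> : (fun z => c * h z - c * f z) = fun z => c * (h z - f z).
  by apply/funext => z; rewrite mulrBr.
rewrite mixed_norm1Z; last by apply: cmeasurableB => //; exact: nice_cmeasurable.
apply: (@le_trans _ _ ((normc c)%:E * (e / (normc c + 1))%:E)%E).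
  by rewrite lee_wpmul2l// lee_fin normc_ge0.
by rewrite -EFinM lee_fin mulrCA ger_pMr// ler_pdivrMr// mul1r lerDl.
Qed.

Lemma approximable_cvg (f_ : nat -> R6 R -> R[i]) f : (forall k, cmeasurable (f_ k)) ->
  cmeasurable f -> (forall k, approximable (f_ k)) ->
  mixed_norm 1 (fun z => (f_ k z - f z)%R) @[k --> \oo] --> 0%E -> approximable f.
Proof.
move=> mf_ mf af ff e e0; have e2 : 0 < e / 2 by rewrite divr_gt0.
have [k _ /(_ k (leqnn k)) hk] := cvge0_near ff e2.
have [h [hn hf]] := af k _ e2.
exists h; split => //.
have -> : e%:E = ((e / 2)%:E + (e / 2)%:E)%E by rewrite -EFinD -splitr.
apply: le_trans (leeD hf hk); apply: mixed_norm1_triangle.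
- by apply: cmeasurableB => //; exact: nice_cmeasurable.
- exact: cmeasurableB.
- by move=> z; apply: le_trans (normcD _ _); rewrite addrA subrK.
Qed.

Lemma approximable_dominated (f_ : nat -> R6 R -> R[i]) f (r : R6 R -> R[i]) :
  (forall k, cmeasurable (f_ k)) -> cmeasurable f -> cmeasurable r ->
  (mixed_norm 1 r < +oo)%E -> (forall k, approximable (f_ k)) ->
  (forall z, ccvg (f_ ^~ z) (f z)) ->
  (forall k z, normc (f_ k z - f z) <= normc (r z)) -> approximable f.
Proof.
move=> mf_ mf mr roo af ff fr; apply: (approximable_cvg mf_ mf af).
apply: (@mixed_norm1_dominated R (fun k z => f_ k z - f z) r) => //.
  by move=> k; exact: cmeasurableB.
move=> z; have [fR fI] := ff z.
have hR : `|Re (f_ k z - f z)| @[k --> \oo] --> (0 : R).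
  under eq_fun do rewrite ReB.
  have H := cvg_norm (cvgB fR (cvg_cst (Re (f z)))).
  by rewrite subrr normr0 in H; exact: H.
have hI : `|Im (f_ k z - f z)| @[k --> \oo] --> (0 : R).
  under eq_fun do rewrite ImB.
  have H := cvg_norm (cvgB fI (cvg_cst (Im (f z)))).
  by rewrite subrr normr0 in H; exact: H.
have hS : `|Re (f_ k z - f z)| + `|Im (f_ k z - f z)| @[k --> \oo] --> (0 : R).
  by rewrite -[X in _ --> X](addr0 0); exact: cvgD.
apply: (@squeeze_cvgr _ _ _ _ (fun=> 0) (fun k => `|Re (f_ k z - f z)| + `|Im (f_ k z - f z)|)) => //.
- by apply: nearW => k; rewrite normc_ge0 normc_le.
- exact: cvg_cst.
Qed.

End approximable.

(** * Boxes are approximable *)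

Section boxes.
Context {R : realType}.
Local Notation mu := (@lebesgue_measure R).

Lemma mixed_norm1_tensor_lty (F G : R3 R -> R[i]) : cintegrable leb3 F ->
  cintegrable leb3 G -> (forall y, normc (G y) <= 1) ->
  (mixed_norm 1 (tensor6 F G) < +oo)%E.
Proof.
move=> Fi Gi G1.
rewrite mixed_norm1_tensor; [|exact: cintegrable_cmeasurable Fi|exact: cintegrable_cmeasurable Gi].
have G2 : (l2norm leb3 G < +oo)%E.
  have : (\int[leb3]_y (normc (G y) ^+ 2)%:E < +oo)%E.
    apply: le_lt_trans (cintegrable_lty Gi); apply: ge0_le_integralT => y.
      by rewrite lee_fin sqr_ge0.
    by rewrite lee_fin expr2 ler_piMr ?normc_ge0.
  move=> Goo; rewrite l2normE -[X in sqrte X]fineK ?ltry//.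
  by rewrite ge0_fin_numE// integral_ge0// => y _; rewrite lee_fin sqr_ge0.
rewrite lte_mul_pinfty//.
- by apply: integral_ge0 => x _; rewrite lee_fin normc_ge0.
- rewrite ge0_fin_numE; first exact: cintegrable_lty.
  by apply: integral_ge0 => x _; rewrite lee_fin normc_ge0.
Qed.

(** Empty intervals occur when a ray is intersected with the cube; a trapezoid on reversed endpoints
    could still be nonzero, so 0 is used instead. *)
Definition trapezoid_approx (a b : R) (k : nat) (x : R1 R) : R[i] :=
  if a <= b then (trapezoid a b k.+1%:R^-1 x)%:C else 0.

Lemma nice1_trapezoid_approx a b k : nice1 (trapezoid_approx a b k).
Proof.
rewrite /trapezoid_approx; case: (leP a b) => ab; last exact: nice1_0.
by apply: nice1_trapezoid => //; rewrite invr_gt0 ltr0n.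
Qed.

Lemma trapezoid_approx_cvg a b x :
  ccvg (fun k => trapezoid_approx a b k x) (itv_fun a b x).
Proof.
rewrite /trapezoid_approx /itv_fun; case: (leP a b) => ab; last first.
  by rewrite set_itv_ge ?bnd_simp -?ltNge// indic0; exact: ccvg_cst.
split => /=; last exact: cvg_cst.
have k0 k : 0 < k.+1%:R^-1 :> R by rewrite invr_gt0 ltr0n.
have [xab|xab] := boolP (a <= x <= b).
  rewrite indicE mem_set/=; last by rewrite in_itv.
  by under eq_fun do rewrite trapezoid1//; exact: cvg_cst.
rewrite indicE memNset/=; last by rewrite in_itv/=; exact/negP.
(* Off the closed interval there is a gap [d], eventually wider than the overhang [2 / (k + 1)] of
   the trapezoid. *)
have [d d0 hd] : exists2 d : R, 0 < d & (x <= a - d) || (b + d <= x).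
  move: xab; rewrite negb_and -!ltNge => /orP[xa|bx].
  - exists (a - x); first by rewrite subr_gt0.
    by rewrite opprB addrCA subrr addr0 lexx.
  - exists (x - b); first by rewrite subr_gt0.
    by rewrite addrCA subrr addr0 lexx orbT.
apply: cvg_near_cst; near=> k.
have kd : 2 * k.+1%:R^-1 < d.
  rewrite -ltr_pdivlMl// -[X in _ < X]invrK ltf_pV2 ?posrE ?invr_gt0 ?ltr0n ?mulr_gt0 ?invr_gt0//.
  apply: (@lt_le_trans _ _ k%:R); last by rewrite ler_nat.
  by near: k; exact: nbhs_infty_gtr.
apply: trapezoid0 => //; apply/negP => /andP[h1 h2].
suff: d < d by rewrite ltxx.
by move: hd => /orP[] h; move: kd h1 h2 h; move: (k.+1%:R^-1 : R) => q; lra.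
Unshelve. all: by end_near. Qed.

Lemma normc_itv_fun a b a' b' (x : R1 R) : a' <= a -> b <= b' ->
  normc (itv_fun a b x) <= normc (itv_fun a' b' x).
Proof.
move=> aa bb; rewrite !normc_realC !ger0_norm// !indicE.
have [xab|//] := boolP (x \in `[a, b]%classic).
rewrite mem_set//=; move: xab; rewrite inE/= !in_itv/= => /andP[h1 h2].
by rewrite (le_trans aa h1) (le_trans h2 bb).
Qed.

(** The overhang [2 / (k + 1)] is at most 2 on either side, so one interval dominates all the
    approximations. *)
Lemma normc_trapezoid_approx a b k (x : R1 R) :
  normc (trapezoid_approx a b k x) <= normc (itv_fun (a - 2) (b + 2) x).
Proof.
rewrite /trapezoid_approx; case: (leP a b) => ab; last by rewrite Normc.normc0 normc_ge0.
have k0 : 0 < k.+1%:R^-1 :> R by rewrite invr_gt0 ltr0n.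
have k1 : k.+1%:R^-1 <= 1 :> R by rewrite invf_le1 ?ltr0n// ler1n.
rewrite !normc_realC ger0_norm ?trapezoid_ge0// ger0_norm// indicE.
have [_|xn] := boolP (x \in _); first exact: trapezoid_le1.
rewrite trapezoid0//; apply: contra xn => /andP[h1 h2].
by rewrite inE/= in_itv/=; apply/andP; split; move: h1 h2 k1; move: (k.+1%:R^-1 : R) => q; lra.
Qed.

Definition itv3 (a b : R3 R) : R3 R -> R[i] :=
  tensor3 (itv_fun a.1.1 b.1.1) (itv_fun a.1.2 b.1.2) (itv_fun a.2 b.2).

Definition itv6 (a b : R6 R) : R6 R -> R[i] := tensor6 (itv3 a.1 b.1) (itv3 a.2 b.2).

Lemma cintegrable_itv3 a b : cintegrable leb3 (itv3 a b).
Proof. by apply: cintegrable_tensor3; exact: cintegrable_itv_fun. Qed.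

Lemma cintegrable_itv6 a b : cintegrable leb6 (itv6 a b).
Proof. by apply: cintegrable_tensor6; exact: cintegrable_itv3. Qed.

Lemma normc_itv_fun_le1 a b (x : R1 R) : normc (itv_fun a b x) <= 1.
Proof. by rewrite normc_realC ger0_norm// indicE lern1 leq_b1. Qed.

Lemma normc_itv3_le1 a b x : normc (itv3 a b x) <= 1.
Proof.
rewrite /itv3 /tensor3 !Normc.normcM.
have h := normc_itv_fun_le1; have h0 z := @normc_ge0 R z.
by apply: mulr_ile1 => //; [exact: mulr_ge0|apply: mulr_ile1].
Qed.

Lemma mixed_norm1_itv6_lty a b : (mixed_norm 1 (itv6 a b) < +oo)%E.
Proof.
apply: mixed_norm1_tensor_lty; [exact: cintegrable_itv3|exact: cintegrable_itv3|].
by move=> y; exact: normc_itv3_le1.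
Qed.

Lemma normc_tensor6_le (a b c a' b' c' p q r p' q' r' : R1 R -> R[i]) z :
  (forall x, normc (a x) <= normc (p x)) -> (forall x, normc (b x) <= normc (q x)) ->
  (forall x, normc (c x) <= normc (r x)) -> (forall x, normc (a' x) <= normc (p' x)) ->
  (forall x, normc (b' x) <= normc (q' x)) -> (forall x, normc (c' x) <= normc (r' x)) ->
  normc (tensor6 (tensor3 a b c) (tensor3 a' b' c') z) <=
  normc (tensor6 (tensor3 p q r) (tensor3 p' q' r') z).
Proof.
move=> h1 h2 h3 h4 h5 h6; rewrite /tensor6 /tensor3 !Normc.normcM.
have h0 z' := @normc_ge0 R z'.
by apply: ler_pM; rewrite ?mulr_ge0//; apply: ler_pM; rewrite ?mulr_ge0//; apply: ler_pM.
Qed.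

Definition shift6 (z : R6 R) (c : R) : R6 R :=
  ((z.1.1.1 + c, z.1.1.2 + c, z.1.2 + c), (z.2.1.1 + c, z.2.1.2 + c, z.2.2 + c)).

Lemma approximable_itv6 a b : approximable (itv6 a b).
Proof.
pose F k := tensor6
  (tensor3 (trapezoid_approx a.1.1.1 b.1.1.1 k) (trapezoid_approx a.1.1.2 b.1.1.2 k) (trapezoid_approx a.1.2 b.1.2 k))
  (tensor3 (trapezoid_approx a.2.1.1 b.2.1.1 k) (trapezoid_approx a.2.1.2 b.2.1.2 k) (trapezoid_approx a.2.2 b.2.2 k)).
pose W := itv6 (shift6 a (- 2)) (shift6 b 2).
have mW : cmeasurable W := cintegrable_cmeasurable (cintegrable_itv6 _ _).
have Fn k : nice (F k) by apply: nice_tensor; exact: nice1_trapezoid_approx.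
(* [W] dominates both the approximations and the box itself; their difference costs the factor 2. *)
apply: (@approximable_dominated R F _ (fun z => 2%:R%:C * W z)).
- by move=> k; exact: nice_cmeasurable.
- exact: cintegrable_cmeasurable (cintegrable_itv6 _ _).
- by apply: cmeasurableM => //; exact: cmeasurable_cst.
- rewrite mixed_norm1Z// lte_mul_pinfty ?lee_fin ?normc_ge0//.
  exact: mixed_norm1_itv6_lty.
- by move=> k; exact: nice_approximable.
- by move=> z; rewrite /F /itv6 /itv3 /tensor6 /tensor3; do !apply: ccvgM; exact: trapezoid_approx_cvg.
- move=> k z; have h1 : normc (F k z) <= normc (W z).
    by apply: normc_tensor6_le => x; exact: normc_trapezoid_approx.
  have h2 : normc (itv6 a b z) <= normc (W z).
    by apply: normc_tensor6_le => x; apply: normc_itv_fun; rewrite /= ?lerBlDr lerDl.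
  rewrite Normc.normcM normc_realC ger0_norm// mulr_natl mulr2n.
  apply: le_trans (normcD _ _) _; rewrite lerD//.
  by rewrite -sub0r normcBC subr0.
Qed.

End boxes.

(** * Boxes of rays generate the sigma-algebra of R^6 *)

Section boxes_generate.
Context {R : realType}.

(** [None] is the whole line, so that a half-space in a single coordinate is itself a box. *)
Definition ray (o : option R) : set (R1 R) :=
  if o is Some x then `[x, +oo[%classic else setT.

Definition ray_meet (o o' : option R) : option R :=
  match o, o' with
  | Some x, Some y => Some (Num.max x y)
  | Some x, None => Some x
  | None, _ => o'
  end.

Lemma ray_meetP o o' x : ray (ray_meet o o') x <-> ray o x /\ ray o' x.
Proof.
case: o o' => [p|] [q|] /=; rewrite ?in_itv/= ?andbT; try by split; [|case].
by rewrite ge_max; split => [/andP[]//|[-> ->]].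
Qed.

Definition opt3 := (option R * option R * option R)%type.

Definition ray3 (o : opt3) : set (R3 R) :=
  [set x | [/\ ray o.1.1 x.1.1, ray o.1.2 x.1.2 & ray o.2 x.2]].

Definition ray6 (o : opt3 * opt3) : set (R6 R) := [set z | ray3 o.1 z.1 /\ ray3 o.2 z.2].

Definition ray_boxes : set (set (R6 R)) := range ray6.

Definition meet3 (o o' : opt3) : opt3 :=
  (ray_meet o.1.1 o'.1.1, ray_meet o.1.2 o'.1.2, ray_meet o.2 o'.2).

Lemma ray3_meet o o' x : ray3 (meet3 o o') x <-> ray3 o x /\ ray3 o' x.
Proof.
split.
- by case=> /ray_meetP[? ?] /ray_meetP[? ?] /ray_meetP[? ?]; split; split.
- by move=> [[? ? ?] [? ? ?]]; split; apply/ray_meetP.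
Qed.

Lemma ray_boxes_setI : setI_closed ray_boxes.
Proof.
move=> _ _ [p _ <-] [p' _ <-]; exists (meet3 p.1 p'.1, meet3 p.2 p'.2) => //.
apply/seteqP; split => z.
- by case=> /ray3_meet[? ?] /ray3_meet[? ?]; split; split.
- by move=> [[? ?] [? ?]]; split; apply/ray3_meet.
Qed.

(** Each coordinate is measurable for the generated sigma-algebra, as preimages of rays are boxes;
    hence so is the identity map into the product, and [A] is its own preimage. *)
Lemma measurable_ray_boxes (A : set (R6 R)) : measurable A -> <<s ray_boxes >> A.
Proof.
pose X := g_sigma_algebraType ray_boxes.
have coord (p : R6 R -> R1 R) (o : R -> opt3 * opt3) :
    (forall c, preimage p `[c, +oo[%classic = ray6 (o c)) ->
    measurable_fun [set: X] (p : X -> R1 R).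
  move=> po; apply: (measurability (@RGenCInfty.G R)) => [|/= _ [_] [c] -> <-].
    exact: RGenCInfty.measurableE.
  rewrite setTI.
  by apply: sub_sigma_algebra; exists (o c) => //; rewrite po.
have c1 : measurable_fun [set: X] (fun z : X => z.1.1.1).
  apply: (coord (fun z => z.1.1.1) (fun c => ((Some c, None, None), (None, None, None)))) => c.
  by apply/seteqP; split => z /=; [|move=> [[]]].
have c2 : measurable_fun [set: X] (fun z : X => z.1.1.2).
  apply: (coord (fun z => z.1.1.2) (fun c => ((None, Some c, None), (None, None, None)))) => c.
  by apply/seteqP; split => z /=; [|move=> [[]]].
have c3 : measurable_fun [set: X] (fun z : X => z.1.2).
  apply: (coord (fun z => z.1.2) (fun c => ((None, None, Some c), (None, None, None)))) => c.
  by apply/seteqP; split => z /=; [|move=> [[]]].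
have c4 : measurable_fun [set: X] (fun z : X => z.2.1.1).
  apply: (coord (fun z => z.2.1.1) (fun c => ((None, None, None), (Some c, None, None)))) => c.
  by apply/seteqP; split => z /=; [|move=> [_ []]].
have c5 : measurable_fun [set: X] (fun z : X => z.2.1.2).
  apply: (coord (fun z => z.2.1.2) (fun c => ((None, None, None), (None, Some c, None)))) => c.
  by apply/seteqP; split => z /=; [|move=> [_ []]].
have c6 : measurable_fun [set: X] (fun z : X => z.2.2).
  apply: (coord (fun z => z.2.2) (fun c => ((None, None, None), (None, None, Some c)))) => c.
  by apply/seteqP; split => z /=; [|move=> [_ []]].
have idm : measurable_fun [set: X] (fun z : X => ((z.1.1.1, z.1.1.2, z.1.2), (z.2.1.1, z.2.1.2, z.2.2)) : R6 R).
  by do !apply: measurable_fun_pair.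
move=> mA; have := idm measurableT A mA; rewrite setTI.
by rewrite (_ : preimage _ A = A)//; apply/seteqP; split => -[[[? ?] ?] [[? ?] ?]].
Qed.

Lemma measurable_ray6 o : measurable (ray6 o).
Proof.
have mr (p : option R) : measurable (ray p) by case: p => [c|]; [exact: measurable_itv|exact: measurableT].
have mr3 (q : opt3) : measurable (ray3 q).
  rewrite (_ : ray3 q = (ray q.1.1 `*` ray q.1.2) `*` ray q.2).
    by apply: measurableX => //; exact: measurableX.
  by apply/seteqP; split => x [] //= [].
rewrite (_ : ray6 o = ray3 o.1 `*` ray3 o.2); first exact: measurableX.
by apply/seteqP; split => x [].
Qed.

End boxes_generate.

(** * From boxes to measurable sets *)

Section density.
Context {R : realType}.
Implicit Types (A : set (R6 R)) (n : nat).

(** The cube makes the norm finite for every [A], including the whole space, which the lambda-system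
    must contain. *)
Definition indic_box n A : R6 R -> R[i] := fun z => (\1_A z)%:C * box6 n z.

Lemma box6_itv6 n : box6 n = itv6 (shift6 ((0, 0, 0), (0, 0, 0)) (- n%:R)) (shift6 ((0, 0, 0), (0, 0, 0)) n%:R) :> (R6 R -> R[i]).
Proof. by rewrite /itv6 /itv3 /shift6/= !add0r. Qed.

Lemma cmeasurable_indic_box n A : measurable A -> cmeasurable (indic_box n A).
Proof.
move=> mA; apply: cmeasurableM; first exact: cmeasurable_indic.
exact: cintegrable_cmeasurable (cintegrable_box6 n).
Qed.

Lemma mixed_norm1_box6_lty n : (mixed_norm 1 (box6 n : R6 R -> R[i]) < +oo)%E.
Proof. by rewrite box6_itv6; exact: mixed_norm1_itv6_lty. Qed.

Lemma approximable_ray_box n o : approximable (indic_box n (ray6 o)).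
Proof.
(* A ray meets [[-n, n]] in an interval ending at [n]; only the left endpoint depends on the ray. *)
pose lo (o : option R) := if o is Some x then Num.max x (- n%:R) else - n%:R.
pose lo3 (o : opt3) : R3 R := (lo o.1.1, lo o.1.2, lo o.2).
have H := approximable_itv6 (lo3 o.1, lo3 o.2) (shift6 ((0, 0, 0), (0, 0, 0)) n%:R).
have loE (p : option R) (x : R1 R) : itv_fun (lo p) n%:R x = (\1_(ray p) x)%:C * itv_fun (- n%:R) n%:R x.
  rewrite /itv_fun -realCM; congr (_%:C).
  have -> : `[lo p, n%:R]%classic = ray p `&` `[- n%:R, n%:R]%classic.
    apply/seteqP; split => y; case: p => [c|] /=; rewrite ?in_itv/= ?andbT.
    - by rewrite ge_max => /andP[/andP[-> ->] ->].
    - by move=> ->.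
    - by move=> [cy /andP[ny yn]]; rewrite ge_max cy ny yn.
    - by case.
  by rewrite indicI.
suff -> : indic_box n (ray6 o) = itv6 (lo3 o.1, lo3 o.2) (shift6 ((0, 0, 0), (0, 0, 0)) n%:R) by [].
apply/funext => z; rewrite /itv6 /itv3 /tensor6 /tensor3 /shift6 /lo3/= !add0r !loE.
have r3 (q : opt3) (x : R3 R) : (\1_(ray3 q) x : R) = \1_(ray q.1.1) x.1.1 * \1_(ray q.1.2) x.1.2 * \1_(ray q.2) x.2.
  rewrite !indicE; have [h1|h1] := boolP (x.1.1 \in _); last first.
    by rewrite memNset ?mul0r// => -[h _ _]; move/negP: h1; apply; rewrite inE.
  have [h2|h2] := boolP (x.1.2 \in _); last first.
    by rewrite memNset ?mulr0 ?mul0r// => -[_ h _]; move/negP: h2; apply; rewrite inE.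
  have [h3|h3] := boolP (x.2 \in _); last first.
    by rewrite memNset ?mulr0// => -[_ _ h]; move/negP: h3; apply; rewrite inE.
  by rewrite mem_set ?mul1r//; split; exact/set_mem.
have r6 : (\1_(ray6 o) z : R) = \1_(ray3 o.1) z.1 * \1_(ray3 o.2) z.2.
  rewrite !indicE; have [h1|h1] := boolP (z.1 \in _); last first.
    by rewrite memNset ?mul0r// => -[h _]; move/negP: h1; apply; rewrite inE.
  have [h2|h2] := boolP (z.2 \in _); last first.
    by rewrite memNset ?mulr0 ?mul0r// => -[_ h]; move/negP: h2; apply; rewrite inE.
  by rewrite mem_set ?mul1r//; split; exact/set_mem.
by rewrite /indic_box r6 !r3 !realCM /box6 /box3 /tensor6 /tensor3 /box_indic; ring.
Qed.

Lemma approximable_indic_box n A : measurable A -> approximable (indic_box n A).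
Proof.
pose D := [set B : set (R6 R) | measurable B /\ approximable (indic_box n B)].
suff sD : <<s ray_boxes >> `<=` D by move=> /measurable_ray_boxes /sD[].
have mb : cmeasurable (box6 n : R6 R -> R[i]) := cintegrable_cmeasurable (cintegrable_box6 n).
apply: lambda_system_subset => //; first exact: ray_boxes_setI.
split => //.
- split; first exact: measurableT.
  have -> : indic_box n setT = itv6 (shift6 ((0, 0, 0), (0, 0, 0)) (- n%:R)) (shift6 ((0, 0, 0), (0, 0, 0)) n%:R).
    by rewrite -box6_itv6; apply/funext => z; rewrite /indic_box indicT mul1r.
  exact: approximable_itv6.
- move=> E B BE [mE aE] [mB aB]; split; first exact: measurableD.
  have -> : indic_box n (E `\` B) = fun z => indic_box n E z + (- 1) * indic_box n B z.
    apply/funext => z; rewrite /indic_box mulN1r -mulrBl; congr (_ * _).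
    rewrite -rmorphB; congr (_%:C); rewrite !indicE.
    have [zB|zB] := boolP (z \in B).
      rewrite [z \in E]mem_set; last by apply: BE; exact: set_mem.
      by rewrite memNset ?subrr// => -[_]; apply; exact: set_mem.
    rewrite subr0; congr (_%:R); congr nat_of_bool.
    apply/idP/idP => [/set_mem[zA _]|/set_mem zA]; first exact: mem_set.
    by apply: mem_set; split => // zB'; move/negP: zB; apply; exact: mem_set.
  apply: approximableD => //; first exact: cmeasurable_indic_box.
  + by apply: cmeasurableM; [exact: cmeasurable_cst|exact: cmeasurable_indic_box].
  + by apply: approximableZ => //; exact: cmeasurable_indic_box.
- move=> F ndF FD; have mF k : measurable (F k) by case: (FD k).
  have mU : measurable (\bigcup_k F k) by exact: bigcupT_measurable.
  split => //.
  (* Two indicators differ by at most 1, so the cube dominates the differences along the increasing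
     union. *)
  apply: (@approximable_dominated R (fun k => indic_box n (F k)) _ (box6 n)) => //.
  + by move=> k; exact: cmeasurable_indic_box.
  + exact: cmeasurable_indic_box.
  + exact: mixed_norm1_box6_lty.
  + by move=> k; case: (FD k).
  + move=> z; apply: ccvgM; last exact: ccvg_cst.
    split => /=; last exact: cvg_cst.
    have [[k _ Fkz]|zU] := pselect ((\bigcup_k F k) z).
      rewrite [X in _ --> X]indicE mem_set; last by exists k.
      apply: cvg_near_cst; near=> m; rewrite indicE mem_set//.
      have km : (k <= m)%N by near: m; exact: nbhs_infty_ge.
      by have /subsetPset := ndF _ _ km; apply.
    rewrite [X in _ --> X]indicE memNset//.
    apply: cvg_near_cst; near=> m; rewrite indicE memNset// => Fmz.
    by apply: zU; exists m.
  + move=> k z; rewrite /indic_box -mulrBl Normc.normcM -[leRHS]mul1r.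
    rewrite ler_wpM2r ?normc_ge0// -rmorphB normc_realC !indicE.
    by case: (_ \in _); case: (_ \in _); rewrite /= ?subrr ?subr0 ?sub0r ?normrN ?normr1 ?normr0.
- move=> E rE; split; last by case: rE => p _ <-; exact: approximable_ray_box.
  by case: rE => p _ <-; exact: measurable_ray6.
Unshelve. all: by end_near. Qed.

End density.

(** * From measurable sets to functions of finite norm *)

Section approximable_finite_norm.
Import HBNNSimple.
Context {R : realType}.
Implicit Types f : R6 R -> R[i].

Lemma cmeasurable_sum n (f_ : nat -> R6 R -> R[i]) : (forall i, cmeasurable (f_ i)) ->
  cmeasurable (fun z => \sum_(i < n) f_ i z).
Proof.
move=> mf; elim: n => [|n ih].
  by under eq_fun do rewrite big_ord0; exact: cmeasurable_cst.
by under eq_fun do rewrite big_ord_recr/=; exact: cmeasurableD.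
Qed.

Lemma approximable_sum n (f_ : nat -> R6 R -> R[i]) : (forall i, cmeasurable (f_ i)) ->
  (forall i, approximable (f_ i)) -> approximable (fun z => \sum_(i < n) f_ i z).
Proof.
move=> mf af; elim: n => [|n ih].
  have -> : (fun z => \sum_(i < 0) f_ i z) = (fun z => 0 * f_ 0%N z).
    by apply/funext => z; rewrite big_ord0 mul0r.
  exact: approximableZ.
under eq_fun do rewrite big_ord_recr/=.
by apply: approximableD => //; exact: cmeasurable_sum.
Qed.

Lemma approximable_simple n (s : {nnsfun R6 R >-> R}) :
  approximable (fun z : R6 R => (s z)%:C * box6 n z).
Proof.
pose v : seq R := finmap.enum_fset (fset_set (range s)).
pose g i := fun z => (v`_i)%:C * indic_box n (s @^-1` [set v`_i]) z.
have mi i : measurable (s @^-1` [set v`_i]) by exact: measurable_sfunP.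
have -> : (fun z : R6 R => (s z)%:C * box6 n z) = (fun z => \sum_(i < size v) g i z).
  apply/funext => z; rewrite fimfunEord -/v rmorph_sum mulr_suml; apply: eq_bigr => i _.
  by rewrite /g /indic_box mulrA -realCM.
apply: approximable_sum => i.
  by apply: cmeasurableM; [exact: cmeasurable_cst|exact: cmeasurable_indic_box].
by apply: approximableZ; [exact: cmeasurable_indic_box|exact: approximable_indic_box].
Qed.

(** The simple functions increase to [p] while the cubes exhaust the space; cutting off by the cube
    is what brings the simple functions back to indicators already treated. Both the products and
    [p] are at most [p], hence the domination by [2 p]. *)
Lemma approximable_ge0 (p : R6 R -> R) : measurable_fun [set: R6 R] p ->
  (forall z, 0 <= p z) -> (mixed_norm 1 (fun z => (p z)%:C) < +oo)%E ->
  approximable (fun z => (p z)%:C).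
Proof.
move=> mp p0 poo.
have mEp : measurable_fun [set: R6 R] (EFin \o p) by exact/measurable_EFinP.
have mpC : cmeasurable (fun z => (p z)%:C) by exact: cmeasurable_realC.
pose s k := nnsfun_approx measurableT mEp k.
have sp z : s k z @[k --> \oo] --> p z.
  have := @cvg_nnsfun_approx _ _ _ _ measurableT _ mEp (fun x _ => p0 x) z I.
  exact: fine_cvg.
have s_le k z : s k z <= p z.
  rewrite -(cvg_lim _ (sp z))//; apply: nondecreasing_cvgn_le.
    by move=> i j ij; exact/lefP/nd_nnsfun_approx.
  by apply/cvg_ex; exists (p z); exact: sp.
have ms k : cmeasurable (fun z : R6 R => (s k z)%:C) by exact: cmeasurable_realC.
have mb k : cmeasurable (box6 k : R6 R -> R[i]) := cintegrable_cmeasurable (cintegrable_box6 k).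
apply: (@approximable_dominated R (fun k (z : R6 R) => (s k z)%:C * box6 k z) _ (fun z => 2%:R%:C * (p z)%:C)) => //.
- by move=> k; exact: cmeasurableM.
- by apply: cmeasurableM => //; exact: cmeasurable_cst.
- by rewrite mixed_norm1Z// lte_mul_pinfty ?lee_fin ?normc_ge0// mixed_norm_ge0.
- by move=> k; exact: approximable_simple.
- move=> z; rewrite -[X in ccvg _ X]mulr1; apply: ccvgM; last exact: box6_cvg.
  by split; [exact: sp|exact: cvg_cst].
- move=> k z; rewrite [leRHS]Normc.normcM !normc_realC !ger0_norm// mulr_natl mulr2n.
  apply: le_trans (normcD _ _) _; rewrite -[- _]sub0r normcBC subr0 normc_realC ger0_norm// lerD//.
  rewrite Normc.normcM normc_realC ger0_norm//.
  by rewrite -[leRHS]mulr1 ler_pM ?normc_ge0 ?normc_box6.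
Qed.

(** The positive and negative parts of [Re f] and [Im f] are bounded by the modulus of [f], so all
    four have finite norm. *)
Theorem approximable_lty f : cmeasurable f -> (mixed_norm 1 f < +oo)%E -> approximable f.
Proof.
move=> mf foo; have [mR mI] := mf.
have part (p : R6 R -> R) : measurable_fun [set: R6 R] p ->
    (forall z, 0 <= p z) -> (forall z, p z <= normc (f z)) -> approximable (fun z => (p z)%:C).
  move=> mp p0 pf; apply: approximable_ge0 => //; apply: le_lt_trans foo.
  by apply: mixed_norm1_le => z; rewrite normc_realC ger0_norm.
have real (p : R6 R -> R) : measurable_fun [set: R6 R] p ->
    (forall z, `|p z| <= normc (f z)) ->
    cmeasurable (fun z => (p z)%:C) /\ approximable (fun z => (p z)%:C).
  move=> mp pf; split; first exact: cmeasurable_realC.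
  have mpos : measurable_fun [set: R6 R] (fun z => Num.max (p z) 0).
    by apply: measurable_maxr.
  have mneg : measurable_fun [set: R6 R] (fun z => Num.max (- p z) 0).
    by apply: measurable_maxr => //; exact: measurableT_comp.
  have -> : (fun z => (p z)%:C) = (fun z => (Num.max (p z) 0)%:C + (- 1) * (Num.max (- p z) 0)%:C).
    apply/funext => z; rewrite mulN1r -rmorphB; congr (_%:C).
    by case: (leP 0 (p z)) => h; [rewrite max_r ?subr0// oppr_le0
      |rewrite max_l ?sub0r ?opprK// oppr_ge0 ltW].
  apply: approximableD.
  + exact: cmeasurable_realC.
  + by apply: cmeasurableM; [exact: cmeasurable_cst|exact: cmeasurable_realC].
  + apply: part => // z; first by rewrite le_max lexx orbT.
    by rewrite ge_max normc_ge0 (le_trans (ler_norm _)).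
  + apply: approximableZ; first exact: cmeasurable_realC.
    apply: part => // z; first by rewrite le_max lexx orbT.
    by rewrite ge_max normc_ge0 (le_trans (ler_norm _))// normrN.
have [mRe aRe] := real _ mR (fun z => normc_Re (f z)).
have [mIm aIm] := real _ mI (fun z => normc_Im (f z)).
have -> : f = (fun z => (Re (f z))%:C + 'i * (Im (f z))%:C).
  by apply/funext => z; rewrite [LHS]complexE.
apply: approximableD => //; last exact: approximableZ.
by apply: cmeasurableM => //; exact: cmeasurable_cst.
Qed.

End approximable_finite_norm.

(** * Extension by density *)

Section geometric_increments.
Context {R : realType}.

Lemma is_cvg_geometric_increments (a : nat -> R) (B : R) :
  (forall k, `|a k.+1 - a k| <= B * (2^-1) ^+ k) -> cvgn a.
Proof.
move=> aB; have B0 : 0 <= B by have := aB 0%N; rewrite expr0 mulr1; apply: le_trans.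
have sc : cvgn (series (telescope a)).
  apply: normed_cvg; apply: (@series_le_cvg _ _ (geometric B 2^-1)) => //.
  - by move=> k; exact: normr_ge0.
  - by move=> k; rewrite /geometric/= mulr_ge0// exprn_ge0// invr_ge0.
  - by apply: is_cvg_geometric_series; rewrite ger0_norm ?invr_ge0// invf_lt1// ltr1n.
have -> : a = (fun n => a 0%N + series (telescope a) n).
  by apply/funext => n; exact: eq_sum_telescope.
by apply: is_cvgD; [exact: is_cvg_cst|exact: sc].
Qed.

End geometric_increments.

(** * Pointwise and L^2 limits of geometrically Cauchy sequences *)

Section l2_completeness.
Context d (T : measurableType d) (R : realType).
Variable m : {measure set T -> \bar R}.
Variables (G_ : nat -> T -> R[i]) (c : R).
Hypothesis mG : forall k, cmeasurable (G_ k).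
Hypothesis c0 : 0 <= c.
Hypothesis Gc : forall k j, (k <= j)%N ->
  (l2norm m (fun x => (G_ j x - G_ k x)%R) <= (c / 8 ^+ k)%:E)%E.

Let int_sqr_le k j : (k <= j)%N ->
  (\int[m]_x (normc (G_ j x - G_ k x)%R ^+ 2)%:E <= ((c / 8 ^+ k) ^+ 2)%:E)%E.
Proof.
move=> kj; rewrite -(l2norm_sqr m) EFin_expe.
by rewrite expe2 expe2; apply: lee_pmul; rewrite ?l2norm_ge0//; exact: (Gc kj).
Qed.

Lemma l2_cauchy_ae :
  {ae m, forall x, cvgn (fun k => Re (G_ k x)) /\ cvgn (fun k => Im (G_ k x))}.
Proof.
(* The sum of the [w k] is integrable, so [|G_ k.+1 - G_ k| = O(2 ^- k)] almost
   everywhere. *)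
pose w k x : \bar R := (4 ^+ k * normc (G_ k.+1 x - G_ k x)%R ^+ 2)%:E.
have w0 k x : (0 <= w k x)%E by rewrite lee_fin mulr_ge0 ?exprn_ge0 ?normc_ge0.
have mw k : measurable_fun [set: T] (w k).
  apply/measurable_EFinP; apply: measurable_funM; first exact: measurable_cst.
  by apply: measurable_funX; apply: cmeasurable_normc; exact: cmeasurableB.
pose W x : \bar R := (\sum_(k <oo) w k x)%E.
have intW : (\int[m]_x W x < +oo)%E.
  rewrite /W integral_nneseries//.
  apply: (@le_lt_trans _ _ (2 * c ^+ 2)%:E); last exact: ltry.
  (* The term [4^k (c / 8^k)^2 = c^2 / 16^k] is at most [2 c^2 / 2^(k+1)], a series with sum
     [2 c^2]. *)
  apply: le_trans (epsilon_trick0 xpredT _); last by rewrite mulr_ge0// sqr_ge0.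
  apply: lee_nneseries => k _; first by move=> _; apply: integral_ge0 => x _; exact: w0.
  under eq_integral do rewrite /w EFinM.
  rewrite ge0_integralZl//; last 2 first.
  - by apply/measurable_EFinP; apply: measurable_funX; apply: cmeasurable_normc; exact: cmeasurableB.
  - by move=> x _; rewrite lee_fin sqr_ge0.
  apply: (@le_trans _ _ ((4 ^+ k)%:E * ((c / 8 ^+ k) ^+ 2)%:E)%E).
    by rewrite lee_wpmul2l ?lee_fin ?exprn_ge0// int_sqr_le.
  rewrite -EFinM lee_fin natrX [2%:R ^+ k.+1]exprS.
  have -> : (4 : R) = 2 ^+ 2 by rewrite -natrX.
  have -> : (8 : R) = 2 ^+ 3 by rewrite -natrX.
  rewrite -!exprM ![(_ * k)%N]mulnC !exprM.
  have p1 : 1 <= 2 ^+ k :> R by rewrite exprn_ege1// ler1n.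
  move: (2 ^+ k) p1 => p p1; have p0 : 0 < p by rewrite (lt_le_trans _ p1).
  have -> : p ^+ 2 * (c / p ^+ 3) ^+ 2 = c ^+ 2 / p * (p ^+ 3)^-1 by field; rewrite gt_eqF.
  have -> : 2 * c ^+ 2 / (2 * p) = c ^+ 2 / p by field; rewrite gt_eqF.
  rewrite ler_piMr ?divr_ge0 ?sqr_ge0 ?(ltW p0)//.
  by rewrite invf_le1 ?exprn_gt0// exprn_ege1.
have iW : m.-integrable [set: T] W.
  apply/integrableP; split; first exact: ge0_emeasurable_sum.
  by under eq_integral do rewrite gee0_abs ?nneseries_ge0//.
have := integrable_ae measurableT iW; apply: filterS => x /(_ I) Wx.
pose B := Num.sqrt (fine (W x)).
have step k : normc (G_ k.+1 x - G_ k x)%R <= B * 2^-1 ^+ k.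
  have : (w k x <= W x)%E.
    apply: le_trans (nneseries_lim_ge k.+1 _) => [|i _ _]; last exact: w0.
    by rewrite big_nat_recr//= leeDr// sume_ge0.
  rewrite -(fineK Wx) lee_fin => wW.
  move: wW; have h : 4 ^+ k * normc (G_ k.+1 x - G_ k x)%R ^+ 2 = (2 ^+ k * normc (G_ k.+1 x - G_ k x)%R) ^+ 2.
    have -> : (4 : R) = 2 ^+ 2 by rewrite -natrX.
    by rewrite !exprMn expr2.
  rewrite h => /ler_wsqrtr; rewrite sqrtr_sqr ger0_norm; last first.
    by rewrite mulr_ge0 ?exprn_ge0 ?normc_ge0.
  by rewrite exprVn ler_pdivlMr ?exprn_gt0// mulrC.
split; apply: (@is_cvg_geometric_increments _ _ B) => k; apply: le_trans (step k).
  by rewrite -ReB normc_Re.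
by rewrite -ImB normc_Im.
Qed.

(** Fatou in [j] applied to the squared modulus of [G_ j - G_ k]: the Cauchy bound with [k] fixed
    survives the limit. *)
Lemma l2_cauchy_limit G k : cmeasurable G ->
  {ae m, forall x, ccvg (G_ ^~ x) (G x)} ->
  (l2norm m (fun x => (G_ k x - G x)%R) <= (c / 8 ^+ k)%:E)%E.
Proof.
move=> mG0 GG.
have k0 : 0 <= c / 8 ^+ k by rewrite divr_ge0 ?exprn_ge0.
apply: (@Lnorm2_le _ _ _ m (fun x => normc (G_ k x - G x)%R) _ k0).
pose s j x : \bar R := (normc (G_ j x - G_ k x)%R ^+ 2)%:E.
have ms j : measurable_fun [set: T] (s j).
  by apply/measurable_EFinP; apply: measurable_funX; apply: cmeasurable_normc; exact: cmeasurableB.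
have s0 j x : (0 <= s j x)%E by rewrite lee_fin sqr_ge0.
have sG x : ccvg (G_ ^~ x) (G x) -> s j x @[j --> \oo] --> (normc (G_ k x - G x)%R ^+ 2)%:E.
  move=> [gR gI]; apply: cvg_EFin; first exact: nearW.
  rewrite normcBC normc_sqr ReB ImB.
  have -> : fine \o s ^~ x = fun j =>
      (Re (G_ j x) - Re (G_ k x)) ^+ 2 + (Im (G_ j x) - Im (G_ k x)) ^+ 2.
    by apply/funext => j; rewrite /s /= normc_sqr ReB ImB.
  by apply: cvgD; rewrite !expr2; under eq_fun do rewrite expr2; apply: cvgM;
    apply: cvgB => //; exact: cvg_cst.
have -> : (\int[m]_x (normc (G_ k x - G x)%R ^+ 2)%:E = \int[m]_x limn_einf (s ^~ x))%E.
  apply: ge0_ae_eq_integral => //.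
  - by apply/measurable_EFinP; apply: measurable_funX; apply: cmeasurable_normc; exact: cmeasurableB.
  - under eq_fun do rewrite -[limn_einf _]oppeK -limn_esupN.
    apply: measurableT_comp => //.
    by apply: measurable_fun_limn_esup => j; exact: measurableT_comp.
  - by move=> x _; rewrite lee_fin sqr_ge0.
  - move=> x _; rewrite limn_einf_lim; apply: lime_ge; first exact: is_cvg_einfs.
    by apply: nearW => n; apply: le_ereal_inf_tmp => _ [j _ <-].
  - by apply: filterS GG => x /sG /cvg_limn_einf_sup[-> _].
apply: le_trans (fatou m measurableT ms (fun j x _ => s0 j x)) _.
rewrite limn_einf_lim; apply: lime_le; first exact: is_cvg_einfs.
(* The infimum over indices from [n] on is tested at [maxn n k], where the Cauchy bound is
   available. *)
apply: nearW => n; apply: (@le_trans _ _ (\int[m]_x s (maxn n k) x)%E).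
  by apply: ereal_inf_lbound; exists (maxn n k) => //=; exact: leq_maxl.
by apply: int_sqr_le; exact: leq_maxr.
Qed.

End l2_completeness.

Lemma LnormooE d (T : measurableType d) (R : realType) (m : {measure set T -> \bar R}) (a : T -> \bar R) :
  Lnorm m +oo a = (if (0 < m [set: T])%E then ess_sup m (abse \o a) else 0%E).
Proof. by rewrite unlock. Qed.

(** * The mixed norm with essential supremum *)

Section mixed_norm_infinity.
Context {R : realType}.
Local Open Scope ereal_scope.
Implicit Types h : R6 R -> R[i].

(** On a space of measure zero the L^oo norm is 0 by convention; positivity selects the branch with
    the essential supremum. *)
Lemma leb3_setT_gt0 : 0 < leb3 [set: R3 R].
Proof.
have m0 : 0 < @lebesgue_measure R [set: R1 R].
  have m01 : @lebesgue_measure R `[0%R, 1%R]%classic = 1.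
    by rewrite lebesgue_measure_itv/= lte_fin ltr01 oppr0 adde0.
  apply: (@lt_le_trans _ _ (@lebesgue_measure R `[0%R, 1%R]%classic)).
    by rewrite m01 lte_fin ltr01.
  by apply: le_measure; rewrite ?inE//; exact: measurable_itv.
have -> : leb3 [set: R3 R] = leb2 [set: R1 R * R1 R] * @lebesgue_measure R [set: R1 R].
  by rewrite -[in LHS]setXTT; exact: (product_measure1E leb2 (@lebesgue_measure R)).
have -> : leb2 [set: R1 R * R1 R] = @lebesgue_measure R [set: R1 R] * @lebesgue_measure R [set: R1 R].
  by rewrite -[in LHS]setXTT; exact: (product_measure1E (@lebesgue_measure R) (@lebesgue_measure R)).
by rewrite !mule_gt0.
Qed.

Lemma mixed_normoo_le h (B : \bar R) : 0 <= B ->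
  {ae leb3, forall u, l2norm leb3 (slice h u) <= B} -> mixed_norm +oo h <= B.
Proof.
move=> B0 hB; rewrite /mixed_norm LnormooE; case: ifPn => // _.
apply/ess_supP; apply: filterS hB => u hu.
by rewrite /comp gee0_abs//; exact: Lnorm_ge0.
Qed.

Lemma mixed_normoo_ae h :
  {ae leb3, forall u, l2norm leb3 (slice h u) <= mixed_norm +oo h}.
Proof.
rewrite /mixed_norm LnormooE leb3_setT_gt0.
have := @ess_sup_ge _ _ _ (leb3 : {measure set _ -> \bar R}) (abse \o (fun x => l2norm leb3 (slice h x))).
apply: filterS => u; apply: le_trans.
by rewrite /comp gee0_abs//; exact: l2norm_ge0.
Qed.

End mixed_norm_infinity.

Section extension_by_density.
Context {R : realType}.
Variables (t sg : R).
Hypothesis t0 : 0 < t.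
Implicit Types f g : R6 R -> R[i].
Let K : R := dispersion_const / t `^ (3 / 2).
Let N : (R6 R -> R[i]) -> \bar R := mixed_norm 1.
(** For [sg = 1] this is [norm_diff_sum +oo]; [sg = -1] is the case to which the second estimate is
    reduced. *)
Let M g := mixed_norm +oo (fun z => g (rot sg z)).

Let K0 : 0 < K. Proof. by rewrite divr_gt0 ?dispersion_const_gt0 ?powR_gt0. Qed.

Let N0 f : (0 <= N f)%E. Proof. exact: mixed_norm_ge0. Qed.

Lemma propagatorB f g z : cintegrable leb6 f -> cintegrable leb6 g ->
  propagator t (fun w => f w - g w) z = propagator t f z - propagator t g z.
Proof.
move=> fi gi; have gp (h : R6 R -> R[i]) : cintegrable leb6 h ->
    cintegrable leb6 (fun w => gauss_phase t z w * h w).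
  move=> hi; apply: (@cintegrableM_bounded _ _ _ _ _ _ 1) => //.
  - by apply: cmeasurable_gauss_phase; mfun.
  - by move=> w; rewrite normc_expi.
rewrite /propagator -mulrBr -cintegralB; [|exact: gp..].
by congr (_ * _); apply: eq_cintegral => w; rewrite mulrBr.
Qed.

(** The bound is proved for an arbitrary [g] reached by some approximating sequence, and passes to
    it by two triangle inequalities, so it does not depend on how the extension was constructed. *)
Lemma evolves_to_le f g : cmeasurable f -> evolves_to N M t f g ->
  (M g <= K%:E * N f)%E.
Proof.
move=> mf [mg [f_ [fn Nf Mf]]]; apply/lee_addgt0Pr => e e0.
have e2 : 0 < e / 2 by rewrite divr_gt0.
near \oo => n.
have Nn : (N (fun z => (f_ n z - f z)%R) <= (e / 2 / K)%:E)%E.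
  (* The tolerance [e / 2 / K] becomes [e / 2] once multiplied by the constant of the estimate. *)
  by near: n; apply: (cvge0_near Nf); rewrite divr_gt0.
have Mn : (M (fun z => (schrodinger t (f_ n) z - g z)%R) <= (e / 2)%:E)%E.
  by near: n; exact: (cvge0_near Mf).
have [fi _] := fn n; have mfn := cintegrable_cmeasurable fi.
have Nfn : (N (f_ n) <= N f + (e / 2 / K)%:E)%E.
  apply: le_trans (leeD (lexx (N f)) Nn); apply: mixed_norm1_triangle => //.
    exact: cmeasurableB.
  by move=> z; have h := normcD (f z) (f_ n z - f z); rewrite addrCA subrr addr0 in h.
apply: (@le_trans _ _ (K%:E * N (f_ n) + (e / 2)%:E)%E); last first.
  apply: (@le_trans _ _ (K%:E * (N f + (e / 2 / K)%:E) + (e / 2)%:E)%E).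
    by rewrite leeD2r// lee_wpmul2l// lee_fin ltW.
  rewrite ge0_muleDr//; last by rewrite lee_fin divr_ge0 ?(ltW e2) ?(ltW K0).
  rewrite -EFinM mulrC divfK ?gt_eqF// -addeA -EFinD -splitr.
  by [].
apply: mixed_normoo_le.
  by rewrite adde_ge0// ?mule_ge0// lee_fin ltW.
have := mixed_normoo_ae (fun z => schrodinger t (f_ n) (rot sg z) - g (rot sg z)).
apply: filterS => u hu.
apply: le_trans (leeD (propagator_apriori sg u t0 fi) (le_trans hu Mn)).
apply: l2norm_triangle.
- exact: (cmeasurable_comp (measurable_rot_slice sg u) (cmeasurable_propagator t mfn)).
- have -> : slice (fun z => schrodinger t (f_ n) (rot sg z) - g (rot sg z)) u =
      (fun v => propagator t (f_ n) (rot sg (u, v)) - g (rot sg (u, v))).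
    by apply/funext => v; rewrite /slice schrodingerE.
  apply: cmeasurableB.
  + exact: (cmeasurable_comp (measurable_rot_slice sg u) (cmeasurable_propagator t mfn)).
  + exact: (cmeasurable_comp (measurable_rot_slice sg u) mg).
- move=> v; rewrite /slice schrodingerE// [X in _ + X]normcBC.
  have := normcD (propagator t (f_ n) (rot sg (u, v))) (g (rot sg (u, v)) - propagator t (f_ n) (rot sg (u, v))).
  rewrite addrCA subrr addr0 => h; exact: h.
Unshelve. all: by end_near. Qed.

Lemma cvge0_geometric (a : nat -> \bar R) (c : R) : (forall k, 0 <= a k)%E ->
  (forall k, a k <= (c / 8 ^+ k)%:E)%E -> a k @[k --> \oo] --> 0%E.
Proof.
move=> a0 ac; apply: cvge0I => // e e0.
have h : geometric c (8^-1) @ \oo --> (0 : R).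
  by apply: cvg_geometric; rewrite ger0_norm ?invr_ge0// invf_lt1// ltr1n.
have /cvgrPdist_le /(_ e e0) := h; apply: filterS => k.
rewrite sub0r normrN /geometric/= => hk; apply: le_trans (ac k) _.
by rewrite lee_fin -exprVn (le_trans (ler_norm _)).
Qed.

Lemma evolves_to_exists f : cmeasurable f -> (N f < +oo)%E ->
  exists g, evolves_to N M t f g.
Proof.
move=> mf foo; have af := approximable_lty mf foo.
(* The rate [8^-k] is the one for which [l2_cauchy_ae] yields pointwise convergence. *)
have e0 k : 0 < 1 / 8 ^+ k :> R by rewrite divr_gt0// exprn_gt0.
have [f_ fP] := choice (fun k => af _ (e0 k)).
have fn k : nice (f_ k) by have [] := fP k.
have Nf k : (N (fun z => (f_ k z - f z)%R) <= (1 / 8 ^+ k)%:E)%E by have [] := fP k.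
have mf_ k : cmeasurable (f_ k) by exact: nice_cmeasurable.
pose F k := propagator t (f_ k).
have mF k : cmeasurable (F k) by exact: cmeasurable_propagator.
(* Upper limits are defined and measurable everywhere and agree with the limit wherever it exists;
   the same [g] therefore serves all slices. *)
pose g z : R[i] := Complex (fine (limn_esup (fun k => (Re (F k z))%:E)))
                           (fine (limn_esup (fun k => (Im (F k z))%:E))).
have mg : cmeasurable g.
  split; apply: measurableT_comp => //; apply: measurable_fun_limn_esup => k;
    by apply/measurable_EFinP; case: (mF k).
have gE z : cvgn (fun k => Re (F k z)) /\ cvgn (fun k => Im (F k z)) -> ccvg (F ^~ z) (g z).
  have lE (a : nat -> R) : cvgn a -> a k @[k --> \oo] --> fine (limn_esup (fun k => (a k)%:E)).
    move=> ca; have : (a k)%:E @[k --> \oo] --> (limn a)%:E.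
      by apply: cvg_EFin; [exact: nearW|exact: ca].
    by move=> /cvg_limn_einf_sup[_ ->]; exact: ca.
  by move=> [cR cI]; split; exact: lE.
(* The 2 comes from comparing both [f_ j] and [f_ k] with [f]: [8^-j + 8^-k] is at most
   [2 / 8^k]. *)
have Fc u k j : (k <= j)%N ->
    (l2norm leb3 (fun v => (F j (rot sg (u, v)) - F k (rot sg (u, v)))%R) <= (2 * K / 8 ^+ k)%:E)%E.
  move=> kj; have [fji _] := fn j; have [fki _] := fn k.
  have -> : (fun v => F j (rot sg (u, v)) - F k (rot sg (u, v))) =
      (fun v => propagator t (fun z => f_ j z - f_ k z) (rot sg (u, v))).
    by apply/funext => v; rewrite propagatorB.
  apply: le_trans (propagator_apriori sg u t0 (cintegrableB fji fki)) _.
  have -> : 2 * K / 8 ^+ k = K * (2 / 8 ^+ k) by rewrite -mulrA mulrCA.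
  rewrite -/K [(K * (2 / 8 ^+ k))%:E]EFinM lee_wpmul2l ?lee_fin ?(ltW K0)//.
  apply: (@le_trans _ _ ((1 / 8 ^+ j)%:E + (1 / 8 ^+ k)%:E)%E).
    apply: le_trans (leeD (Nf j) (Nf k)); apply: mixed_norm1_triangle.
    - exact: cmeasurableB.
    - exact: cmeasurableB.
    - move=> z; rewrite [normc (f_ k z - f z)]normcBC; apply: le_trans (normcD _ _).
      by rewrite addrA subrK.
  have : (1 / 8 ^+ j <= 1 / 8 ^+ k :> R).
    by rewrite !div1r lef_pV2 ?posrE ?exprn_gt0// ler_weXn2l// ler1n.
  rewrite -EFinD lee_fin; move: (8 ^+ j) (8 ^+ k) => p q; lra.
have Mk k : (M (fun z => (schrodinger t (f_ k) z - g z)%R) <= (2 * K / 8 ^+ k)%:E)%E.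
  apply: mixed_normoo_le.
    by rewrite lee_fin divr_ge0 ?exprn_ge0// mulr_ge0// ltW.
  (* The estimate holds for every [u]; a null set appears only inside the slice, as a set of [v]
     that may depend on [u]. *)
  apply: aeW => u.
  have -> : slice (fun z => schrodinger t (f_ k) (rot sg z) - g (rot sg z)) u =
      (fun v => F k (rot sg (u, v)) - g (rot sg (u, v))).
    by apply/funext => v; rewrite /slice schrodingerE.
  have mG j : cmeasurable (fun v => F j (rot sg (u, v))).
    exact: (cmeasurable_comp (measurable_rot_slice sg u) (mF j)).
  have K2 : 0 <= 2 * K by rewrite mulr_ge0// ltW.
  apply: (l2_cauchy_limit mG K2 (Fc u)).
    exact: (cmeasurable_comp (measurable_rot_slice sg u) mg).
  by have := l2_cauchy_ae mG (Fc u); apply: filterS => v; exact: gE.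
exists g; split => //; exists f_; split => //.
- by apply: (@cvge0_geometric _ 1) => // k; exact: mixed_norm_ge0.
- by apply: (@cvge0_geometric _ (2 * K)) => // k; exact: mixed_norm_ge0.
Qed.

End extension_by_density.

(** * The evolution commutes with rotations *)

Section rotation_invariance.
Context {R : realType}.
Variable s : R.
Hypothesis s1 : s ^+ 2 = 1.
Implicit Types f g : R6 R -> R[i].

Lemma rotNK : cancel (rot (- s)) (rot s).
Proof. by move=> z; rewrite -[s in rot s]opprK rotK// sqrrN. Qed.

Lemma cmeasurable_rot f : cmeasurable f -> cmeasurable (fun z => f (rot s z)).
Proof. by move=> mf; exact: (cmeasurable_comp (measurable_rot s) mf). Qed.

Lemma fourier_rot f p : cintegrable leb6 f ->
  fourier (fun z => f (rot s z)) p = fourier f (rot s p).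
Proof.
move=> fi; rewrite /fourier.
rewrite -(cintegral_preserves (preserves_integral_rot s1) (cintegrable_cmeasurable (cintegrable_character6 (rot s p) fi))).
by apply: eq_cintegral => z; rewrite dot6_rot.
Qed.

Lemma nice_rot f : nice f -> nice (fun z => f (rot s z)).
Proof.
move=> [fi Ffi]; split; first exact: (cintegrable_preserves (preserves_integral_rot s1)).
rewrite (_ : fourier _ = fun p => fourier f (rot s p)).
  exact: (cintegrable_preserves (preserves_integral_rot s1)).
by apply/funext => p; exact: fourier_rot.
Qed.

Lemma schrodinger_rot t f z : nice f ->
  schrodinger t (fun w => f (rot s w)) z = schrodinger t f (rot s z).
Proof.
move=> [fi Ffi]; rewrite /schrodinger; apply: (congr1 (GRing.mul _)).
pose h w p := expi (dot6 p w) * expi (- (t * dot6 p p)) * fourier f p.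
have mh w : cmeasurable (h w).
  apply: cmeasurableM; last exact: cintegrable_cmeasurable Ffi.
  by apply: cmeasurableM; apply: cmeasurable_expi; mfun6.
apply: etrans (cintegral_preserves (preserves_integral_rot s1) (mh (rot s z))).
by apply: eq_cintegral => p; rewrite /h !dot6_rot// fourier_rot.
Qed.

(** The approximating sequence is rotated along with [f] and [g], and the new norms undo the
    rotation, so the two convergences are literally the old ones. *)
Lemma evolves_to_rot (P Q : (R6 R -> R[i]) -> \bar R) t f g : evolves_to P Q t f g ->
  evolves_to (fun h => P (fun z => h (rot (- s) z))) (fun h => Q (fun z => h (rot (- s) z)))
    t (fun z => f (rot s z)) (fun z => g (rot s z)).
Proof.
move=> [mg [f_ [fn Pf Qf]]]; split; first exact: cmeasurable_rot.
exists (fun n z => f_ n (rot s z)); split.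
- by move=> n; exact: nice_rot.
- have -> : (fun n => P (fun z => f_ n (rot s (rot (- s) z)) - f (rot s (rot (- s) z)))) =
      (fun n => P (fun z => f_ n z - f z)).
    by apply/funext => n; congr P; apply/funext => z; rewrite rotNK.
  exact: Pf.
- have -> : (fun n => Q (fun z => schrodinger t (fun w => f_ n (rot s w)) (rot (- s) z)
      - g (rot s (rot (- s) z)))) = (fun n => Q (fun z => schrodinger t (f_ n) z - g z)).
    apply/funext => n; apply: (congr1 Q); apply/funext => z; rewrite rotNK.
    by rewrite (schrodinger_rot t (rot (- s) z) (fn n)) rotNK.
  exact: Qf.
Qed.

End rotation_invariance.

Theorem proposition2p20 (R : realType) :
  exists C : R, forall (t : R), 0 < t -> forall (f : R6 R -> R[i]), cmeasurable f ->
    ((norm_x_y 1%E f < +oo)%E ->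
      (exists g, evolves_to (norm_x_y 1%E) (norm_diff_sum +oo%E) t f g) /\
      (forall g, evolves_to (norm_x_y 1%E) (norm_diff_sum +oo%E) t f g ->
        (norm_diff_sum +oo g <= (C / (t `^ (3 / 2)))%:E * norm_x_y 1 f)%E)) /\
    ((norm_diff_sum 1%E f < +oo)%E ->
      (exists g, evolves_to (norm_diff_sum 1%E) (norm_x_y +oo%E) t f g) /\
      (forall g, evolves_to (norm_diff_sum 1%E) (norm_x_y +oo%E) t f g ->
        (norm_x_y +oo g <= (C / (t `^ (3 / 2)))%:E * norm_diff_sum 1 f)%E)).
Proof.
exists dispersion_const => t t0 f mf.
have nds q : norm_diff_sum q = (fun h => mixed_norm q (fun z => h (rot 1 z))) :> (_ -> \bar R).
  by apply/funext => h; rewrite /norm_diff_sum in_diff_sumE.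
have s1 : (1 : R) ^+ 2 = 1 by rewrite expr1n.
have sN1 : (- 1 : R) ^+ 2 = 1 by rewrite sqrrN expr1n.
have r1 := rotNK s1.
have rN1 q : (fun h => mixed_norm q (fun z => h (rot (- 1) (rot 1 z)))) = mixed_norm q :> ((R6 R -> R[i]) -> _).
  by apply/funext => h; apply: (congr1 (mixed_norm q)); apply/funext => z; rewrite rotK.
have r1N q : (fun h => mixed_norm q (fun z => h (rot 1 (rot (- 1) z)))) = mixed_norm q :> ((R6 R -> R[i]) -> _).
  by apply/funext => h; apply: (congr1 (mixed_norm q)); apply/funext => z; rewrite r1.
have nxy q : norm_x_y q = mixed_norm q :> ((R6 R -> R[i]) -> _) by [].
split=> foo; rewrite !nds !nxy in foo *.
  split; first exact: evolves_to_exists.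
  by move=> g; exact: evolves_to_le.
(* For the second estimate the datum is [f] read in the variables [(u, v)]: its L^1 L^2 norm is
   [norm_diff_sum 1 f], and [rot (- 1)] leads back to [(x, y)]. *)
have mf1 := cmeasurable_rot 1 mf.
have to_N1 g : evolves_to (fun h => mixed_norm 1 (fun z => h (rot 1 z))) (mixed_norm +oo) t f g ->
    evolves_to (mixed_norm 1) (fun h => mixed_norm +oo (fun z => h (rot (- 1) z))) t
      (fun z => f (rot 1 z)) (fun z => g (rot 1 z)).
  by move=> /(evolves_to_rot s1) ge; rewrite -(rN1 1%E); exact: ge.
split.
  (* The extension is built for the rotated datum and then carried back by the inverse rotation. *)
  have [g ge] := evolves_to_exists (- 1) t0 mf1 foo.
  have ge1 := evolves_to_rot sN1 ge.
  have fE : (fun z => f (rot 1 (rot (- 1) z))) = f by apply/funext => z; rewrite r1.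
  rewrite opprK fE in ge1.
  by exists (fun z => g (rot (- 1) z)); rewrite -(r1N +oo%E); exact: ge1.
move=> g /to_N1 ge; have := evolves_to_le t0 mf1 ge.
have -> : (fun z => g (rot 1 (rot (- 1) z))) = g by apply/funext => z; rewrite r1.
by [].
Qed.
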